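(* Let $R$ be either a Noetherian local ring or a finitely generated graded $K$-algebra ($K$ a field, $R=\bigoplus_{i\ge 0}R_i$, $R_0=K$). Assume that $R$ is a normal Cohen--Macaulay domain with a canonical module $\omega_R$, and that the divisor class group $\mathrm{Cl}(R)$ is a finitely generated abelian group. Let $d(R)$ be the torsion number of $R$. Then $R$ is Gorenstein if and only if $d(R)=0$.
   Context: The canonical module $\omega_R$ is identified with a divisorial ideal of $R$, and $[\omega_R]$ denotes its class in the divisor class group $\mathrm{Cl}(R)$ (written additively). In the graded case $\omega_R$ is the graded canonical module. Reduced divisor class group: $\overline{\mathrm{Cl}}(R)=\mathrm{Cl}(R)/\mathbb{Z}[\omega_R]$. Fitting ideals: for a finitely generated abelian group $G$ with generators $u_1,\dots,u_n$ and integer relation matrix $A$ (so that $G$ is the quotient of $\mathbb{Z}^n$ by the subgroup spanned by the relation vectors recorded in $A$), the $i$th Fitting ideal is $\mathrm{Fitt}_i(G)=I_{n-i}(A)\subseteq\mathbb{Z}$, the ideal generated by the $(n-i)$-minors of $A$ (with $I_k(A)=\mathbb{Z}$ for $k\le 0$, and $I_k(A)=0$ if $A$ has no $k$-minors). It does not depend on the choices of generators and relations, and $\mathrm{rank}\,G=\min\{i:\mathrm{Fitt}_i(G)\ne 0\}$. Torsion number: let $r=\mathrm{rank}\,\overline{\mathrm{Cl}}(R)$. If $\mathrm{Fitt}_r(\mathrm{Cl}(R))=\mathrm{Fitt}_r(\overline{\mathrm{Cl}}(R))$, set $d(R)=0$. Otherwise $d(R)$ is the nonnegative integer with $\mathrm{Fitt}_r(\overline{\mathrm{Cl}}(R))=(d(R))$.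 *)

(* Defs.v *)
From HB Require Import structures.
From mathcomp Require Import all_boot all_order all_algebra.
From mathcomp Require Import boolp classical_sets.

Set Implicit Arguments.
Unset Strict Implicit.
Unset Printing Implicit Defensive.
Import GRing.Theory.
Local Open Scope ring_scope.
Local Open Scope quotient_scope.

Notation "x %:F" := (@FracField.tofrac _ x).

Definition fg_submod (R : pzRingType) (V : lmodType R) (N : {pred V}) : Prop :=
  exists s : seq V, {subset s <= N} /\
    forall N' : {pred V}, GRing.submod_closed N' -> {subset s <= N'} ->
      {subset N <= N'}.

Definition fg_module (R : pzRingType) (V : lmodType R) : Prop :=
  fg_submod (predT : {pred V}).

Definition noetherian (R : comNzRingType) : Prop :=
  forall I : {pred R^o}, GRing.submod_closed I -> fg_submod I.

(* [idealr_closed] already says that the ideal is proper. *)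
Definition maximal_ideal (R : comNzRingType) (m : {pred R}) : Prop :=
  idealr_closed m /\
  forall J : {pred R}, idealr_closed J -> {subset m <= J} -> {subset J <= m}.

Definition local_ring (R : comNzRingType) : Prop :=
  exists m : {pred R}, maximal_ideal m /\
    forall m' : {pred R}, maximal_ideal m' -> m' =i m.

Definition integrally_closed (R : idomainType) : Prop :=
  forall x : {fraction R},
    integralOver (@FracField.tofrac R) x -> exists a : R, x = a%:F.

(* V is the direct sum of the additive subgroups H i. *)
Definition grading (V : zmodType) (I : eqType) (H : I -> {pred V}) : Prop :=
  [/\ forall i, zmod_closed (H i),
      forall x, exists (s : seq I) (c : I -> V),
        (forall i, c i \in H i) /\ x = \sum_(i <- s) c i
    & forall (s : seq I) (c : I -> V), uniq s -> (forall i, c i \in H i) ->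
        \sum_(i <- s) c i = 0 -> forall i, i \in s -> c i = 0].

Definition graded_algebra (K : fieldType) (R : comNzRingType)
    (iota : {rmorphism K -> R}) (G : nat -> {pred R}) : Prop :=
  [/\ grading G,
      forall i j x y, x \in G i -> y \in G j -> x * y \in G (i + j)%N
    & forall x, x \in G 0%N <-> exists a, x = iota a].

Definition fg_algebra (K : fieldType) (R : comNzRingType)
    (iota : {rmorphism K -> R}) : Prop :=
  exists s : seq R, forall A : {pred R}, subring_closed A ->
    (forall a, iota a \in A) -> {subset s <= A} -> forall x, x \in A.

Definition graded_module (R : comNzRingType) (G : nat -> {pred R})
    (M : lmodType R) (H : int -> {pred M}) : Prop :=
  grading H /\
  forall i j a x, a \in G i -> x \in H j -> a *: x \in H (i%:Z + j).

Variant setting (R : idomainType) : Type :=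
  | LocalCase of noetherian R & local_ring R
  | GradedCase (K : fieldType) (iota : {rmorphism K -> R}) (G : nat -> {pred R})
      of graded_algebra iota G & fg_algebra iota.

Lemma noetherian_field (K : fieldType) : noetherian K.
Proof.
move=> I [I0 IS].
have [[a [aI a0]]|noa] := pselect (exists a, a \in I /\ a != 0).
  exists [:: a]; split=> [x|]; first by rewrite inE => /eqP ->.
  move=> J [J0 JS] sJ x _; have aJ : a \in J by apply: sJ; rewrite inE.
  by have := JS (x / a) a 0 aJ J0; rewrite addr0 /GRing.scale /= divfK.
exists [::]; split=> // J [J0 _] _ x xI.
have [-> //|x0] := eqVneq x 0.
by case: noa; exists x.
Qed.

Lemma noetherian_poly (A : comNzRingType) : noetherian A -> noetherian {poly A}.
Proof.
move=> hA I IP; have [I0 IS] := IP.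
have IM (q p : {poly A}) : p \in I -> q * p \in I.
  by move=> pI; have := IS q p 0 pI I0; rewrite addr0.
pose L d : {pred A^o} :=
  [pred a | `[< exists2 p : {poly A}, p \in I & (size p <= d.+1)%N /\ p`_d = a >]].
have LP d a : reflect
    (exists2 p : {poly A}, p \in I & (size p <= d.+1)%N /\ p`_d = a) (a \in L d).
  exact: asboolP.
have sizeZD d (c : A) (p q : {poly A}) : (size p <= d)%N -> (size q <= d)%N ->
    (size (c%:P * p + q)%R <= d)%N.
  move=> sp sq; rewrite (leq_trans (size_polyD _ _)) // geq_max sq andbT.
  by rewrite mul_polyC (leq_trans (size_scale_leq _ _)).
have Lsub d : GRing.submod_closed (L d).
  split; first by apply/LP; exists 0 => //; rewrite size_poly0 coef0.
  move=> c _ _ /LP[p pI [sp <-]] /LP[q qI [sq <-]].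
  apply/LP; exists (c%:P * p + q); first exact: IS.
  by rewrite sizeZD // coefD coefCM.
have LS d : {subset L d <= L d.+1}.
  move=> _ /LP[p pI [sp <-]]; apply/LP; exists ('X * p); first exact: IM.
  by rewrite coefXM /= (leq_trans (size_polyMleq _ _)) // size_polyX add2n.
have Lmon d e : (d <= e)%N -> {subset L d <= L e}.
  by move/subnK <-; elim: (e - d)%N => // n IHn x /IHn /LS.
pose Loo : {pred A^o} := [pred a | `[< exists d, a \in L d >]].
have LooP a : reflect (exists d, a \in L d) (a \in Loo) by exact: asboolP.
have LooS : GRing.submod_closed Loo.
  split; first by apply/LooP; exists 0%N; have [] := Lsub 0%N.
  move=> c a b /LooP[d ad] /LooP[e be]; apply/LooP; exists (maxn d e).
  have [_] := Lsub (maxn d e); apply.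
    by apply: Lmon ad; rewrite leq_maxl.
  by apply: Lmon be; rewrite leq_maxr.
have [s [sL sG]] := hA _ LooS.
have [N sN] : exists N, {subset s <= L N}.
  elim: s sL {sG} => [|a s IHs] sL; first by exists 0%N.
  have [x xs|N sN] := IHs; first by apply: sL; rewrite inE xs orbT.
  have /LooP[d ad] : a \in Loo by apply: sL; rewrite mem_head.
  exists (maxn d N) => x; rewrite inE => /predU1P[->|/sN].
    by apply: Lmon ad; rewrite leq_maxl.
  by apply: Lmon; rewrite leq_maxr.
have LN d : {subset L d <= L N}.
  by move=> a ad; apply: sG => //; apply/LooP; exists d.
have realize d : exists t : seq {poly A},
    (forall p, p \in t -> p \in I /\ (size p <= d.+1)%N) /\
    forall J : {pred A^o}, GRing.submod_closed J ->
      (forall p : {poly A}, p \in t -> p`_d \in J) -> {subset L d <= J}.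
  have [r [rL rG]] := hA _ (Lsub d).
  suff [t [tI tr]] : exists t : seq {poly A},
      (forall p, p \in t -> p \in I /\ (size p <= d.+1)%N) /\
      forall a, a \in r -> exists2 p : {poly A}, p \in t & p`_d = a.
    exists t; split=> // J JS tJ; apply: rG => // a /tr[p pt <-]; exact: tJ.
  elim: r rL {rG} => [|a r IHr] rL; first by exists [::].
  have [x xr|t [tI tr]] := IHr; first by apply: rL; rewrite inE xr orbT.
  have /LP[p pI [sp pa]] : a \in L d by apply: rL; rewrite mem_head.
  exists (p :: t); split=> [q|b].
    by rewrite inE => /predU1P[->|/tI].
  rewrite inE => /predU1P[->|/tr[q qt qb]]; first by exists p; rewrite ?mem_head.
  by exists q => //; rewrite inE qt orbT.
have [t tP] := choice realize.
exists (flatten [seq t d | d <- iota 0 N.+1]); split.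
  by move=> p /flatten_mapP[d _ /(tP d).1[]].
move=> J [J0 JS] tJ p; have [n] := ubnP (size p); move/leqW: (leqnn n).
move=> _; elim: n p => // n IHn p; rewrite ltnS => sp pI.
have [p0|pn0] := eqVneq p 0; first by rewrite p0.
case: n => [|n] in IHn sp *.
  by move: sp; rewrite leqn0 size_poly_eq0 (negPf pn0).
pose e := minn n N.
have pe : p`_n \in L e.
  have pn : p`_n \in L n by apply/LP; exists p.
  by rewrite /e /minn; case: ifP => _ //; apply: LN pn.
pose C : {pred A^o} := [pred b | `[< exists q : {poly A},
  [/\ q \in I, q \in J, (size q <= e.+1)%N & q`_e = b] >]].
have CP b : reflect (exists q : {poly A},
  [/\ q \in I, q \in J, (size q <= e.+1)%N & q`_e = b]) (b \in C) by exact: asboolP.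
have CS : GRing.submod_closed C.
  split; first by apply/CP; exists 0; rewrite size_poly0 coef0.
  move=> c _ _ /CP[q [qI qJ sq <-]] /CP[r [rI rJ sr <-]].
  apply/CP; exists (c%:P * q + r); split; [exact: IS|exact: JS| |].
    exact: sizeZD.
  by rewrite coefD coefCM.
have /CP[q [qI qJ sq qe]] : p`_n \in C.
  apply: (tP e).2 pe => // r rt; apply/CP; exists r.
  have [rI sr] := (tP e).1 r rt; split=> //; apply: tJ.
  apply/flatten_mapP; exists e => //.
  by rewrite mem_iota /= add0n ltnS geq_minr.
have en : (e <= n)%N by rewrite geq_minl.
pose r : {poly A} := - 'X^(n - e) * q + p.
have rI : r \in I by exact: IS.
suff rJ : r \in J.
  have := JS 'X^(n - e) q r qJ rJ.
  by rewrite /GRing.scale /= /r mulNr addNKr.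
apply: IHn rI; rewrite ltnS; apply/leq_sizeP => i ni.
rewrite /r mulNr coefD coefN coefXnM.
have -> : (i < n - e)%N = false by apply/negbTE; rewrite -leqNgt (leq_trans _ ni) ?leq_subr.
case: (ltngtP n i) ni => // [ni|<-] _; last by rewrite subKn // qe addNr.
rewrite !nth_default ?oppr0 ?addr0 ?(leq_trans sp) // (leq_trans sq) //.
by rewrite ltn_subRL subnK.
Qed.

Lemma noetherian_surj (A B : comNzRingType) (f : {rmorphism A -> B}) :
  (forall b, exists a, f a = b) -> noetherian A -> noetherian B.
Proof.
move=> fS hA I [I0 IS].
pose f' (J : {pred B^o}) : {pred A^o} := [pred a | f a \in J].
have f'S (J : {pred B^o}) : GRing.submod_closed J -> GRing.submod_closed (f' J).
  move=> [J0 JS]; split; rewrite ?inE ?rmorph0 // => a x y.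
  rewrite !inE => xJ yJ; rewrite rmorphD [f (a *: x)]rmorphM; exact: JS.
have [s [sI sG]] := hA _ (f'S I (conj I0 IS)).
exists [seq f a | a <- s]; split=> [_ /mapP[a /sI aI ->] //|].
move=> J JS sJ b; have [a <-] := fS b => aI.
have: a \in f' J by apply: sG => [|c cs|//]; [exact: f'S|apply: sJ; exact: map_f].
by [].
Qed.

Lemma noetherian_generated (A R : comNzRingType) (f : {rmorphism A -> R})
    (s : seq R) : noetherian A ->
  (forall B : {pred R}, subring_closed B -> (forall a, f a \in B) ->
    {subset s <= B} -> forall x, x \in B) -> noetherian R.
Proof.
elim: s A f => [|x s IHs] A f hA sG.
  apply: (@noetherian_surj A R f) => // b.
  pose I : {pred R} := [pred b | `[< exists a, f a = b >]].
  have : b \in I.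
    apply: sG => // [|a]; last by apply/asboolP; exists a.
    split; first by apply/asboolP; exists 1; rewrite rmorph1.
      move=> _ _ /asboolP[a <-] /asboolP[c <-].
      by apply/asboolP; exists (a - c); rewrite rmorphB.
    move=> _ _ /asboolP[a <-] /asboolP[c <-].
    by apply/asboolP; exists (a * c); rewrite rmorphM.
  by move/asboolP.
have cfx : commr_rmorph f x by move=> a; apply: mulrC.
apply: (IHs {poly A} (horner_morph cfx)) => [|B BS fB sB].
  exact: noetherian_poly.
apply: sG => // [a|y].
  by rewrite -(horner_morphC cfx); apply: fB.
by rewrite inE => /predU1P[->|/sB //]; rewrite -(horner_morphX cfx); apply: fB.
Qed.

Lemma noetherian_fg_algebra (K : fieldType) (R : comNzRingType)
  (iota : {rmorphism K -> R}) : fg_algebra iota -> noetherian R.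
Proof.
case=> s hs.
exact: (@noetherian_generated K R iota s (@noetherian_field K) hs).
Qed.

Lemma setting_noetherian (R : idomainType) (S : setting R) : noetherian R.
Proof. by case: S => // K iota G _; apply: noetherian_fg_algebra. Qed.

Section Local.
Variable S : comNzRingType.
Implicit Types M N E : lmodType S.

(* The maximal ideal, when S is local. *)
Definition nonunit : {pred S} := [pred x | ~~ `[< exists y, x * y = 1 >]].

Definition prime_ideal (P : {pred S}) : Prop :=
  idealr_closed P /\ prime_idealr_closed P.

Definition prime_chain (n : nat) : Prop :=
  exists P : 'I_n.+1 -> {pred S}, (forall i, prime_ideal (P i)) /\
    forall i j : 'I_n.+1, (i < j)%N ->
      {subset P i <= P j} /\ ~ {subset P j <= P i}.

Definition krull_dim (d : nat) : Prop :=
  prime_chain d /\ forall n, prime_chain n -> (n <= d)%N.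

(* z lies in the submodule (x_1, ..., x_n) M *)
Definition in_seq_mul M (x : seq S) (z : M) : Prop :=
  exists w : 'I_(size x) -> M, z = \sum_(i < size x) x`_i *: w i.

Definition regular_seq M (x : seq S) : Prop :=
  [/\ {subset x <= nonunit},
      forall i, (i < size x)%N -> forall z : M,
        in_seq_mul (take i x) (x`_i *: z) -> in_seq_mul (take i x) z
    & exists z : M, ~ in_seq_mul x z].

Definition depth M (d : nat) : Prop :=
  (exists2 x, regular_seq M x & size x = d) /\
  forall x, regular_seq M x -> (size x <= d)%N.

Definition maximal_regular_seq M (x : seq S) : Prop :=
  regular_seq M x /\ forall y, ~ regular_seq M (rcons x y).

(* z represents an element of the socle of M / x M *)
Definition in_socle M (x : seq S) (z : M) : Prop :=
  forall a, a \in nonunit -> in_seq_mul x (a *: z).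

(* The type of M is the dimension over the residue field of the socle
   Hom(k, M / x M), which does not depend on the maximal M-sequence x;
   u is a basis of it. *)
Definition has_type M (r : nat) : Prop :=
  forall x : seq S, maximal_regular_seq M x ->
    exists u : 'I_r -> M,
      [/\ forall i, in_socle x (u i),
          forall c : 'I_r -> S, in_seq_mul x (\sum_i c i *: u i) ->
            forall i, c i \in nonunit
        & forall z, in_socle x z ->
            exists c : 'I_r -> S, in_seq_mul x (z - \sum_i c i *: u i)].

Definition injective_module E : Prop :=
  forall (A B : lmodType S) (i : {linear A -> B}) (f : {linear A -> E}),
    injective i -> exists g : {linear B -> E}, forall a, g (i a) = f a.

Definition exact_at (A B C : lmodType S) (f : {linear A -> B})
    (g : {linear B -> C}) : Prop :=
  forall b, g b = 0 <-> exists a, b = f a.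

Definition finite_injdim M : Prop :=
  exists (n : nat) (E : nat -> lmodType S) (e : {linear M -> E 0%N})
         (d : forall i, {linear E i -> E i.+1}),
    [/\ forall i, injective_module (E i),
        injective e, exact_at e (d 0%N),
        forall i, exact_at (d i) (d i.+1)
      & forall i, (n < i)%N -> forall z : E i, z = 0].

Definition maximal_cohen_macaulay M : Prop :=
  fg_module M /\ exists2 d, krull_dim d & depth M d.

Definition canonical_module_local M : Prop :=
  [/\ maximal_cohen_macaulay M, has_type M 1 & finite_injdim M].

End Local.

Section Localization.
Variables (R : idomainType) (p : prime_idealr R).

Definition loc_pred : {pred {fraction R}} :=
  [pred x | `[< exists a s : R, s \notin p /\ x = a%:F / s%:F >]].

Lemma loc_predP x :
  reflect (exists a s : R, s \notin p /\ x = a%:F / s%:F) (x \in loc_pred).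
Proof. exact: asboolP. Qed.

Lemma notin_prime_neq0 s : s \notin p -> s%:F != 0.
Proof. by apply: contraNneq => /eqP; rewrite tofrac_eq0 => /eqP ->; apply: rpred0. Qed.

Lemma loc_subring_closed : subring_closed loc_pred.
Proof.
have p1 : 1 \notin p by rewrite idealr1.
split.
- by apply/loc_predP; exists 1, 1; rewrite tofrac1 divr1.
- move=> _ _ /loc_predP[a [s [ps ->]]] /loc_predP[b [t [pt ->]]].
  apply/loc_predP; exists (a * t - b * s), (s * t).
  rewrite prime_idealrM negb_or ps pt; split=> //.
  rewrite tofracB !tofracM -mulNr addf_div ?notin_prime_neq0 //.
  by rewrite mulNr.
- move=> _ _ /loc_predP[a [s [ps ->]]] /loc_predP[b [t [pt ->]]].
  apply/loc_predP; exists (a * b), (s * t).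
  by rewrite prime_idealrM negb_or ps pt !tofracM mulf_div.
Qed.

HB.instance Definition _ :=
  GRing.isSubringClosed.Build {fraction R} loc_pred loc_subring_closed.

Record loc : Type := Loc { loc_val :> {fraction R}; _ : loc_val \in loc_pred }.

HB.instance Definition _ := [isSub for loc_val].
HB.instance Definition _ := [Choice of loc by <:].
HB.instance Definition _ := [SubChoice_isSubComNzRing of loc by <:].

Lemma loc_pred_tofrac a : a%:F \in loc_pred.
Proof. by apply/loc_predP; exists a, 1; rewrite idealr1 tofrac1 divr1. Qed.

Definition toloc (a : R) : loc := Loc (loc_pred_tofrac a).

Lemma toloc_zmod_morphism : zmod_morphism toloc.
Proof. by move=> a b; apply: val_inj; rewrite rmorphB /= tofracB. Qed.

Lemma toloc_monoid_morphism : monoid_morphism toloc.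
Proof. by split=> [|a b]; apply: val_inj; rewrite ?rmorphM /= ?tofracM. Qed.

HB.instance Definition _ :=
  GRing.isZmodMorphism.Build R loc toloc toloc_zmod_morphism.
HB.instance Definition _ :=
  GRing.isMonoidMorphism.Build R loc toloc toloc_monoid_morphism.

(* f exhibits N as the localization of M at p *)
Definition is_localization (M : lmodType R) (N : lmodType loc)
    (f : {linear M -> N | toloc \; *:%R}) : Prop :=
  (forall z, f z = 0 <-> exists2 s, s \notin p & s *: z = 0) /\
  (forall w : N, exists z s, s \notin p /\ toloc s *: w = f z).

End Localization.

Definition cohen_macaulay (R : idomainType) : Prop :=
  forall p : prime_idealr R, maximal_ideal p ->
    maximal_cohen_macaulay ((loc p)^o : lmodType (loc p)).

Definition gorenstein (R : idomainType) : Prop :=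
  forall p : prime_idealr R, maximal_ideal p ->
    finite_injdim ((loc p)^o : lmodType (loc p)).

Definition canonical_module (R : idomainType) (M : lmodType R) : Prop :=
  fg_module M /\
  forall p : prime_idealr R, maximal_ideal p ->
    exists (N : lmodType (loc p)) (f : {linear M -> N | toloc p \; *:%R}),
      is_localization f /\ canonical_module_local N.

(* A graded canonical module is a graded module that is a canonical module; it
   is unique up to a shift of the grading, which does not affect its class. *)
Definition canonical_module_in (R : idomainType) (S : setting R)
    (M : lmodType R) : Prop :=
  match S with
  | LocalCase _ _ => canonical_module M
  | GradedCase _ _ G _ _ =>
      canonical_module M /\ exists H : int -> {pred M}, graded_module G H
  end.

Section Divisorial.
Variable R : idomainType.
Local Notation F := {fraction R}.
Implicit Types I J : set F.

(* R as a subset of its fraction field *)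
Definition base_ring : set F := [set x | exists a : R, x = a%:F].

(* The fractional ideal R : I *)
Definition dual I : set F := [set x | forall y, I y -> base_ring (x * y)].

Definition fractional_ideal I : Prop :=
  [/\ I 0, forall (a : R) x y, I x -> I y -> I (a%:F * x + y),
      exists2 x, I x & x != 0
    & exists2 d : R, d != 0 & forall x, I x -> base_ring (d%:F * x)].

Definition divisorial I : Prop := fractional_ideal I /\ dual (dual I) = I.

(* The divisorial product of I and J is R : (R : IJ); as R : _ only depends on
   the submodule generated, the set of products xy can stand for IJ. *)
Definition divprod I J : set F :=
  dual (dual [set z | exists x y, [/\ I x, J y & z = x * y]]).

Record divisorial_ideal : Type :=
  DivisorialIdeal { ideal_set :> set F; _ : `[< divisorial ideal_set >] }.

HB.instance Definition _ := [isSub for ideal_set].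
HB.instance Definition _ := [Choice of divisorial_ideal by <:].

Lemma base_ring0 : base_ring 0. Proof. by exists 0; rewrite tofrac0. Qed.
Lemma base_ring1 : base_ring 1. Proof. by exists 1; rewrite tofrac1. Qed.
Lemma base_ringR a : base_ring a%:F. Proof. by exists a. Qed.
Lemma base_ringM x y : base_ring x -> base_ring y -> base_ring (x * y).
Proof. by move=> [a ->] [b ->]; exists (a * b); rewrite tofracM. Qed.
Lemma base_ringD x y : base_ring x -> base_ring y -> base_ring (x + y).
Proof. by move=> [a ->] [b ->]; exists (a + b); rewrite tofracD. Qed.

Lemma dual_anti I J : (forall x, I x -> J x) -> forall x, dual J x -> dual I x.
Proof. by move=> IJ x Jx y /IJ/Jx. Qed.

Lemma sub_dual2 I x : I x -> dual (dual I) x.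
Proof. by move=> Ix y /(_ x Ix); rewrite mulrC. Qed.

Lemma dual3 I : dual (dual (dual I)) = dual I.
Proof.
apply/predeqP => x; split; last exact: sub_dual2.
by apply: dual_anti => y; apply: sub_dual2.
Qed.

Lemma dual_base_ring : dual base_ring = base_ring.
Proof.
apply/predeqP => x; split=> [/(_ 1 base_ring1)|xR y yR]; first by rewrite mulr1.
exact: base_ringM.
Qed.

Lemma frac_denom (x : F) : exists2 d : R, d != 0 & base_ring (d%:F * x).
Proof.
elim/quotW: x => -[[a b] /= b0]; exists b => //; exists a.
unlock FracField.tofrac; rewrite -[LHS]FracField.pi_mul; apply/eqmodP => /=.
by rewrite FracField.equivfE /FracField.mulf !numden_Ratio ?mul1r ?mulr1 ?oner_eq0 //= mulrC.
Qed.

Lemma fractional_dual (T : set F) : (exists2 x, T x & x != 0) ->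
    (exists2 d : R, d != 0 & forall x, T x -> base_ring (d%:F * x)) ->
  fractional_ideal (dual T).
Proof.
move=> [x Tx x0] [d d0 dT]; split.
- by move=> y _; rewrite mul0r; apply: base_ring0.
- move=> a u v Tu Tv y Ty; rewrite mulrDl -mulrA.
  by apply: base_ringD; [apply: base_ringM (Tu _ Ty); apply: base_ringR|apply: Tv].
- by exists d%:F; rewrite ?tofrac_eq0.
have [b b0 [a ba]] := frac_denom x; exists a.
  by rewrite -tofrac_eq0 -ba mulf_neq0 // tofrac_eq0.
move=> z Tz; rewrite -ba -mulrA [x * z]mulrC.
by apply: base_ringM (Tz _ Tx); apply: base_ringR.
Qed.

Lemma divisorial_dual I : fractional_ideal I -> divisorial (dual I).
Proof. by case=> _ _ I1 I2; split; [exact: fractional_dual|exact: dual3]. Qed.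

Lemma divisorial_base_ring : divisorial base_ring.
Proof.
split; last by rewrite !dual_base_ring.
split; [exact: base_ring0| |by exists 1; [exact: base_ring1|exact: oner_neq0]|].
  by move=> a x y xR; apply: base_ringD; apply: base_ringM xR; apply: base_ringR.
by exists 1; rewrite ?oner_neq0 // => x; rewrite tofrac1 mul1r.
Qed.

Lemma divisorial_divprod I J :
  fractional_ideal I -> fractional_ideal J -> divisorial (divprod I J).
Proof.
move=> [_ _ [x Ix x0] [d d0 dI]] [_ _ [y Jy y0] [e e0 eJ]].
apply/divisorial_dual/fractional_dual.
  by exists (x * y); rewrite ?mulf_neq0 //; exists x, y.
exists (d * e); first by rewrite mulf_neq0.
move=> _ [u [v [Iu Jv ->]]]; rewrite tofracM mulrACA.
by apply: base_ringM; [exact: dI|exact: eJ].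
Qed.

Lemma divprodC I J : divprod I J = divprod J I.
Proof.
rewrite /divprod; congr (dual (dual _)); apply/predeqP => z.
by split=> -[x [y [Ix Jy ->]]]; exists y, x; rewrite mulrC.
Qed.

Lemma divprodP I J z : dual (divprod I J) z <->
  forall x y, I x -> J y -> base_ring (z * (x * y)).
Proof.
rewrite /divprod dual3; split=> [h x y Ix Jy|h _ [x [y [Ix Jy ->]]]].
  by apply: h; exists x, y.
exact: h.
Qed.

Lemma dual_divprodA I J L z : dual (divprod I (divprod J L)) z <->
  forall x y w, I x -> J y -> L w -> base_ring (z * (x * (y * w))).
Proof.
rewrite divprodP; split=> [h x y w Ix Jy Lw|h x v Ix].
  by apply: h => //; apply: sub_dual2; exists y, w.
move=> vP; rewrite mulrA [_ * v]mulrC; apply: (vP (z * x)) => _ [y [w [Jy Lw ->]]].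
by rewrite -mulrA; apply: h.
Qed.

Lemma divprod_id I J : divprod I J = dual (dual (divprod I J)).
Proof. by rewrite [RHS]dual3. Qed.

Lemma divprodA I J L : divprod I (divprod J L) = divprod (divprod I J) L.
Proof.
rewrite divprod_id [RHS]divprod_id; congr (dual _); apply/predeqP => z.
rewrite (divprodC (divprod I J)) !dual_divprodA; split=> h x y w Ix Jy Lw.
  by rewrite [x * _]mulrC -mulrA; apply: h.
by rewrite [x * (y * w)]mulrA [x * y * w]mulrC; apply: h.
Qed.

Lemma divprod1 I : divisorial I -> divprod base_ring I = I.
Proof.
case=> _ {2}<-; rewrite divprod_id; congr (dual _); apply/predeqP => z.
rewrite divprodP; split=> [h y Iy|h x y xR Iy].
  by rewrite -[y]mul1r; apply: h => //; apply: base_ring1.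
by rewrite mulrCA; apply: base_ringM => //; apply: h.
Qed.

Lemma fg_submod_sum (A : comNzRingType) (V : lmodType A) (N : {pred V}) :
  fg_submod N -> exists s : seq V, {subset s <= N} /\
    forall x, x \in N ->
      exists c : 'I_(size s) -> A, x = \sum_(i < size s) c i *: s`_i.
Proof.
case=> s [sN sG]; exists s; split=> // x xN.
pose N' : {pred V} :=
  [pred x | `[< exists c : 'I_(size s) -> A, x = \sum_(i < size s) c i *: s`_i >]].
suff: x \in N' by move/asboolP.
apply: sG xN; first split.
- by apply/asboolP; exists (fun=> 0); rewrite big1 // => i _; rewrite scale0r.
- move=> a _ _ /asboolP[c ->] /asboolP[b ->].
  apply/asboolP; exists (fun i => a * c i + b i).
  rewrite scaler_sumr -big_split; apply: eq_bigr => i _ /=.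
  by rewrite scalerDl scalerA.
move=> y ys; apply/asboolP.
have yi : (index y s < size s)%N by rewrite index_mem.
exists (fun i => (i == Ordinal yi)%:R).
rewrite (bigD1 (Ordinal yi)) //= eqxx scale1r nth_index // big1 ?addr0 //.
by move=> i /negPf ->; rewrite scale0r.
Qed.

(* A Noetherian integrally closed domain is completely integrally closed. *)
Lemma completely_integrally_closed I x :
    noetherian R -> integrally_closed R -> fractional_ideal I ->
  (forall y, I y -> I (x * y)) -> base_ring x.
Proof.
move=> hN hI [I0 ID [z Iz z0] [d d0 dI]] xI; apply: hI.
have dF : d%:F != 0 by rewrite tofrac_eq0.
pose I' : {pred R^o} := [pred a : R | `[< I (a%:F / d%:F) >]].
have I'S : GRing.submod_closed I'.
  split; first by apply/asboolP; rewrite tofrac0 mul0r.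
  move=> a b c /asboolP Ib /asboolP Ic; apply/asboolP.
  change (I ((a * (b : R) + (c : R))%:F / d%:F)).
  by rewrite tofracD tofracM mulrDl -mulrA; apply: ID.
have [s0 [sI sG]] := fg_submod_sum (hN _ I'S); pose s : seq R := s0.
rewrite -/s in sI sG.
have sum_s y : I y -> exists c : 'I_(size s) -> R,
    y = \sum_(j < size s) (c j)%:F * ((s`_j)%:F / d%:F).
  move=> Iy; have [b by_] := dI _ Iy.
  have [|c bc] := sG b.
    by apply/asboolP; rewrite -by_ mulrC mulKf.
  exists c; apply: (mulfI dF); rewrite by_ bc rmorph_sum mulr_sumr.
  apply: eq_bigr => j _; rewrite [RHS]mulrCA [d%:F * _]mulrC divfK //.
  exact: tofracM.
have /choice[A xA] (i : 'I_(size s)) : exists c : 'I_(size s) -> R,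
    x * ((s`_i)%:F / d%:F) = \sum_(j < size s) (c j)%:F * ((s`_j)%:F / d%:F).
  by apply/sum_s/xI/asboolP/sI/mem_nth.
pose M : 'M[R]_(size s) := \matrix_(i, j) A j i.
exists (char_poly M); first exact: char_poly_monic.
rewrite -[map_poly _ _]/(map_poly (@FracField.tofrac R) _) map_char_poly.
rewrite -eigenvalue_root_char; apply/eigenvalueP.
exists (\row_i ((s`_i)%:F / d%:F)).
  apply/rowP => i; rewrite !mxE xA; apply: eq_bigr => j _.
  by rewrite !mxE mulrC.
apply: contraNneq z0 => /rowP e0; have [c ->] := sum_s z Iz.
rewrite big1 // => i _; have := e0 i; rewrite !mxE => ->.
by rewrite mulr0.
Qed.

Lemma divprodV I : noetherian R -> integrally_closed R -> divisorial I ->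
  divprod (dual I) I = base_ring.
Proof.
move=> hN hI [If Id]; rewrite -dual_base_ring divprod_id; congr (dual _).
apply/predeqP => z; rewrite divprodP; split=> [h|zR x y Ix Iy].
  apply: (completely_integrally_closed hN hI (divisorial_dual If).1).
  by move=> y Iy w Iw; rewrite -mulrA; apply: h.
by apply: base_ringM => //; apply: Ix.
Qed.

End Divisorial.

(* On a Noetherian normal domain the divisorial ideals form a group under
   [divprod]; the proofs only serve to provide inverses. *)
Definition Div (R : idomainType) (hN : noetherian R) (hI : integrally_closed R) :
  Type := divisorial_ideal R.

Section DivisorClassGroup.
Variables (R : idomainType) (hN : noetherian R) (hI : integrally_closed R).
Local Notation F := {fraction R}.
Local Notation Div := (Div hN hI).

HB.instance Definition _ := Choice.on Div.

Lemma divP (I : divisorial_ideal R) : divisorial I.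
Proof. by apply/asboolP; exact: (valP I). Qed.

Definition div_zero : Div :=
  DivisorialIdeal (asboolT (divisorial_base_ring R)).
Definition div_opp (I : Div) : Div :=
  DivisorialIdeal (asboolT (divisorial_dual (divP I).1)).
Definition div_add (I J : Div) : Div :=
  DivisorialIdeal (asboolT (divisorial_divprod (divP I).1 (divP J).1)).

Lemma div_addA : associative div_add.
Proof. by move=> I J L; apply: val_inj; apply: divprodA. Qed.
Lemma div_addC : commutative div_add.
Proof. by move=> I J; apply: val_inj; apply: divprodC. Qed.
Lemma div_add0 : left_id div_zero div_add.
Proof. by move=> I; apply: val_inj; apply: divprod1 (divP I). Qed.
Lemma div_addN : left_inverse div_zero div_opp div_add.
Proof. by move=> I; apply: val_inj; apply: divprodV hN hI (divP I). Qed.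

HB.instance Definition _ :=
  GRing.isZmodule.Build Div div_addA div_addC div_add0 div_addN.

Definition principal : {pred Div} :=
  [pred I : Div | `[< exists x : F, x != 0 /\
    forall y, ideal_set I y <-> base_ring (y / x) >]].

Lemma principalP (I : Div) : reflect
  (exists x : F, x != 0 /\ forall y, ideal_set I y <-> base_ring (y / x))
  (I \in principal).
Proof. exact: asboolP. Qed.

Lemma dual_principal (I : set F) (x : F) : x != 0 ->
  (forall y, I y <-> base_ring (y / x)) -> forall y, dual I y <-> base_ring (y * x).
Proof.
move=> x0 Ix y; split=> [h|yR z /Ix zR].
  by apply: h; apply/Ix; rewrite mulfV //; apply: base_ring1.
by rewrite -(divfK x0 z) mulrCA; apply: base_ringM.
Qed.

Lemma principal_zmod_closed : zmod_closed principal.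
Proof.
split.
  by apply/principalP; exists 1; split=> [|y]; rewrite ?oner_neq0 ?divr1.
move=> I J /principalP[x [x0 Ix]] /principalP[y [y0 Jy]].
apply/principalP; exists (x / y); split; first by rewrite mulf_neq0 ?invr_eq0.
have Jd := dual_principal y0 Jy.
have d w : dual (divprod I (dual J)) w <-> base_ring (w / (x / y)^-1).
  rewrite divprodP invrK; split=> [h|wR u v /Ix uR /Jd vR].
    apply: h; first by apply/Ix; rewrite mulfV //; apply: base_ring1.
    by apply/Jd; rewrite mulVf //; apply: base_ring1.
  have -> : w * (u * v) = w * (x / y) * ((u / x) * (v * y)).
    rewrite [u / x * _]mulrACA [RHS]mulrACA [x / y * _]mulrACA.
    by rewrite mulfV // mulVf // !mulr1.
  by apply: base_ringM => //; apply: base_ringM.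
move=> z; have xy0 : (x / y)^-1 != 0 by rewrite invr_eq0 mulf_neq0 ?invr_eq0.
have := dual_principal xy0 d z; rewrite dual3 //.
Qed.

HB.instance Definition _ :=
  GRing.isZmodClosed.Build Div principal principal_zmod_closed.

(* [ideal_quot] is the quotient of a Z-module by a subgroup. *)
Definition Cl : zmodType := {ideal_quot principal}.

Definition div_class (I : divisorial_ideal R) : Cl :=
  \pi_{ideal_quot principal} (I : Div).

End DivisorClassGroup.

Section AbelianGroups.
Variable G : zmodType.

Definition generates n (u : 'I_n -> G) : Prop :=
  forall x : G, exists c : 'rV[int]_n, x = \sum_i u i *~ c 0 i.

Definition fg_group : Prop := exists n (u : 'I_n -> G), generates u.

(* The rows of A span the module of relations between the generators u. *)
Definition presented_by n (u : 'I_n -> G) m (A : 'M[int]_(m, n)) : Prop :=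
  generates u /\ forall c : 'rV[int]_n,
    \sum_i u i *~ c 0 i = 0 <-> exists b : 'rV[int]_m, c = b *m A.

Definition independent n (u : 'I_n -> G) : Prop :=
  forall c : 'rV[int]_n, \sum_i u i *~ c 0 i = 0 -> c = 0.

Definition has_rank (r : nat) : Prop :=
  (exists u : 'I_r -> G, independent u) /\
  forall n (u : 'I_n -> G), independent u -> (n <= r)%N.

Definition rank : nat := xget 0%N [set r | has_rank r].

Definition multiples (g : G) : {pred G} :=
  [pred x | `[< exists k : int, x = g *~ k >]].

Lemma multiples_zmod_closed (g : G) : zmod_closed (multiples g).
Proof.
split=> [|_ _ /asboolP[k ->] /asboolP[l ->]]; apply/asboolP.
  by exists 0; rewrite mulr0z.
by exists (k - l); rewrite mulrzBr.
Qed.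

HB.instance Definition _ (g : G) :=
  GRing.isZmodClosed.Build G (multiples g) (multiples_zmod_closed g).

End AbelianGroups.

(* The ideal I_k(A) generated by the k-minors. The maps f and g need not be
   increasing: this only adds 0 and signs. For k = 0 the ideal is all of Z. *)
Definition minor_ideal m n (A : 'M[int]_(m, n)) (k : nat) : set int :=
  [set z | exists c : {ffun 'I_k -> 'I_m} -> {ffun 'I_k -> 'I_n} -> int,
     z = \sum_f \sum_g c f g * \det (mxsub f g A)].

(* All presentations of G give the same ideal. The truncated subtraction n - i
   is 0 for i >= n, and then the ideal is Z. *)
Definition fitting_ideal (i : nat) (G : zmodType) : set int :=
  [set z | exists n (u : 'I_n -> G) m (A : 'M[int]_(m, n)),
     presented_by u A /\ minor_ideal A (n - i) z].

(* The torsion number for Cl(R) = G and [omega_R] = g; the default value 0 of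
   [xget] is never used, as every ideal of Z is principal. *)
Definition torsion_number (G : zmodType) (g : G) : nat :=
  let Gbar : zmodType := {ideal_quot (multiples g)} in
  let r := rank Gbar in
  if `[< fitting_ideal r G = fitting_ideal r Gbar >] then 0%N
  else xget 0%N [set d : nat |
    fitting_ideal r Gbar = [set z : int | (d%:Z %| z)%Z]%classic].

(* Main.v *)
From HB Require Import structures.
Require Import Defs.
From mathcomp Require Import all_boot all_order all_algebra perm.
From mathcomp Require Import boolp classical_sets.

(** The torsion number is governed by a statement on a finitely generated
    abelian group G and g in G: with r the rank of G / Zg, Fitt_r(G / Zg) is
    nonzero, and it equals Fitt_r(G) only if g = 0. Indeed, present G by A and
    G / Zg by A with one more row c, and bring A to Smith normal form: equality
    of the ideals of minors of size rank [A; c] forces c into the row space of A.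
    So the torsion number vanishes iff the canonical ideal is principal, i.e.
    iff omega = R w for some w.

    If omega = R w then omega_p is isomorphic to R_p, which thus has finite
    injective dimension. Conversely, let A = R_p be Gorenstein, p being the
    (irrelevant) maximal ideal, and let N = omega_p. By prime avoidance there is
    a sequence s of length dim A which is regular both on A and on N. Then
    B = A / (s) is Artinian, and N / s N and B are injective B-modules, as their
    injective dimensions over B are finite. As N / s N has a simple socle and B
    is self-injective, N / s N is isomorphic to B, whence N is cyclic by
    Nakayama's lemma. In the local case N = omega; in the graded case the cyclicity
    of N carries over to omega by looking at components of lowest degree. *)

Set Implicit Arguments.
Unset Strict Implicit.
Unset Printing Implicit Defensive.
Import Order.TTheory GRing.Theory Num.Theory.
Local Open Scope ring_scope.
Local Open Scope quotient_scope.
Local Open Scope classical_set_scope.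

(** * Submodules and quotient modules *)

(** No quotient ring is formed. Modules over A / J are A-modules killed by [J], so [injdim_le J]
    measures injective dimension over A / J while everything stays over A; likewise M / (U + x M) is
    represented by the submodule U + x M of M. The depths of A and N provide one sequence for each,
    with no relation between them. [regular_seq_mod_exchange] lets any regular element start a
    sequence of the required length, so the elements of s can be chosen jointly. As [has_type]
    speaks of all maximal N-sequences, it can be read off at s. Dividing by an element y of s
    replaces A / J by A / (J + y A): the y-torsion Hom(A / yA, -) of an injective is injective over
    the smaller ring. Over the Artinian ring B, finite injective dimension forces injectivity
    because the residue field embeds in B. For the minors, the relevant size is n - r, the rank of
    [A; c]. If adjoining c raises the rank, Fitt_r(G) is zero and differs from Fitt_r(G / Zg) at
    once; if not, divisibility of the invariant factors decides. *)

Definition submod (A : pzRingType) (M : lmodType A) (U : set M) : Prop :=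
  U 0 /\ forall a x y, U x -> U y -> U (a *: x + y).

Lemma set0_submod (A : pzRingType) (M : lmodType A) :
  submod ([set 0]%classic : set M).
Proof. by split=> // a x y -> ->; rewrite scaler0 addr0. Qed.

Section Submod.
Variables (A : pzRingType) (M : lmodType A) (U : set M) (UP : submod U).

Lemma submod0 : U 0. Proof. by case: UP. Qed.
Lemma submodD x y : U x -> U y -> U (x + y).
Proof. by case: UP => _ h Ux Uy; rewrite -[x]scale1r; apply: h. Qed.
Lemma submodZ a x : U x -> U (a *: x).
Proof. by case: UP => U0 h Ux; rewrite -[_ *: _]addr0; apply: h. Qed.
Lemma submodN x : U x -> U (- x).
Proof. by rewrite -scaleN1r; apply: submodZ. Qed.
Lemma submodB x y : U x -> U y -> U (x - y).
Proof. by move=> Ux Uy; apply: submodD => //; apply: submodN. Qed.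
Lemma submodDl x y : U x -> U (x + y) <-> U y.
Proof.
move=> Ux; split=> [Uxy|]; last exact: submodD.
by rewrite -[y](addKr x) addrC; apply: submodB.
Qed.
Lemma submod_sum (I : finType) (F : I -> M) : (forall i, U (F i)) -> U (\sum_i F i).
Proof. by move=> UF; elim/big_ind: _ => // [|x y]; [exact: submod0|exact: submodD]. Qed.

Definition submod_pred of submod U : {pred M} := [pred x | `[< U x >]].

Lemma submod_predP x : reflect (U x) (x \in submod_pred UP).
Proof. exact: asboolP. Qed.

Lemma submod_pred_closed : GRing.submod_closed (submod_pred UP).
Proof.
split; first by apply/submod_predP; exact: submod0.
move=> a x y /submod_predP Ux /submod_predP Uy; apply/submod_predP.
by apply: submodD Uy; exact: submodZ.
Qed.

HB.instance Definition _ := GRing.isSubmodClosed.Build A M (submod_pred UP)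
  submod_pred_closed.

Record submodule : Type := Submodule
  { submodule_val :> M; _ : submodule_val \in submod_pred UP }.
HB.instance Definition _ := [isSub for submodule_val].
HB.instance Definition _ := [Choice of submodule by <:].
HB.instance Definition _ := [SubChoice_isSubLmodule of submodule by <:].

Definition quotient_module : Type := {ideal_quot (submod_pred UP)}.
HB.instance Definition _ := GRing.Zmodule.on quotient_module.

Local Notation Q := {ideal_quot (submod_pred UP)}.

Definition quotient_scale (a : A) (x : quotient_module) : quotient_module :=
  \pi_Q (a *: repr (x : Q)).

Lemma quotient_pi_eq x y : (\pi_Q x = \pi_Q y) <-> U (x - y).
Proof.
split=> [/eqP|/submod_predP Uxy]; last by apply/eqP; rewrite -Quotient.idealrBE.
by rewrite -Quotient.idealrBE => /submod_predP.
Qed.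

Lemma quotient_pi_scale a x : quotient_scale a (\pi_Q x) = \pi_Q (a *: x).
Proof.
apply/quotient_pi_eq; rewrite -scalerBr; apply: submodZ.
by apply/quotient_pi_eq; rewrite reprK.
Qed.

Lemma quotient_scaleA a b x :
  quotient_scale a (quotient_scale b x) = quotient_scale (a * b) x.
Proof. by rewrite -[x](@reprK _ Q) !quotient_pi_scale scalerA. Qed.
Lemma quotient_scale1 : left_id 1 quotient_scale.
Proof. by move=> x; rewrite -[x](@reprK _ Q) quotient_pi_scale scale1r. Qed.
Lemma quotient_scaleDr : right_distributive quotient_scale +%R.
Proof.
move=> a x y; rewrite -[x](@reprK _ Q) -[y](@reprK _ Q).
by rewrite -[_ + _](raddfD \pi_Q) !quotient_pi_scale scalerDr; apply: (raddfD \pi_Q).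
Qed.
Lemma quotient_scaleDl x : {morph quotient_scale^~ x : a b / a + b}.
Proof.
move=> a b; rewrite -[x](@reprK _ Q).
by rewrite !quotient_pi_scale scalerDl; apply: (raddfD \pi_Q).
Qed.
HB.instance Definition _ := GRing.Zmodule_isLmodule.Build A quotient_module
  quotient_scaleA quotient_scale1 quotient_scaleDr quotient_scaleDl.

End Submod.

(** * Linear maps given by graphs, and factorisations *)

Section Maps.
Variable A : pzRingType.
Implicit Types M N E : lmodType A.

(** Maps such as connecting homomorphisms are most easily given by their graph. For a graph closed
    under linear combinations, being single-valued only has to be checked at 0. *)
Lemma linear_of_rel M N (r : M -> N -> Prop) : (forall x, exists y, r x y) ->
    (forall a x y u v, r x u -> r y v -> r (a *: x + y) (a *: u + v)) ->
    (forall y, r 0 y -> y = 0) ->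
  exists f : {linear M -> N}, forall x y, r x y <-> f x = y.
Proof.
move=> /choice[f rf] rD r0.
have r_fun x u v : r x u -> r x v -> u = v.
  move=> xu xv; apply/eqP; rewrite -subr_eq0; apply/eqP/r0.
  by have := rD (-1) x x v u xv xu; rewrite !scaleN1r addNr addrC.
have flin : linear f by move=> a x y; apply: r_fun (rf _) _; exact: rD.
pose lf := GRing.isLinear.Build A M N _ f flin.
pose g : {linear M -> N} := HB.pack f lf.
by exists g => x y; split=> [xy|<- //]; apply: r_fun xy; exact: rf.
Qed.

Lemma linear_inj M N (f : {linear M -> N}) : (forall x, f x = 0 -> x = 0) -> injective f.
Proof.
move=> f0 x y xy; apply/eqP; rewrite -subr_eq0; apply/eqP/f0.
by rewrite linearB xy subrr.
Qed.

Lemma submodule_exists M (U : set M) : submod U ->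
  exists (S : lmodType A) (i : {linear S -> M}),
    injective i /\ forall z, U z <-> exists w, z = i w.
Proof.
move=> UP; exists (submodule UP), (val : {linear submodule UP -> M}).
split=> [|z]; first exact: val_inj.
split=> [/(submod_predP UP) Uz|[w ->]]; first by exists (Submodule Uz).
by apply/submod_predP; exact: (valP w).
Qed.

Lemma quotient_exists M (U : set M) : submod U ->
  exists (Q : lmodType A) (q : {linear M -> Q}),
    (forall z, q z = 0 <-> U z) /\ forall w, exists z, q z = w.
Proof.
move=> UP; pose Q0 := {ideal_quot (submod_pred UP)}.
have [|||q qP] := @linear_of_rel M (quotient_module UP) (fun x w => w = \pi_Q0 x).
- by move=> x; exists (\pi_Q0 x).
- move=> a x y u v -> ->.
  by rewrite [_ *: _]quotient_pi_scale -[LHS](raddfD \pi_Q0).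
- by move=> y ->; apply: (raddf0 \pi_Q0).
exists (quotient_module UP), q; split=> [z|w].
  rewrite -qP -[z in U z]subr0 -(quotient_pi_eq UP) [\pi_Q0 0](raddf0 \pi_Q0).
  by split.
by exists (repr (w : Q0)); apply/qP; rewrite reprK.
Qed.

Lemma factor_surj M N E (q : {linear M -> N}) (f : {linear M -> E}) :
    (forall y, exists x, q x = y) -> (forall x, q x = 0 -> f x = 0) ->
  exists g : {linear N -> E}, forall x, g (q x) = f x.
Proof.
move=> qS fq.
have [||_ [x [/fq fx <-]] //|g gP] :=
    @linear_of_rel N E (fun y z => exists x, q x = y /\ f x = z).
- by move=> y; have [x <-] := qS y; exists (f x), x.
- move=> a _ _ _ _ [x [<- <-]] [y [<- <-]]; exists (a *: x + y).
  by rewrite !linearP.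
by exists g => x; apply/gP; exists x.
Qed.

Lemma factor_inj M N E (i : {linear N -> M}) (f : {linear E -> M}) :
    injective i -> (forall x, exists y, f x = i y) ->
  exists g : {linear E -> N}, forall x, i (g x) = f x.
Proof.
move=> iI fi; have [||y|g gP] := @linear_of_rel E N (fun x y => f x = i y).
- by [].
- by move=> a x y u v xu yv; rewrite !linearP xu yv.
- by by rewrite linear0 -(linear0 i) => /iI.
by exists g => x; apply/esym/gP.
Qed.

End Maps.

(** * Noetherian modules, local rings and primes *)

Definition noetherian_module (A : pzRingType) (M : lmodType A) : Prop :=
  forall F : set (set M), (forall U, F U -> submod U) -> (exists U, F U) ->
    exists2 U, F U & forall V, F V -> U `<=` V -> V `<=` U.

(** Without a maximal member, choice yields a strictly increasing chain; its union is a finitely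
    generated ideal, hence already reached at a finite stage. *)
Lemma noetherian_maximal (A : comNzRingType) :
  noetherian A -> noetherian_module (A^o : lmodType A).
Proof.
move=> hA F FS [U0 FU0]; apply: contrapT => nomax.
have /choice[next nextP] (U : set A^o) : exists V : set A^o,
    F U -> [/\ F V, U `<=` V & ~ V `<=` U].
  have [FU|nFU] := pselect (F U); last by exists U.
  apply: contrapT => noV; apply: nomax; exists U => // V FV UV.
  by apply: contrapT => nVU; apply: noV; exists V.
pose C n := iter n next U0.
have CF n : F (C n) by elim: n => // n /nextP[].
have CS n : C n `<=` C n.+1 by have [] := nextP _ (CF n).
have Cmon m n : (m <= n)%N -> C m `<=` C n.
  by move/subnK <-; elim: (n - m)%N => // k IHk x /IHk /CS.
pose D : {pred A^o} := [pred x | `[< exists n, C n x >]].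
have DS : GRing.submod_closed D.
  split; first by apply/asboolP; exists 0%N; have [] := FS _ (CF 0%N).
  move=> a x y /asboolP[m Cx] /asboolP[n Cy]; apply/asboolP; exists (maxn m n).
  have [_] := FS _ (CF (maxn m n)); apply.
    by apply: Cmon Cx; rewrite leq_maxl.
  by apply: Cmon Cy; rewrite leq_maxr.
have [s [sD sG]] := hA _ DS.
have [N sN] : exists N, {in s, forall x, C N x}.
  elim: s sD {sG} => [|x s IHs] sD; first by exists 0%N.
  have [y ys|N sN] := IHs; first by apply: sD; rewrite inE ys orbT.
  have /asboolP[m Cx] : x \in D by apply: sD; rewrite mem_head.
  exists (maxn m N) => y; rewrite inE => /predU1P[->|/sN].
    by apply: Cmon Cx; rewrite leq_maxl.
  by apply: Cmon; rewrite leq_maxr.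
have [_ _] := nextP _ (CF N); apply=> x Cx.
have [C0 CD] := FS _ (CF N).
suff : x \in [pred x | `[< C N x >]] by move/asboolP.
apply: sG => [|y ys|]; last by apply/asboolP; exists N.+1.
  by split=> [|a y z /asboolP Cy /asboolP Cz]; apply/asboolP => //; apply: CD.
by apply/asboolP/sN.
Qed.

Fixpoint spanned (A : pzRingType) (M : lmodType A) (s : seq M) (z : M) : Prop :=
  if s is g :: s' then exists a, spanned s' (z - a *: g) else z = 0.

Section Span.
Variables (A : pzRingType) (M : lmodType A).

Lemma spanned_submod (s : seq M) : submod (spanned s).
Proof.
elim: s => [|g s [IH0 IHD]] /=.
  by split=> // a x y -> ->; rewrite scaler0 addr0.
split; first by exists 0; rewrite scale0r subr0.
move=> a x y [b xb] [c yc]; exists (a * b + c).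
by rewrite scalerDl opprD addrACA -scalerA -scalerBr; apply: IHD.
Qed.

Lemma spanned_mem (s : seq M) x : x \in s -> spanned s x.
Proof.
elim: s => //= g s IHs; rewrite inE => /predU1P[->|/IHs xs].
  by exists 1; rewrite scale1r subrr; case: (spanned_submod s).
by exists 0; rewrite scale0r subr0.
Qed.

Lemma spanned_min (s : seq M) (U : set M) : submod U -> {in s, forall x, U x} ->
  spanned s `<=` U.
Proof.
move=> UP; elim: s => /= [|g s IHs] sU z; first by move=> ->; exact: submod0.
case=> a /IHs Uz; rewrite -[z](subrK (a *: g)); apply: submodD => //.
  by apply: Uz => x xs; apply: sU; rewrite inE xs orbT.
by apply: submodZ => //; apply: sU; rewrite mem_head.
Qed.

Lemma fg_spanned : fg_module M -> exists s : seq M, forall z, spanned s z.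
Proof.
case=> s [_ sG]; exists s => z.
suff : z \in [pred z | `[< spanned s z >]] by move/asboolP.
apply: sG => // [|x xs]; last by apply/asboolP; apply: spanned_mem.
have [s0 sD] := spanned_submod s.
by split=> [|a y x /asboolP ys /asboolP xs]; apply/asboolP => //; apply: sD.
Qed.

Lemma fg_noetherian :
  noetherian_module (A^o : lmodType A) -> fg_module M -> noetherian_module M.
Proof.
move=> hA /fg_spanned[s sM].
(* Maximality is only tested inside [spanned s], so that one generator can be added at a time. With
   [I V] the ideal of coefficients of [g] in [V], first [I V] is made maximal, then the part in the
   span of the other generators. *)
suff P : forall F : set (set M), (forall U, F U -> submod U) -> (exists U, F U) ->
    exists2 U, F U & forall V, F V -> U `<=` V -> spanned s `&` V `<=` U.
  move=> F FS F0; have [U FU Umax] := P F FS F0.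
  by exists U => // V FV UV z Vz; apply: (Umax V).
elim: s {sM} => [|g s IHs] F FS [U FU].
  by exists U => // V _ _ z [-> _]; apply: submod0; apply: FS.
pose I (V : set M) : set A^o := [set a : A | exists2 x, spanned s x & V (a *: g + x)].
have IS V : F V -> submod (I V).
  move=> /FS VP; have sS := spanned_submod s.
  split; first by exists 0; rewrite ?scale0r ?addr0; exact: submod0.
  move=> a b c [x sx Vx] [y sy Vy]; exists (a *: x + y).
    by apply: submodD => //; apply: submodZ.
  rewrite scalerDl -scalerA addrACA -scalerDr.
  by apply: submodD => //; apply: submodZ.
have [||J [U0 FU0 IU0] Jmax] := hA [set J | exists2 V, F V & I V = J].
- by move=> _ [V FV <-]; apply: IS.
- by exists (I U), U.
have [||U1 [FU1 U01] U1max] := IHs [set V | F V /\ U0 `<=` V].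
- by move=> V [/FS].
- by exists U0; split.
exists U1 => // V FV U1V z [[a sza] Vz].
have : I U1 a.
  have [x sx U0x] : I U0 a.
    rewrite IU0; apply: (Jmax (I V)); first by exists V.
      rewrite -IU0 => b [x sx U0x]; exists x => //; exact/U1V/U01.
    by exists (z - a *: g); rewrite // addrC subrK.
  by exists x => //; apply: U01.
case=> x sx U1x.
suff U1zx : U1 (z - (a *: g + x)).
  by rewrite -[z](subrK (a *: g + x)); apply: submodD => //; exact: FS.
apply: (U1max V) => //; first by split=> // w /U01 /U1V.
split; last by apply: submodB => //; [exact: FS|exact: U1V].
rewrite opprD addrA; apply: submodB => //; exact: spanned_submod.
Qed.

End Span.

Section LocalRing.
Variable A : comNzRingType.
Implicit Type M : lmodType A.

Lemma nonunitP (x : A) : reflect (~ exists y, x * y = 1) (x \in @nonunit A).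
Proof. exact: asboolPn. Qed.

Lemma nonunitM (a x : A) : x \in @nonunit A -> a * x \in @nonunit A.
Proof.
move=> /nonunitP xN; apply/nonunitP => -[y axy]; apply: xN.
by exists (a * y); rewrite mulrCA mulrA.
Qed.

Lemma nonunit0 : 0 \in @nonunit A.
Proof. by apply/nonunitP => -[y] /eqP; rewrite mul0r eq_sym oner_eq0. Qed.

Lemma notin_nonunit x : x \notin @nonunit A -> exists y, x * y = 1.
Proof. by move=> xN; apply: contrapT => /nonunitP; apply/negP. Qed.

Lemma nonunit1 : 1 \notin @nonunit A.
Proof. by apply/nonunitP; apply; exists 1; rewrite mulr1. Qed.

(** For a nonzero commutative ring this is equivalent to being local. *)
Definition nonunits_add : Prop :=
  forall a b, a \in @nonunit A -> b \in @nonunit A -> a + b \in @nonunit A.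

Lemma unit_scale M (U : set M) a z : submod U -> a \notin @nonunit A ->
  U (a *: z) -> U z.
Proof.
move=> UP /notin_nonunit[b ab] Uaz.
by rewrite -[z]scale1r -ab mulrC -scalerA; apply: submodZ.
Qed.

Hypothesis A_local : nonunits_add.

Lemma sub1_nonunit a : a \in @nonunit A -> 1 - a \notin @nonunit A.
Proof.
move=> aN; apply/negP => /A_local /(_ aN); rewrite subrK.
by rewrite (negPf nonunit1).
Qed.

(* The hypothesis states that K is contained in U + m K. *)
Lemma nakayama M (U K : set M) : noetherian_module M -> submod U -> submod K ->
    (forall V : set M, submod V -> U `<=` V ->
      (forall a k, a \in @nonunit A -> K k -> V (a *: k)) -> K `<=` V) ->
  K `<=` U.
Proof.
move=> hM UP KP KU; apply: contrapT => nKU.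
have [||V [VP UV nKV] Vmax] :=
    hM [set V : set M | [/\ submod V, U `<=` V & ~ K `<=` V]].
- by move=> V [].
- by exists U; split.
have [k [Kk nVk]] : exists k, K k /\ ~ V k.
  by apply: contrapT => h; apply: nKV => k Kk; apply: contrapT => nVk; apply: h; exists k.
(* By maximality of [V], adjoining any element outside [V] captures all of [K]. *)
have grow g : ~ V g -> K `<=` [set z | exists b, V (z - b *: g)].
  move=> nVg; set W := [set _ | _]; apply: contrapT => nKW.
  apply: nVg; apply: (Vmax W); last by exists 1; rewrite scale1r subrr; exact: submod0.
    split=> // [|z /UV Vz]; last by exists 0; rewrite scale0r subr0.
    split; first by exists 0; rewrite scale0r subr0; exact: submod0.
    move=> a x y [b Vx] [c Vy]; exists (a * b + c).
    rewrite scalerDl opprD addrACA -scalerA -scalerBr.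
    by apply: submodD => //; apply: submodZ.
  by move=> z Vz; exists 0; rewrite scale0r subr0.
apply: nKV; apply: KU => // a k' aN Kk'.
have [b Vb] := grow _ nVk _ Kk'.
have -> : a *: k' = a *: (k' - b *: k) + b *: (a *: k).
  by rewrite scalerBr !scalerA [b * a]mulrC subrK.
apply: submodD => //; apply: submodZ => //.
(* Otherwise [k] lies in V + A (a k), so (1 - c a) k is in [V] with 1 - c a invertible. *)
apply: contrapT => nVak; apply: nVk.
have [c Vc] := grow _ nVak _ Kk.
apply: (@unit_scale _ V (1 - c * a)) => //.
  by apply: sub1_nonunit; apply: nonunitM.
by rewrite scalerBl scale1r -scalerA.
Qed.

End LocalRing.

(** * Prime avoidance and associated primes *)

Section Primes.
Variable A : comNzRingType.
Implicit Types (M : lmodType A) (P : set A^o).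

Definition prime_set P : Prop :=
  [/\ submod P, ~ P 1 & forall a b : A, P (a * b) -> P a \/ P b].

Definition colon M (U : set M) (z : M) : set A^o := [set a : A | U (a *: z)].

Lemma colon_submod M (U : set M) z : submod U -> submod (colon U z).
Proof.
move=> UP; split=> [|a b c Ub Uc]; rewrite /colon /=.
  by rewrite scale0r; exact: submod0.
by rewrite scalerDl -scalerA; apply: submodD => //; apply: submodZ.
Qed.

(** A maximal colon ideal is prime: if a b z is in [U] but b z is not, the colon ideal of b z
    contains that of [z], hence equals it, and it contains [a]. The set [Z] allows the search to be
    confined, for instance to the multiples of one element. *)
Lemma exists_prime_colon M (U Z : set M) :
    noetherian_module (A^o : lmodType A) -> submod U -> (exists z, Z z) ->
    (forall z, Z z -> ~ U z) -> (forall z b, Z z -> ~ U (b *: z) -> Z (b *: z)) ->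
  exists z, [/\ Z z, prime_set (colon U z)
    & forall w, Z w -> colon U z `<=` colon U w -> colon U w `<=` colon U z].
Proof.
move=> hA UP [z0 Zz0] ZU ZM.
have [||_ [z Zz <-] zmax] := hA [set I | exists2 z, Z z & colon U z = I].
- by move=> _ [z _ <-]; apply: colon_submod.
- by exists (colon U z0), z0.
have zmax' w : Z w -> colon U z `<=` colon U w -> colon U w `<=` colon U z.
  by move=> Zw; apply: zmax; exists w.
exists z; split=> //; split; first exact: colon_submod.
  by rewrite /colon /= scale1r; apply: ZU.
move=> a b Uab; have [Ub|nUb] := pselect (U (b *: z)); first by right.
left; apply: (zmax' (b *: z)); first exact: ZM.
  by move=> c Uc; rewrite /colon /= scalerA mulrC -scalerA; apply: submodZ.
by rewrite /colon /= scalerA.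
Qed.

Lemma prime_prod P (s : seq A) : prime_set P -> P (\prod_(a <- s) a) ->
  exists2 a, a \in s & P a.
Proof.
case=> _ P1 PM; elim: s => [|a s IHs]; first by rewrite big_nil.
rewrite big_cons => /PM[Pa|/IHs[b bs Pb]]; first by exists a; rewrite ?mem_head.
by exists b; rewrite // inE bs orbT.
Qed.

Lemma prime_avoidance (m : set A^o) (L : seq (set A^o)) : submod m ->
    {in L, forall P, prime_set P /\ ~ m `<=` P} ->
  exists2 a, m a & {in L, forall P : set A^o, ~ P a}.
Proof.
move=> mP; have [n] := ubnP (size L); elim: n L => // n IHn [|Q L] /= sL LP.
  by exists 0; [exact: submod0|].
have [[P PL PQ]|noP] := pselect (exists2 P, P \in L & P `<=` Q).
  have [||a ma aL] := IHn (Q :: rem P L).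
  - by rewrite /= size_rem // prednK // -has_predT; apply/hasP; exists P.
  - move=> P'; rewrite inE => /predU1P[->|/mem_rem P'L]; apply: LP.
      by rewrite mem_head.
    by rewrite inE P'L orbT.
  exists a => // P'; rewrite inE => /predU1P[->|P'L]; first by apply: aL;
    rewrite mem_head.
  have [->|neP] := eqVneq P' P; first by move=> /PQ; apply: aL; rewrite mem_head.
  by apply: aL; rewrite inE; apply/orP; right; move: P'L;
    rewrite (perm_mem (perm_to_rem PL)) inE (negPf neP).
have [QP nmQ] := LP Q (mem_head _ _).
have LP' : {in L, forall P, prime_set P /\ ~ m `<=` P}.
  by move=> P PL; apply: LP; rewrite inE PL orbT.
have [a ma aL] := IHn L sL LP'.
have [Qa|nQa] := pselect (Q a); last first.
  by exists a => // P; rewrite inE => /predU1P[->|/aL].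
have [mu [mmu nQmu]] : exists mu, m mu /\ ~ Q mu.
  by apply: contrapT => h; apply: nmQ => x mx; apply: contrapT => Qx; apply: h; exists x.
have /choice[c cP] (P : set A^o) : exists c : A, P \in L -> P c /\ ~ Q c.
  have [PL|] := boolP (P \in L); last by exists 0.
  apply: contrapT => h; apply: noP; exists P => // x Px.
  by apply: contrapT => Qx; apply: h; exists x.
(* [b] lies in [m] and in every prime of [L] but not in [Q], so a + b leaves [Q] and still avoids
   [L]. *)
pose b : A := mu * \prod_(x <- map c L) x.
have nQb : ~ Q b.
  have [_ _ QM] := QP; case/QM => // /(prime_prod QP)[x /mapP[P PL ->]].
  by have [] := cP P PL.
have Lb P : P \in L -> P b.
  move=> PL; have [[PS _ _] _] := LP' P PL;
    rewrite /b big_map (big_rem P) //= mulrA mulrAC.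
  by apply: (submodZ PS (_ * _)); have [] := cP P PL.
have mb : m b by rewrite /b mulrC; apply: (submodZ mP).
exists (a + b); first exact: submodD.
move=> P; rewrite inE => /predU1P[->|PL] Pab.
  by have [QS _ _] := QP; apply: nQb; apply/(submodDl QS b Qa).
have [[PS _ _] _] := LP' P PL; apply: (aL P PL); apply/(submodDl PS a (Lb P PL)).
by rewrite addrC.
Qed.

(** The maximal colon ideals already cover the zero divisors on M / U. They are finitely many:
    choose a finite list [s] of elements with maximal colon ideal for which U plus the span of [s]
    is as large as possible; every further such element then lies in that submodule. *)
Lemma associated_primes M (U : set M) :
    noetherian_module (A^o : lmodType A) -> noetherian_module M -> submod U ->
  exists L : seq (set A^o),
    {in L, forall P, prime_set P /\ exists2 z, ~ U z & P = colon U z} /\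
    forall (a : A) z, ~ U z -> U (a *: z) -> exists2 P : set A^o, P \in L & P a.
Proof.
move=> hA hM UP.
pose good z := [/\ ~ U z, prime_set (colon U z)
  & forall w, ~ U w -> colon U z `<=` colon U w -> colon U w `<=` colon U z].
pose S (s : seq M) : set M := [set x | exists2 u, U u & spanned s (x - u)].
have SS s : submod (S s).
  split; first by exists 0; rewrite ?subr0; apply: submod0 => //; exact: spanned_submod.
  move=> a x y [u Uu xu] [v Uv yv]; exists (a *: u + v).
    by apply: submodD => //; apply: submodZ.
  rewrite opprD addrACA -scalerBr.
  by have [_] := spanned_submod s; apply.
have [||_ [s sgood <-] smax] := hM [set V | exists2 s, {in s, forall z,
  good z} & S s = V].
- by move=> _ [s _ <-].
- by exists (S [::]), [::].
exists [seq colon U z | z <- s]; split=> [_ /mapP[z /sgood[nUz zp _] ->]|a z nUz Uaz].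
  by split=> //; exists z.
have [|||w [[nUw Uaw] wp wmax]] := @exists_prime_colon M U
    [set w | ~ U w /\ U (a *: w)] hA UP.
- by exists z.
- by move=> w [].
- move=> w b [nUw Uaw] nUbw; split=> //.
  by rewrite scalerA mulrC -scalerA; apply: submodZ.
have wgood : good w.
  split=> // w' nUw' ww'; apply: wmax => //; split=> //; exact: ww'.
have [u Uu] : S s w.
  apply: (smax (S (w :: s))).
  - by exists (w :: s) => // z'; rewrite inE => /predU1P[->|/sgood].
  - by move=> x [v Uv xv]; exists v => //=; exists 0; rewrite scale0r subr0.
  exists 0; first exact: submod0.
  by rewrite subr0; apply: spanned_mem; rewrite mem_head.
move=> sw; have [/hasP[z' z's /asboolP z'w]|] := boolP (has (fun z =>
  `[< colon U z `<=` colon U w >]) s).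
  exists (colon U z'); first exact: (map_f (colon U) z's).
  have [_ _ z'max] := sgood _ z's; exact: (z'max w nUw z'w a Uaw).
move=> /hasPn noz; exfalso.
have /choice[c cP] (z' : M) : exists c : A, z' \in s -> U (c *: z') /\ ~ U (c *: w).
  have [/noz /asboolPn nz|] := boolP (z' \in s); last by exists 0.
  apply: contrapT => h; apply: nz => x Ux.
  by apply: contrapT => nUx; apply: h; exists x.
(* [b] sends the span of [s] into [U], hence also [w]; the prime [colon U w] then contains one of
   the factors, against their choice. *)
pose b : A := \prod_(x <- map c s) x.
have [x /mapP[z' z's ->]] : exists2 x, x \in map c s & colon U w x.
  apply: prime_prod => //; rewrite -/b /colon /=.
  rewrite -[w](subrK u) scalerDr; apply: submodD => //; last exact: submodZ.
  apply: (spanned_min (U := [set x | U (b *: x)])) sw.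
    split=> [|e x y Ux Uy]; first by rewrite /= scaler0; exact: submod0.
    by rewrite /= scalerDr scalerA mulrC -scalerA; apply: submodD => //; apply: submodZ.
  move=> z' z's; rewrite /b /= big_map (big_rem z') //= mulrC -scalerA.
  by apply: submodZ => //; have [] := cP z' z's.
by have [_] := cP z' z's.
Qed.

End Primes.

(** * Regular sequences *)

Section RegularSequences.
Variable A : comNzRingType.
Implicit Types M N : lmodType A.

Definition regular_mod M (U : set M) (x : A) : Prop := forall z, U (x *: z) -> U z.

Definition add_mul M (U : set M) (x : A) : set M := [set z | exists w, U (z - x *: w)].

Fixpoint regular_seq_mod M (U : set M) (s : seq A) : Prop :=
  if s is x :: s' then
    [/\ x \in @nonunit A, regular_mod U x & regular_seq_mod (add_mul U x) s']
  else exists z, ~ U z.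

Lemma add_mul_submod M (U : set M) x : submod U -> submod (add_mul U x).
Proof.
move=> UP; split; first by exists 0; rewrite scaler0 subr0; exact: submod0.
move=> a y z [v Uv] [w Uw]; exists (a *: v + w).
rewrite scalerDr opprD addrACA scalerA mulrC -scalerA -scalerBr.
by apply: submodD => //; apply: submodZ.
Qed.

Lemma foldl_add_mul_submod M (U : set M) s : submod U -> submod (foldl (@add_mul M) U s).
Proof. by elim: s U => //= x s IHs U UP; apply: IHs; exact: add_mul_submod. Qed.

Lemma sub_add_mul M (U : set M) x : U `<=` add_mul U x.
Proof. by move=> z Uz; exists 0; rewrite scaler0 subr0. Qed.

Lemma sub_foldl_add_mul M (U : set M) s : U `<=` foldl (@add_mul M) U s.
Proof. by elim: s U => [|x s IHs] U /=; [move=> z|move=> z Uz; apply: IHs;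
  apply: sub_add_mul]. Qed.

Lemma add_mul_mem M (U : set M) x z : submod U -> add_mul U x (x *: z).
Proof. by move=> UP; exists z; rewrite subrr; exact: submod0. Qed.

Lemma foldl_add_mul_mem M (U : set M) s x z : submod U -> x \in s ->
  foldl (@add_mul M) U s (x *: z).
Proof.
elim: s U => //= y s IHs U UP; rewrite inE => /predU1P[->|xs].
  by apply: sub_foldl_add_mul; apply: add_mul_mem.
by apply: IHs => //; apply: add_mul_submod.
Qed.

Lemma add_mulC M (U : set M) x y :
  add_mul (add_mul U x) y = add_mul (add_mul U y) x.
Proof.
by apply/predeqP => z; split=> -[w [v Uz]]; exists v, w; rewrite addrAC.
Qed.

Lemma foldl_add_mulP M (U : set M) s z :
  foldl (@add_mul M) U s z <-> exists2 u, U u & in_seq_mul s (z - u).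
Proof.
elim: s U => [|x s IHs] U /=.
  split=> [Uz|[u Uu [w]]]; last by rewrite big_ord0 => /eqP; rewrite subr_eq0 => /eqP ->.
  by exists z; rewrite // subrr; exists (fun=> 0); rewrite big_ord0.
apply: (iff_trans (IHs _)); split=> [[u [w Uu] [v zu]]|[u Uu [w]]].
  exists (u - x *: w) => //.
  exists (fun i : 'I_(size s).+1 => oapp v w (unlift ord0 i)).
  rewrite big_ord_recl unlift_none /= opprB addrCA zu; congr (_ + _).
  by apply: eq_bigr => i _; rewrite liftK.
rewrite big_ord_recl /= => zu; exists (u + x *: w ord0).
  by exists (w ord0); rewrite addrK.
by exists (fun i => w (lift ord0 i)); rewrite opprD addrA zu addrAC subrr add0r.
Qed.

Lemma in_seq_mulE M s : @in_seq_mul _ M s = foldl (@add_mul M) [set 0] s.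
Proof.
apply/predeqP => z; split=> [zs|/foldl_add_mulP[_ ->]]; last by rewrite subr0.
by apply/foldl_add_mulP; exists 0; rewrite ?subr0.
Qed.

Lemma regular_seq_modP M (U : set M) s : regular_seq_mod U s <->
  [/\ {subset s <= @nonunit A},
    forall i, (i < size s)%N -> regular_mod (foldl (@add_mul M) U (take i s)) s`_i
    & exists z, ~ foldl (@add_mul M) U s z].
Proof.
elim: s U => [|x s IHs] U /=; first by split=> [Uz|[]].
split=> [[xN xU /IHs[sN sU Uz]]|[sN sU Uz]].
  split=> // [y|[|i] //=]; last exact: sU.
  by rewrite inE => /predU1P[->|/sN].
split; [by apply: sN; rewrite mem_head|exact: (sU 0%N)|apply/IHs; split=> //].
  by move=> y ys; apply: sN; rewrite inE ys orbT.
by move=> i si; apply: (sU i.+1).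
Qed.

Lemma regular_seqE M s : regular_seq M s <-> regular_seq_mod ([set 0] : set M) s.
Proof.
split=> [[sN sM [z sz]]|/regular_seq_modP[sN sM [z sz]]].
  apply/regular_seq_modP; split=> // [i si w|]; last by exists z; rewrite -in_seq_mulE.
  by rewrite -in_seq_mulE; apply: sM.
split=> // [i si w|]; last by exists z; rewrite in_seq_mulE.
by rewrite in_seq_mulE; apply: sM.
Qed.

Lemma regular_seq_mod_proper M (U : set M) s : regular_seq_mod U s -> exists z, ~ U z.
Proof.
move=> /regular_seq_modP[_ _ [z nUz]]; exists z => Uz; apply: nUz.
exact: sub_foldl_add_mul.
Qed.

(** If x w = z v modulo [U], then z v is in U + x M, so v = x v' modulo [U], and [x] can be
    cancelled. *)
Lemma regular_swap M (U : set M) x z : submod U ->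
  regular_mod U x -> regular_mod (add_mul U x) z -> regular_mod (add_mul U z) x.
Proof.
move=> UP xU zU w [v Uv].
have [v' Uv'] : add_mul U x v.
  apply: zU; exists w; rewrite -opprB; exact: submodN.
exists v'; apply: xU.
have -> : x *: (w - z *: v') = (x *: w - z *: v) + z *: (v - x *: v').
  by rewrite !scalerBr addrA subrK !scalerA mulrC.
by apply: submodD => //; apply: submodZ.
Qed.

(* Multiplication by y followed by division by x identifies the socle of
   M / (U + x M) with that of M / (U + y M). *)
Lemma socle_exchange M (U : set M) x y : submod U ->
    regular_mod U x -> regular_mod U y ->
    (forall z, (forall a, a \in @nonunit A -> add_mul U x (a *: z)) -> add_mul U x z) ->
  x \in @nonunit A ->
  forall z, (forall a, a \in @nonunit A -> add_mul U y (a *: z)) -> add_mul U y z.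
Proof.
move=> UP xU yU sx xN z zy; have [w Uw] := zy x xN.
have [v Uv] : add_mul U x w.
  apply: sx => a aN; have [v Uv] := zy a aN; exists v; apply: yU.
  have -> : y *: (a *: w - x *: v) = x *: (a *: z - y *: v) - a *: (x *: z - y *: w).
    rewrite !scalerBr !scalerA [x * a]mulrC opprB [RHS]addrC addrA subrK.
    by rewrite [y * a]mulrC [y * x]mulrC.
  by apply: submodB => //; apply: submodZ.
exists v; apply: xU.
have -> : x *: (z - y *: v) = (x *: z - y *: w) + y *: (w - x *: v).
  by rewrite !scalerBr addrA subrK !scalerA [y * x]mulrC.
by apply: submodD => //; apply: submodZ.
Qed.

Hypotheses (A_noeth : noetherian_module (A^o : lmodType A)) (A_local : nonunits_add A).

Lemma nonunit_submod : submod ([set a | a \in @nonunit A] : set A^o).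
Proof.
split=> [|a x y xN yN]; first exact: nonunit0.
by apply: A_local yN; exact: (@nonunitM A).
Qed.

Lemma prime_nonunit (P : set A^o) : prime_set P -> P `<=` [set a | a \in @nonunit A].
Proof.
case=> PS P1 _ x Px; apply/nonunitP => -[y xy]; apply: P1.
by rewrite -xy mulrC; apply: (submodZ PS (y : A)).
Qed.

(** Vanishing of Hom(k, M / U) for the residue field k: for finitely generated modules this is
    positive depth of a nonzero M / U. *)
Definition no_socle M (U : set M) : Prop :=
  forall z, (forall a, a \in @nonunit A -> U (a *: z)) -> U z.

Lemma regular_seq_mod_no_socle M (U : set M) x s :
  regular_seq_mod U (x :: s) -> no_socle U.
Proof. by case=> xN xU _ z zU; apply/xU/zU. Qed.

(** An associated prime containing all nonunits would produce a socle element. So prime avoidance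
    applies to the associated primes of both quotients together. *)
Lemma regular_mod2 M N (U : set M) (V : set N) :
    noetherian_module M -> noetherian_module N -> submod U -> submod V ->
    no_socle U -> no_socle V ->
  exists x, [/\ x \in @nonunit A, regular_mod U x & regular_mod V x].
Proof.
move=> hM hN UP VP sU sV.
have [L [LP LU]] := associated_primes A_noeth hM UP.
have [L' [LP' LV]] := associated_primes A_noeth hN VP.
have [P|x xN xL] := prime_avoidance (L := L ++ L') nonunit_submod.
  rewrite mem_cat => /orP[/LP|/LP'] [Pp [z nz Pz]]; split=> // mP.
    by apply: nz; apply: sU => a aN; have := mP a aN; rewrite Pz.
  by apply: nz; apply: sV => a aN; have := mP a aN; rewrite Pz.
exists x; split=> // z xz; apply: contrapT => nz.
  by have [P PL] := LU x z nz xz; apply: xL; rewrite mem_cat PL.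
by have [P PL] := LV x z nz xz; apply: xL; rewrite mem_cat PL orbT.
Qed.

(** With K the set of [w] such that z w is in [U], cancellation of [x] gives K inside U + x K;
    Nakayama's lemma concludes. *)
Lemma regular_swapl M (U : set M) x z : noetherian_module M -> submod U ->
    x \in @nonunit A -> regular_mod U x -> regular_mod (add_mul U x) z ->
  regular_mod U z.
Proof.
move=> hM UP xN xU zU w; apply: (@nakayama A A_local M U [set w | U (z *: w)]) => //.
  split; first by rewrite /= scaler0; exact: submod0.
  move=> a u v /= Uu Uv; rewrite scalerDr scalerA mulrC -scalerA.
  by apply: submodD => //; apply: submodZ.
move=> V VP UV xV {}w Uw; have [v Uv] : add_mul U x w.
  by apply: zU; apply: sub_add_mul.
rewrite -[w](subrK (x *: v)); apply: submodD => //; first exact: UV.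
apply: xV => //=; apply: xU.
have -> : x *: (z *: v) = z *: w - z *: (w - x *: v).
  by rewrite scalerBr opprB addrC subrK !scalerA mulrC.
by apply: submodB => //; apply: submodZ.
Qed.

Lemma proper_add_mul M (U : set M) x : noetherian_module M -> submod U ->
  x \in @nonunit A -> (exists z, ~ U z) -> exists z, ~ add_mul U x z.
Proof.
move=> hM UP xN [z nUz]; apply: contrapT => h; apply: nUz.
apply: (@nakayama A A_local M U setT) => // V VP UV xV w _.
have [v Uv] : add_mul U x w by apply: contrapT => nw; apply: h; exists w.
by rewrite -[w](subrK (x *: v)); apply: submodD => //; [exact: UV|exact: xV].
Qed.

(** By [socle_exchange] both M / (U + x M) and M / (U + y M) have positive depth, so some [z] is
    regular on both. The induction hypothesis replaces the sequence after [x] by one starting with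
    [z]; swapping [x] and [z] and applying it again, now modulo [z], trades [x] for [y]. *)
Lemma regular_seq_mod_exchange M (U : set M) n y : noetherian_module M -> submod U ->
    (exists2 s, size s = n.+1 & regular_seq_mod U s) ->
    y \in @nonunit A -> regular_mod U y ->
  exists2 s, size s = n & regular_seq_mod (add_mul U y) s.
Proof.
move=> hM; elim: n U y => [|n IHn] U y UP [[|x s]] //= [sn] [xN xU sU] yN yU.
  exists [::] => //=; apply: proper_add_mul => //.
  by have [z nz] := regular_seq_mod_proper sU; exists z => Uz; apply/nz/sub_add_mul.
have UxP := add_mul_submod x UP; have UyP := add_mul_submod y UP.
have sx : no_socle (add_mul U x) by case: s sn sU => // x' s _ /regular_seq_mod_no_socle.
have sy : no_socle (add_mul U y) by exact: socle_exchange sx xN.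
have [z [zN zx zy]] := regular_mod2 hM hM UxP UyP sx sy.
have [t tn tU] : exists2 t, size t = n & regular_seq_mod (add_mul (add_mul U x) z) t.
  by apply: IHn => //; exists s.
have zU : regular_mod U z by exact: regular_swapl zx.
have [t' tn' tU'] : exists2 t, size t = n & regular_seq_mod (add_mul (add_mul U z) y) t.
  apply: IHn => //; first exact: add_mul_submod.
    exists (x :: t); first by rewrite /= tn.
    by split=> //; [exact: regular_swap|rewrite add_mulC].
  exact: regular_swap.
exists (z :: t'); first by rewrite /= tn'.
by split=> //; rewrite add_mulC.
Qed.

Lemma common_regular_seq M N (U : set M) (V : set N) n :
    noetherian_module M -> noetherian_module N -> submod U -> submod V ->
    (exists2 s, size s = n & regular_seq_mod U s) ->
    (exists2 s, size s = n & regular_seq_mod V s) ->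
  exists s, [/\ size s = n, regular_seq_mod U s & regular_seq_mod V s].
Proof.
move=> hM hN; elim: n U V => [|n IHn] U V UP VP [s sn sU] [t tn tV].
  by case: s t sn sU tn tV => // -[] // _ sU _ tV; exists [::].
have sU0 : no_socle U by case: s sn sU => // x s _ /regular_seq_mod_no_socle.
have tV0 : no_socle V by case: t tn tV => // x t _ /regular_seq_mod_no_socle.
have [x [xN xU xV]] := regular_mod2 hM hN UP VP sU0 tV0.
have [||r [rn rU rV]] := IHn (add_mul U x) (add_mul V x) (add_mul_submod x UP)
  (add_mul_submod x VP).
- by apply: regular_seq_mod_exchange => //; exists s.
- by apply: regular_seq_mod_exchange => //; exists t.
by exists (x :: r); split=> //=; rewrite rn.
Qed.

(** Take an ideal maximal among those containing [J] and disjoint from the multiplicative set [C] of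
    all s x^n with [s] outside [P]. Regularity of [x] modulo [J] is what keeps [J] disjoint from
    [C]. *)
Lemma smaller_prime (J P : set A^o) (x : A) : submod J -> prime_set P ->
    J `<=` P -> P x -> regular_mod J x ->
  exists P' : set A^o, [/\ prime_set P', J `<=` P', P' `<=` P & ~ P' x].
Proof.
move=> JS [PS P1 PM] JP Px xJ.
pose C : set A^o := [set b : A | exists s n, ~ P s /\ b = s * x ^+ n].
have CM a b : C a -> C b -> C (a * b).
  move=> [s [n [Ps ->]]] [t [k [Pt ->]]]; exists (s * t), (n + k)%N.
  by split; [case/PM|rewrite mulrACA exprD].
have JC b : J b -> ~ C b.
  move=> Jb [s [n [Ps bE]]]; apply: Ps; apply: JP; move: Jb; rewrite {}bE.
  elim: n => [|n IHn]; first by rewrite mulr1.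
  by rewrite exprS mulrCA => /xJ.
have [||Q [QS JQ QC] Qmax] :=
    A_noeth (F := [set I | [/\ submod I, J `<=` I & forall b, I b -> ~ C b]]).
- by move=> I [].
- by exists J; split.
have Q1 : ~ Q 1 by move=> /QC; apply; exists 1, 0%N; rewrite mulr1.
have grow a : ~ Q a -> exists b q, Q q /\ C (q + b * a).
  move=> nQa; apply: contrapT => h; apply: nQa.
  apply: (Qmax [set z | exists b : A, Q (z - b * a)]).
  - split.
    + split; first by exists 0; rewrite mul0r subr0; exact: (submod0 QS).
      move=> c u v [b Qu] [d Qv]; exists (c * b + d).
      rewrite mulrDl opprD addrACA -mulrA -[c *: _]/(c * _) -mulrBr.
      by apply: (submodD QS) => //; apply: (submodZ QS c).
    + by move=> z Jz; exists 0; rewrite mul0r subr0; apply: JQ.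
    + by move=> z [b Qz] Cz; apply: h; exists b, (z - b * a); rewrite subrK.
  - by move=> z Qz; exists 0; rewrite mul0r subr0.
  - by exists 1; rewrite mul1r subrr; exact: (submod0 QS).
exists Q; split=> //.
- split=> // a b Qab; apply: contrapT =>
  /not_orP[/grow[c [q [Qq Cq]]] /grow[d [r [Qr Cr]]]].
  apply: (QC _ _ (CM _ _ Cq Cr)); rewrite mulrDl; apply: (submodD QS) => //.
    by rewrite mulrC; apply: (submodZ QS (_ + _)).
  rewrite mulrDr; apply: (submodD QS) => //; first exact: (submodZ QS (_ * _)).
  by rewrite mulrACA; apply: (submodZ QS (_ * _)).
- by move=> b Qb; apply: contrapT => nPb; apply: (QC b Qb); exists b, 0%N; rewrite mulr1.
- by move=> /QC; apply; exists 1, 1%N; rewrite mul1r.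
Qed.

(** Each element of [s], removed from the right, yields by [smaller_prime] one strict step down from
    [P]. *)
Lemma regular_seq_prime_chain (J P : set A^o) s : submod J -> regular_seq_mod J s ->
    prime_set P -> foldl (@add_mul A^o) J s `<=` P ->
  exists Q : nat -> set A^o, [/\ forall i, (i <= size s)%N -> prime_set (Q i),
    forall i, (i < size s)%N -> Q i `<=` Q i.+1 /\ ~ Q i.+1 `<=` Q i & Q (size s) = P].
Proof.
elim/last_ind: s P => [|s x IHs] P JS sJ Pp JP.
  by exists (fun=> P); split.
move/regular_seq_modP: sJ => [sN sJ [z nz]].
have sJ' : regular_seq_mod J s.
  apply/regular_seq_modP; split.
  - by move=> y ys; apply: sN; rewrite mem_rcons inE ys orbT.
  - move=> i si; have := sJ i; rewrite size_rcons nth_rcons si -cats1 takel_cat ?(ltnW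
    si) //.
    by apply; rewrite ltnS ltnW.
  - by exists z => Jz; apply: nz; rewrite -cats1 foldl_cat; apply: sub_add_mul.
have Js := foldl_add_mul_submod s JS.
have xJ : regular_mod (foldl (@add_mul A^o) J s) x.
  have := sJ (size s); rewrite size_rcons nth_rcons ltnn eqxx ltnSn -cats1
    take_size_cat //.
  exact.
rewrite -cats1 foldl_cat /= in JP.
have [||Q [Qp JQ QP nQx]] := smaller_prime Js Pp _ _ xJ.
- by move=> y Jy; apply: JP; apply: sub_add_mul.
- by apply: JP; have := add_mul_mem x (1 : A^o) Js; rewrite /GRing.scale /= mulr1.
have [C [Cp CS CQ]] := IHs Q JS sJ' Qp JQ.
exists (fun i => if (i <= size s)%N then C i else P); rewrite size_rcons; split.
- by move=> i; case: ifP => [si _|_ _] //; apply: Cp.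
- move=> i; rewrite ltnS => si; have [->|nei] := eqVneq i (size s); last first.
    have {}si : (i < size s)%N by rewrite ltn_neqAle nei.
    by rewrite (ltnW si) si; apply: CS.
  rewrite leqnn ltnn CQ; split=> // PQ; apply/nQx/PQ.
  by apply: JP; have := add_mul_mem x (1 : A^o) Js; rewrite /GRing.scale /= mulr1.
- by rewrite ltnn.
Qed.

(** If [P] were smaller than the maximal ideal, the chain of length [d] below [P] could be prolonged
    by that ideal, against dim A = d. *)
Lemma parameter_prime d s (P : set A^o) : krull_dim A d -> size s = d ->
    regular_seq_mod ([set 0] : set A^o) s -> prime_set P ->
    foldl (@add_mul A^o) [set 0] s `<=` P ->
  [set a | a \in @nonunit A] `<=` P.
Proof.
move=> [_ dmax] sd sA Pp JP; apply: contrapT => nmP.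
have [C [Cp CS CP]] := regular_seq_prime_chain (@set0_submod A A^o) sA Pp JP.
pose D i : set A^o := if (i <= d)%N then C i else [set a | a \in @nonunit A].
have Dp i : prime_set (D i).
  rewrite /D; case: ifP => [id|_]; first by apply: Cp; rewrite sd.
  split; [exact: nonunit_submod|exact/negP/nonunit1|move=> a b abN].
  apply: contrapT => /not_orP[/negP/notin_nonunit[a' aa'] /negP/notin_nonunit[b' bb']].
  by move/nonunitP: abN; apply; exists (a' * b'); rewrite mulrACA aa' bb' mulr1.
have DS i : (i <= d)%N -> D i `<=` D i.+1 /\ ~ D i.+1 `<=` D i.
  move=> id; rewrite /D; have [->|nei] := eqVneq i d.
    by rewrite leqnn ltnn -sd CP; split=> //; exact: prime_nonunit.
  have {}id : (i < d)%N by rewrite ltn_neqAle nei.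
  by rewrite (ltnW id) id; apply: CS; rewrite sd.
have Dmon i j : (i < j <= d.+1)%N -> D i `<=` D j /\ ~ D j `<=` D i.
  elim: j => // j IHj /andP[]; rewrite !ltnS leq_eqVlt => /predU1P[->|ij] jd;
    first exact: DS.
  have [DjS nDjS] := DS j jd; have [|Dij nDij] := IHj; first by rewrite ij ltnW.
  by split=> [x /Dij /DjS //|DSi]; apply: nDij => x /DjS /DSi.
suff /dmax : prime_chain A d.+1 by rewrite ltnn.
exists (fun i : 'I_d.+2 => [pred a : A | `[< D i a >]] : {pred A}); split=> [i|i j ij].
  have [DiS Di1 DiM] := Dp i.
  split; first split.
  - by apply/asboolP; exact: (submod0 DiS).
  - exact/asboolPn.
  - move=> a u v /asboolP Du /asboolP Dv; apply/asboolP.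
    by apply: (submodD DiS) => //; apply: (submodZ DiS a).
  - by move=> u v /asboolP/DiM[Du|Dv]; apply/orP; [left|right]; apply/asboolP.
have [|Dij nDij] := Dmon i j; first by rewrite ij -ltnS ltn_ord.
split=> [x /asboolP Dx|DD]; first by apply/asboolP/Dij.
by apply: nDij => x Dx; apply/asboolP/DD/asboolP.
Qed.

(* An associated prime of A z / (U :&: A z) contains the parameter ideal (s), so
   it is the maximal ideal. *)
Lemma parameter_socle d s (M : lmodType A) (U : set M) z : krull_dim A d -> size s = d ->
    regular_seq_mod ([set 0] : set A^o) s -> submod U -> ~ U z ->
    (forall a, foldl (@add_mul A^o) [set 0] s a -> U (a *: z)) ->
  exists b, ~ U (b *: z) /\ forall a, a \in @nonunit A -> U (a *: (b *: z)).
Proof.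
move=> dA sd sA UP nUz JU.
have [|||w [[nUw [b wE]] wp _]] := @exists_prime_colon A M U
    [set w | ~ U w /\ exists b, w = b *: z] A_noeth UP.
- by exists z; split=> //; exists 1; rewrite scale1r.
- by move=> w [].
- by move=> w c [_ [b ->]] nUc; split=> //; exists (c * b); rewrite scalerA.
exists b; rewrite -wE; split=> // a aN.
apply: (parameter_prime dA sd sA wp) aN => c Jc.
by rewrite /colon /= wE scalerA mulrC -scalerA; apply/(submodZ UP)/JU.
Qed.

End RegularSequences.

(** * Injective dimension *)

Section InjectiveDimension.
Variable A : comNzRingType.
Implicit Types (M N E S T Q : lmodType A) (J I : set A^o).

Definition killed_by J M : Prop := forall (a : A) (z : M), J a -> a *: z = 0.

(* E is an injective object among the modules killed by J, that is, an
   injective A / J-module. *)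
Definition injective_over J E : Prop := killed_by J E /\
  forall (B C : lmodType A) (i : {linear B -> C}) (f : {linear B -> E}),
    killed_by J B -> killed_by J C -> injective i ->
    exists g : {linear C -> E}, forall b, g (i b) = f b.

(** An injective resolution over A / J cut into short exact sequences 0 -> M -> E -> E' -> 0, with
    the cosyzygy E' in the recursive call, so that proofs go by induction on [n]. *)
Fixpoint injdim_le J (n : nat) M : Prop :=
  if n is n'.+1 then
    exists (E E' : lmodType A) (i : {linear M -> E}) (p : {linear E -> E'}),
      [/\ injective_over J E, injective i, exact_at i p,
          forall y, exists x, p x = y & injdim_le J n' E']
  else injective_over J M.

Lemma injective_over_zero J E : (forall z : E, z = 0) -> injective_over J E.
Proof.
move=> E0; split=> [a z _|B C i f _ _ _]; first exact: E0.
by exists \0%R => b; rewrite [RHS]E0.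
Qed.

Lemma finite_injdim_le M : finite_injdim M -> exists n, injdim_le [set 0] n M.
Proof.
case=> n [E [e [d [Einj eI ed dd En]]]].
have killed0 N : killed_by [set 0] N by move=> a z ->; rewrite scale0r.
have E_inj i : injective_over [set 0] (E i).
  by split=> // B C j f _ _ jI; apply: Einj.
(* [S] is the kernel of [d k], the cosyzygy at place [k]. The induction starts at k = n + 1, where
   [E k] is zero. *)
suff K j k (S : lmodType A) (i : {linear S -> E k}) : (k + j = n.+1)%N ->
    injective i -> exact_at i (d k) -> injdim_le [set 0] j S.
  by exists n.+1; apply: (K n.+1 0%N M e).
elim: j k S i => [|j IHj] k S i.
  rewrite addn0 => kn iI _; apply: injective_over_zero => z.
  by apply: iI; rewrite [LHS]En ?[RHS]En // kn.
rewrite addnS -addSn => kj iI id.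
have KS : submod [set z | d k.+1 z = 0].
  by split=> [|a x y /= dx dy]; rewrite /= ?linear0 // linearP dx dy scaler0 addr0.
have [S' [i' [i'I i'P]]] := submodule_exists KS.
have [|p pP] := factor_inj (f := d k) i'I.
  by move=> x; apply/i'P/(dd k (d k x)); exists x.
exists (E k), S', i, p; split=> //.
- move=> x; rewrite -(id x) -pP; split=> [->|]; first by rewrite linear0.
  by rewrite -(linear0 i') => /i'I.
- move=> y; have /(dd k) [x xy] : d k.+1 (i' y) = 0 by apply/i'P; exists y.
  by exists x; apply: i'I; rewrite pP.
- by apply: (IHj k.+1 S' i') => // z; split=> [/i'P//|[w ->]]; apply/i'P; exists w.
Qed.

(* Baer's criterion; the relation r is the graph of a linear map from an ideal
   containing J to M which vanishes on J. *)
Definition baer J M : Prop := forall r : A -> M -> Prop,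
    (forall a x y u v, r x u -> r y v -> r (a * x + y) (a *: u + v)) ->
    (forall a, J a -> r a 0) -> (forall w, r 0 w -> w = 0) ->
  exists e, forall a w, r a w -> w = a *: e.

Lemma killed_by_inj J M N (i : {linear M -> N}) :
  injective i -> killed_by J N -> killed_by J M.
Proof. by move=> iI JN a z Ja; apply: iI; rewrite linearZZ linear0 JN. Qed.

Lemma killed_by_surj J M N (q : {linear M -> N}) :
  (forall y, exists x, q x = y) -> killed_by J M -> killed_by J N.
Proof. by move=> qS JM a y Ja; have [x <-] := qS y; rewrite -linearZZ JM ?linear0. Qed.

(** The graph [r] becomes a submodule of (A / J) x E on which the first projection is injective; the
    second projection extends along it to A / J, and [e] is the image of 1. *)
Lemma injective_baer J E : submod J -> injective_over J E -> baer J E.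
Proof.
move=> JS [JE Einj] r rD rJ r0.
have [Q [q [qJ qS]]] := quotient_exists JS.
have JQ : killed_by J Q.
  move=> a z Ja; have [x <-] := qS z; rewrite -linearZZ; apply/qJ.
  by rewrite /GRing.scale /= mulrC; apply: (submodZ JS (x : A)).
pose G : set (Q * E)%type := [set z | exists2 a : A, q (a : A^o) = z.1 & r a z.2].
have GS : submod G.
  split; first by exists 0; [rewrite linear0|apply/rJ/(submod0 JS)].
  move=> a [x u] [y v] [b /= <- bu] [c /= <- cv]; exists (a * b + c) => /=.
    by rewrite -linearP.
  exact: rD.
have [S [i [iI iG]]] := submodule_exists GS.
pose f1 : {linear S -> Q} := [the {linear _ -> _} of fst] \o i.
pose f2 : {linear S -> E} := [the {linear _ -> _} of snd] \o i.
have f1I : injective f1.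
  apply: linear_inj => x x0; have /iG[a qa ra] : exists w, i x = i w by exists x.
  apply: iI; rewrite linear0; apply/eqP;
    rewrite -pair_eqE /= -[(i x).1]/(f1 x) x0 eqxx /=.
  apply/eqP/r0; have Ja : J a by apply/qJ; rewrite qa.
  by have := rD (-1) a a 0 _ (rJ a Ja) ra; rewrite mulN1r addNr scaler0 add0r.
have JS' : killed_by J S by apply: killed_by_inj f1I JQ.
have [g gP] := Einj _ _ f1 f2 JS' JQ f1I.
exists (g (q (1 : A^o))) => a w ra.
have [s si] : exists s, (q (a : A^o), w) = i s by apply/iG; exists a.
rewrite -linearZZ -linearZZ /GRing.scale /= mulr1.
have -> : q (a : A^o) = f1 s by rewrite /f1 /= -si.
by rewrite gP /f2 /= -si.
Qed.

(** The rule c s -> c t, zero on [I], is well defined on I + A s because I : s kills [t]; [e] is the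
    image of 1 under an extension. *)
Lemma baer_extend J M I (s : A) (t : M) : submod I -> J `<=` I -> baer J M ->
    (forall a : A, I (a * s) -> a *: t = 0) ->
  exists e, s *: e = t /\ forall a : A, I a -> a *: e = 0.
Proof.
move=> IS JI MB It.
have [|||e eP] := MB (fun x w => exists2 c, I (x - c * s) & w = c *: t).
- move=> a x y u v [c xc ->] [d yd ->]; exists (a * c + d).
    rewrite mulrDl opprD addrACA -mulrA -mulrBr.
    by apply: (submodD IS) => //; apply: (submodZ IS).
  by rewrite scalerDl scalerA.
- by move=> a /JI Ia; exists 0; rewrite ?mul0r ?subr0 ?scale0r.
- move=> w [c Ic ->]; apply: It; rewrite -[c * s]opprK.
  by rewrite sub0r in Ic; apply: (submodN IS).
exists e; split=> [|a Ia].
  by apply/esym/eP; exists 1; rewrite ?scale1r // mul1r subrr; exact: (submod0 IS).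
by apply/esym/eP; exists 0; rewrite ?scale0r // mul0r subr0.
Qed.

Definition divisible (y : A) M : Prop := forall z : M, exists x, y *: x = z.

Lemma injective_divisible J E y : submod J -> regular_mod J y ->
  injective_over J E -> divisible y E.
Proof.
move=> JS yJ Einj z; have [JE _] := Einj.
have [|x [yx _]] := baer_extend (I := J) (s := y) (t := z) JS (fun _ => id)
    (injective_baer JS Einj); last by exists x.
by move=> a Jay; apply: JE; apply: yJ; rewrite /GRing.scale /= mulrC.
Qed.

Lemma divisible_surj M N y (p : {linear M -> N}) :
  (forall z, exists x, p x = z) -> divisible y M -> divisible y N.
Proof.
move=> pS Mdiv z; have [x <-] := pS z; have [w <-] := Mdiv x.
by exists (p w); rewrite linearZZ.
Qed.

(** [S] is Hom(A / yA, E). An extension into [E] of a map to [S], defined on a module killed by [y],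
    takes its values in the y-torsion again. *)
Lemma torsion_injective J E S (i : {linear S -> E}) y : submod J ->
    injective_over J E -> injective i ->
    (forall e, y *: e = 0 <-> exists s, e = i s) ->
  injective_over (add_mul J y) S.
Proof.
move=> JS [JE Einj] iI iP.
have yi s : y *: i s = 0 by apply/iP; exists s.
split=> [a z [w Jaw]|B C j f JB JC jI].
  apply: iI; rewrite linearZZ linear0 -[a](subrK (y * w)) scalerDl.
  by rewrite JE // add0r mulrC -scalerA yi scaler0.
have JJ' : J `<=` add_mul J y by exact: sub_add_mul.
have [|||g gP] := Einj B C j (i \o f); rewrite //.
- by move=> a z /JJ'; apply: JB.
- by move=> a z /JJ'; apply: JC.
have [|g' g'P] := factor_inj (f := g) iI.
  move=> c; apply/iP; rewrite -linearZZ JC ?linear0 //.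
  by have := add_mul_mem y (1 : A^o) JS; rewrite /GRing.scale /= mulr1.
by exists g' => b; apply: iI; rewrite g'P gP.
Qed.

(** On 0 -> M -> E -> E' -> 0 taking y-torsion is left exact with obstruction M / yM on the right.
    This vanishes as [M] is divisible, and E' inherits divisibility from [E]. *)
Lemma torsion_injdim J n M S (i : {linear S -> M}) y : submod J ->
    regular_mod J y -> injdim_le J n M -> divisible y M -> injective i ->
    (forall z, y *: z = 0 <-> exists s, z = i s) ->
  injdim_le (add_mul J y) n S.
Proof.
move=> JS yJ; elim: n M S i => [|n IHn] M S i /=.
  by move=> Minj _ iI iP; apply: torsion_injective iP.
move=> [E [E' [j [p [Einj jI jp pS E'n]]]]] Mdiv iI iP.
have yS N : submod [set z : N | y *: z = 0].
  split=> [|a u v /= yu yv]; first by rewrite /= scaler0.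
  by rewrite scalerDr yv addr0 scalerA mulrC -scalerA yu scaler0.
have [T [k [kI kP]]] := submodule_exists (yS E).
have [T' [k' [k'I k'P]]] := submodule_exists (yS E').
have [|f fP] := factor_inj (f := j \o i) kI.
  move=> x; apply/kP; rewrite /= -linearZZ.
  by have /iP -> : exists s, i x = i s; [exists x|rewrite linear0].
have [|g gP] := factor_inj (f := p \o k) k'I.
  move=> x; apply/k'P; rewrite /= -linearZZ.
  by have /kP /= -> : exists s, k x = k s; [exists x|rewrite linear0].
have Ediv := injective_divisible JS yJ Einj.
exists T, T', f, g; split.
- by apply: torsion_injective kP.
- by apply: linear_inj => x fx; apply/iI/jI; rewrite linear0 linear0 -[LHS]fP fx linear0.
- move=> x; split=> [gx|[s ->]]; last first.
    apply: k'I; rewrite gP linear0 /= fP /=; apply/jp; by exists (i s).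
  have /jp[m xm] : p (k x) = 0 by rewrite -[LHS]gP gx linear0.
  have /iP[s ms] : y *: m = 0.
    by apply: jI; rewrite linearZZ linear0 /= -xm; apply/kP; exists x.
  by exists s; apply: kI; rewrite fP xm ms.
- move=> t; have [e pe] := pS (k' t).
  have /jp[m em] : p (y *: e) = 0 by rewrite linearZZ pe; apply/k'P; exists t.
  have [m' mm'] := Mdiv m.
  have /kP[s es] : y *: (e - j m') = 0 by rewrite scalerBr em -mm' linearZZ subrr.
  exists s; apply: k'I; rewrite gP /= -es linearB pe.
  by have -> : p (j m') = 0; [apply/jp; exists m'|rewrite subr0].
- apply: (IHn E' T' k') => //; exact: divisible_surj pS Ediv.
Qed.

(** As [T] is injective the inclusion splits, and [Q] is a direct summand of [E]. *)
Lemma quotient_injective J E T Q (j : {linear T -> E}) (q : {linear E -> Q}) :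
    injective_over J E -> injective_over J T -> injective j ->
    (forall x, exists e, q e = x) -> exact_at j q ->
  injective_over J Q.
Proof.
move=> [JE Einj] [JT Tinj] jI qS jq.
have [rho rhoK] := Tinj T E j idfun JT JE jI.
have [|sigma sigmaP] := @factor_surj _ _ _ _ q (idfun \- (j \o rho)) qS.
  by move=> x /jq[t ->] /=; rewrite rhoK subrr.
have qsigma x : q (sigma x) = x.
  have [e <-] := qS x; rewrite sigmaP linearB /=.
  by have -> : q (j (rho e)) = 0; [apply/jq; exists (rho e)|rewrite subr0].
split; first exact: killed_by_surj qS JE.
move=> B C i f JB JC iI; have [g gP] := Einj B C i (sigma \o f) JB JC iI.
by exists (q \o g) => b; rewrite /= gP /= qsigma.
Qed.

(** Dividing both [M] and the first term E of its resolution by [T] leaves the cosyzygy E'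
    unchanged, and E / T is still injective. *)
Lemma quotient_injdim J n M T Q (j : {linear T -> M}) (q : {linear M -> Q}) :
    injdim_le J n M -> injective_over J T -> injective j ->
    (forall x, exists e, q e = x) -> exact_at j q ->
  injdim_le J n Q.
Proof.
case: n => [|n] /=; first exact: quotient_injective.
move=> [E [E' [i [p [Einj iI ip pS E'n]]]]] Tinj jI qS jq.
have IS : submod [set e | exists t, e = i (j t)].
  split; first by exists 0; rewrite !linear0.
  by move=> a _ _ [s ->] [t ->]; exists (a *: s + t); rewrite !linearP.
have [R [r [rI rS]]] := quotient_exists IS.
have [|f fP] := factor_surj (q := q) (f := r \o i) qS.
  by move=> x /jq[t ->]; apply/rI; exists t.
have [|g gP] := factor_surj (q := r) (f := p) rS.
  by move=> x /rI[t ->]; apply/ip; exists (j t).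
exists R, E', f, g; split=> //.
- apply: (quotient_injective (j := i \o j) (q := r)) => //.
  by move=> x y /iI /jI.
- apply: linear_inj => x; have [m <-] := qS x.
  by rewrite fP => /rI[t /iI ->]; apply/jq; exists t.
- move=> x; have [e <-] := rS x; rewrite gP; split=> [/ip[m ->]|[z]].
    by exists (q m); rewrite fP.
  have [m <-] := qS z; rewrite fP => /eqP; rewrite -subr_eq0 -linearB => /eqP/rI[t et].
  by apply/ip; exists (j t + m); rewrite linearD -et subrK.
- by move=> y; have [x <-] := pS y; exists (r x); rewrite gP.
Qed.

(* If 0 -> M -> E -> E' -> 0 is exact, then y : E -> E is onto and M / y M is the
   cokernel of the map from the y-torsion of E to that of E'. *)
Lemma injdim_le_mod J n M y : submod J -> regular_mod J y -> injdim_le J n M ->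
    regular_mod ([set 0] : set M) y ->
  exists n' (Q : lmodType A) (q : {linear M -> Q}),
    [/\ forall x, exists z, q z = x, forall z, q z = 0 <-> exists w, z = y *: w
      & injdim_le (add_mul J y) n' Q].
Proof.
move=> JS yJ; case: n => [|n] /=.
  move=> Minj yM; have Mdiv := injective_divisible JS yJ Minj.
  have TS : submod (setT : set M) by split.
  have [Q [q [qT qS]]] := quotient_exists TS.
  exists 0%N, Q, q; split=> // [z|].
    split=> [_|_]; last exact/qT.
    by have [w <-] := Mdiv z; exists w.
  by apply: injective_over_zero => z; have [x <-] := qS z; apply/qT.
move=> [E [E' [i [p [Einj iI ip pS E'n]]]]] yM.
have Ediv := injective_divisible JS yJ Einj.
have yS N : submod [set z : N | y *: z = 0].
  split=> [|a u v /= yu yv]; first by rewrite /= scaler0.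
  by rewrite scalerDr yv addr0 scalerA mulrC -scalerA yu scaler0.
have [T0 [k [kI kP]]] := submodule_exists (yS E).
have [T [k' [k'I k'P]]] := submodule_exists (yS E').
have [|g gP] := factor_inj (f := p \o k) k'I.
  move=> x; apply/k'P; rewrite /= -linearZZ.
  by have /kP /= -> : exists s, k x = k s; [exists x|rewrite linear0].
have gI : injective g.
  apply: linear_inj => x gx; apply: kI; rewrite linear0.
  have /ip[m xm] : p (k x) = 0 by rewrite -[LHS]gP gx linear0.
  rewrite xm (yM m) ?linear0 //; apply: iI; rewrite linearZZ linear0 /= -xm.
  by apply/kP; exists x.
have gS : submod [set t | exists s, t = g s].
  split; first by exists 0; rewrite linear0.
  by move=> a _ _ [s ->] [t ->]; exists (a *: s + t); rewrite linearP.
have [Q [q [qP qS]]] := quotient_exists gS.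
(* The connecting map of the snake lemma: [m] goes to the class of p e with y e = i m. Such [e]
   exist by divisibility, and two of them differ by y-torsion of [E], whose image is zero in [Q]. *)
have [|||f fP] := @linear_of_rel _ M Q
    (fun m w => exists e t, [/\ y *: e = i m, k' t = p e & q t = w]).
- move=> m; have [e em] := Ediv (i m).
  have /k'P[t te] : y *: p e = 0 by rewrite -linearZZ em; apply/ip; exists m.
  by exists (q t), e, t.
- move=> a m m' _ _ [e [t [em te <-]]] [e' [t' [em' te' <-]]].
  exists (a *: e + e'), (a *: t + t'); split; last by rewrite linearP.
    by rewrite scalerDr em' scalerA mulrC -scalerA em linearP.
  by rewrite !linearP te te'.
- move=> _ [e [t [em te <-]]].
  have /kP[s es] : y *: e = 0 by rewrite em linear0.
  by apply/qP; exists s; apply: k'I; rewrite gP te es.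
exists n, Q, f; split.
- move=> w; have [t <-] := qS w; have [e pe] := pS (k' t).
  have /ip[m em] : p (y *: e) = 0 by rewrite linearZZ pe; apply/k'P; exists t.
  by exists m; apply/fP; exists e, t.
- move=> m; rewrite -fP; split=> [[e [t [em te /qP[s ts]]]]|[m' ->]].
    have /ip[m' em'] : p (e - k s) = 0 by rewrite linearB -te ts gP subrr.
    exists m'; apply: iI; rewrite linearZZ -em' -em scalerBr.
    by have /kP -> : exists s', k s = k s'; [exists s|rewrite subr0].
  exists (i m'), 0; rewrite !linear0 linearZZ; split=> //.
  by apply/esym/ip; exists m'.
- apply: (quotient_injdim (j := g) (q := q)) => //.
    by apply: (torsion_injdim (i := k') JS yJ) => //; exact: divisible_surj pS Ediv.
  by apply: torsion_injective kP.
Qed.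

Lemma regular_seq_mod_surj M N (U : set M) (V : set N) (q : {linear M -> N}) s :
    (forall y, exists x, q x = y) -> (forall x, V (q x) <-> U x) ->
  (regular_seq_mod U s -> regular_seq_mod V s) /\
  forall x, foldl (@add_mul A N) V s (q x) <-> foldl (@add_mul A M) U s x.
Proof.
move=> qS; elim: s U V => [|x s IHs] U V UV /=.
  by split=> // -[z Uz]; exists (q z) => /UV.
have UV' z : add_mul V x (q z) <-> add_mul U x z.
  split=> [[y]|[w Uw]]; last by exists (q w); rewrite -linearZZ -linearB; apply/UV.
  have [w <-] := qS y; rewrite -linearZZ -linearB => /UV Uw; by exists w.
have [IH1 IH2] := IHs _ _ UV'; split=> // -[xN xU sU]; split=> // [y|]; last exact: IH1.
by have [w <-] := qS y; rewrite -linearZZ => /UV/xU/UV.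
Qed.

Lemma injdim_le_regular_seq J n M s : submod J -> injdim_le J n M ->
    regular_seq_mod J s -> regular_seq_mod ([set 0] : set M) s ->
  exists n' (Q : lmodType A) (q : {linear M -> Q}),
    [/\ forall x, exists z, q z = x,
        forall z, q z = 0 <-> foldl (@add_mul A M) [set 0] s z
      & injdim_le (foldl (@add_mul A A^o) J s) n' Q].
Proof.
elim: s J n M => [|x s IHs] J n M JS Mn /=.
  by move=> _ _; exists n, M, idfun; split=> // x; exists x.
move=> [_ xJ sJ] [_ xM sM].
have [n1 [Q1 [q1 [q1S q1P Q1n]]]] := injdim_le_mod JS xJ Mn xM.
have q1P' z : [set 0] (q1 z) <-> add_mul [set 0] x z.
  split=> [/q1P[w ->]|[w /eqP]]; first by exists w; rewrite subrr.
  by rewrite subr_eq0 => /eqP ->; apply/q1P; exists w.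
have [/(_ sM) sQ1 Q1P] := regular_seq_mod_surj s q1S q1P'.
have [n' [Q [q [qS qP Qn]]]] := IHs _ _ _ (add_mul_submod x JS) Q1n sJ sQ1.
exists n', Q, (q \o q1); split=> // [z|z].
  by have [y <-] := qS z; have [w <-] := q1S y; exists w.
by rewrite /= qP Q1P.
Qed.

End InjectiveDimension.

(** * Injective modules over an Artinian local quotient *)

Section ArtinianQuotient.
Variables (A : comNzRingType) (J : set A^o).
Implicit Types (M N E Q : lmodType A) (I : set A^o).
Hypothesis A_noeth : noetherian_module (A^o : lmodType A).
Hypotheses (JS : submod J) (J_proper : ~ J 1).
(** This takes the place of the Artinian property of A / J: every nonzero element of an A / J-module
    has a nonzero multiple in the socle. *)
Hypothesis J_socle : forall M (U : set M) z, submod U -> ~ U z ->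
  (forall a, J a -> U (a *: z)) ->
  exists b, ~ U (b *: z) /\ forall a, a \in @nonunit A -> U (a *: (b *: z)).

Lemma socle_element I : submod I -> J `<=` I -> ~ I 1 ->
  exists b : A, ~ I b /\ forall a, a \in @nonunit A -> I (a * b).
Proof.
move=> IS JI I1; have [|b [nb bI]] := J_socle (z := 1 : A^o) IS I1.
  by move=> a /JI; rewrite /GRing.scale /= mulr1.
exists b; rewrite /GRing.scale /= mulr1 in nb bI; by split.
Qed.

Lemma annihilator_nonunit I (b a : A) : submod I -> ~ I b -> I (a * b) ->
  a \in @nonunit A.
Proof.
move=> IS nb Iab; have [//|aN] := boolP (a \in @nonunit A).
by case: nb; apply: (unit_scale IS aN).
Qed.

(** By induction E' satisfies Baer's criterion. It remains to lift maps A / I -> E' to [E], which is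
    the vanishing of Ext^1(A / I, M) over A / J; this goes by Noetherian induction on [I], starting
    from lifts of socle elements. *)
Lemma injdim_le_baer n M : injdim_le J n M -> baer J M.
Proof.
elim: n M => [|n IHn] M /=; first exact: injective_baer.
move=> [E [E' [i [p [Einj iI ip pS /IHn E'B]]]]].
have EB := injective_baer JS Einj; have [JE _] := Einj.
have [b0 [nb0 b0J]] := socle_element JS (fun _ => id) J_proper.
(* b0 embeds the residue field k into A / J, so a map k -> E' extends to A / J and
   can be lifted to E there. *)
have lift_socle t' : (forall a, a \in @nonunit A -> a *: t' = 0) ->
    exists t, p t = t' /\ forall a, a \in @nonunit A -> a *: t = 0.
  move=> t'0; have [|e' [b0e' _]] := baer_extend (s := b0) (t := t') JS (fun _ => id) E'B.
    by move=> a /(annihilator_nonunit JS nb0); apply: t'0.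
  have [e pe] := pS e'; exists (b0 *: e); rewrite linearZZ pe; split=> // a aN.
  by rewrite scalerA; apply/JE/b0J.
have lift I e' : submod I -> J `<=` I -> (forall a, I a -> a *: e' = 0) ->
    exists e, p e = e' /\ forall a, I a -> a *: e = 0.
  move=> IS JI Ie'; apply: contrapT => nolift.
  pose bad I' := [/\ submod I', J `<=` I' & exists e' : E',
    (forall a, I' a -> a *: e' = 0) /\
    ~ exists e, p e = e' /\ forall a, I' a -> a *: e = 0].
  have [||{nolift Ie' e' JI IS I}I [IS JI [e' [Ie' nolift]]] Imax] := A_noeth (F := bad).
  - by move=> I' [].
  - by exists I; split=> //; exists e'.
  apply: nolift; have [I1|nI1] := pselect (I 1).
    exists 0; rewrite linear0; split=> [|a _]; last by rewrite scaler0.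
    by rewrite -[e']scale1r Ie'.
  have [s [ns sI]] := socle_element IS JI nI1.
  have [|t [pt t0]] := lift_socle (s *: e').
    by move=> a aN; rewrite scalerA; apply/Ie'/sI.
  have [|e1 [se1 Ie1]] := baer_extend (s := s) (t := t) IS JI EB.
    by move=> a /(annihilator_nonunit IS ns) /t0.
  have I'S := add_mul_submod s IS.
  (* [e1] extends the lift [t] of s e', so e' - p e1 is killed by [s] as well as by [I], and
     maximality of [I] applies to I + A s. *)
  have [e2 [pe2 e20]] : exists e, p e = e' - p e1 /\
      forall a, add_mul I s a -> a *: e = 0.
    apply: contrapT => nolift; apply: ns.
    apply: (Imax (add_mul I s)); last first.
    - by have := add_mul_mem s (1 : A^o) IS; rewrite /GRing.scale /= mulr1.
    - exact: sub_add_mul.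
    - split=> //; first by move=> a /JI; apply: sub_add_mul.
      exists (e' - p e1); split=> // a [w Iaw].
      rewrite -[a](subrK (s * w)) scalerDl scalerBr Ie' // -linearZZ Ie1 // linear0
        subr0 add0r.
      by rewrite mulrC -scalerA scalerBr -linearZZ se1 pt subrr scaler0.
  exists (e1 + e2); split=> [|a Ia]; first by rewrite linearD pe2 addrC subrK.
  by rewrite scalerDr Ie1 // e20 ?addr0 //; apply: sub_add_mul.
move=> r rD rJ r0.
have [|||e eP] := EB (fun a x => exists2 w, r a w & x = i w).
- move=> a x y _ _ [u ru ->] [v rv ->]; exists (a *: u + v); first exact: rD.
  by rewrite linearP.
- by move=> a /rJ ra; exists 0; rewrite ?linear0.
- by move=> _ [w /r0 -> ->]; rewrite linear0.
(* p e is killed by the domain of [r]. Subtracting from [e] a lift with the same annihilation brings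
   it into [M] without changing its products with that domain. *)
have [|||e1 [pe1 e10]] := lift [set a | exists w, r a w] (p e).
- split; first by exists 0; apply/rJ/(submod0 JS).
  by move=> a x y [u ru] [v rv]; exists (a *: u + v); apply: rD.
- by move=> a /rJ ra; exists 0.
- move=> a [w ra]; rewrite -linearZZ -(eP a (i w)); last by exists w.
  by apply/ip; exists w.
have /ip[m em] : p (e - e1) = 0 by rewrite linearB pe1 subrr.
exists m => a w ra; apply: iI; rewrite linearZZ -em scalerBr e10 ?subr0; last by exists w.
by apply: eP; exists w.
Qed.

(** [Q'] is A / J. Extending b0 -> n0 gives [n] with A n isomorphic to A / J, hence injective and a
    direct summand of [Q]. The socle of [Q] is spanned by n0 = b0 n and lies in A n, so nothing is
    left for a complement. *)
Lemma cyclic_of_socle Q Q' (q : {linear A^o -> Q'}) (n0 : Q) :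
    (forall x, exists a, q a = x) -> (forall a, q a = 0 <-> J a) ->
    baer J Q' -> baer J Q -> killed_by J Q -> n0 != 0 ->
    (forall a, a \in @nonunit A -> a *: n0 = 0) ->
    (forall z : Q, (forall a, a \in @nonunit A -> a *: z = 0) -> exists c, z = c *: n0) ->
  exists n : Q, forall w, exists a, w = a *: n.
Proof.
move=> qS qJ Q'B QB JQ n0n0 n00 socle.
have [b0 [nb0 b0J]] := socle_element JS (fun _ => id) J_proper.
have [|n [b0n _]] := baer_extend (s := b0) (t := n0) JS (fun _ => id) QB.
  by move=> a /(annihilator_nonunit JS nb0) /n00.
have n_faithful a : a *: n = 0 -> J a.
  move=> an; apply: contrapT => nJa.
  have [|c [nJc cJ]] := J_socle (z := a : A^o) JS nJa.
    by move=> b Jb; rewrite /GRing.scale /= mulrC; apply: (submodZ JS (a : A)).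
  (* Self-injectivity of A / J makes [b0] a multiple of the socle element c a modulo [J]; so a n = 0
     would give n0 = b0 n = 0. *)
  have [|e [ce _]] := baer_extend (s := c * a) (t := q b0) JS (fun _ => id) Q'B.
    move=> x /(annihilator_nonunit JS nJc) xN; rewrite -linearZZ; apply/qJ; exact: b0J.
  have [d de] := qS e; move/negP: n0n0; apply; rewrite -b0n.
  have : q (b0 - c * a * d) = 0 by rewrite linearB -ce -de -linearZZ subrr.
  move=> /qJ /(JQ _ n); rewrite scalerBl => /eqP; rewrite subr_eq0 => /eqP ->.
  by rewrite mulrAC -scalerA an scaler0.
exists n => w; apply: contrapT => nw.
have US : submod [set z | exists a, z = a *: n].
  split; first by exists 0; rewrite scale0r.
  by move=> a _ _ [b ->] [c ->]; exists (a * b + c); rewrite scalerDl scalerA.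
have [|c [nc cU]] := J_socle US nw.
  by move=> a Ja; exists 0; rewrite (JQ a w Ja) scale0r.
set w' := c *: w in nc cU.
have [|||e eP] := Q'B (fun a x => exists2 b, a *: w' = b *: n & x = q b).
- move=> a x y _ _ [b xb ->] [d yd ->]; exists (a * b + d).
    by rewrite scalerDl yd -scalerA xb scalerA scalerDl.
  by rewrite -linearP.
- by move=> a Ja; exists 0; [rewrite (JQ a w' Ja) scale0r|rewrite linear0].
- by move=> _ [b b0' ->]; apply/qJ/n_faithful; rewrite -b0' scale0r.
have [b' b'e] := qS e.
(* Here b' n is the projection of [w'] to A n. The difference is a socle element of [Q], hence a
   multiple of b0 n, which forces [w'] into A n. *)
have [|d dn0] := socle (w' - b' *: n).
  move=> a aN; have [b ab] := cU a aN.
  have : q (b - a * b') = 0.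
    rewrite linearB (eP a (q b)); last by exists b.
    by rewrite -b'e -linearZZ subrr.
  move=> /qJ /(JQ _ n); rewrite scalerBl => /eqP; rewrite subr_eq0 => /eqP bn.
  by rewrite scalerBr ab bn scalerA subrr.
apply: nc; exists (d * b0 + b').
by rewrite scalerDl -scalerA b0n -dn0 subrK.
Qed.

End ArtinianQuotient.

(** * Canonical modules over Gorenstein local rings *)

Lemma krull_dim_unique (A : comNzRingType) d d' :
  krull_dim A d -> krull_dim A d' -> d = d'.
Proof.
by case=> cd dP [cd' d'P]; apply/eqP; rewrite eqn_leq d'P //= dP.
Qed.

Lemma depth_regular_seq (A : comNzRingType) (M : lmodType A) d : depth M d ->
  exists2 s, size s = d & regular_seq_mod ([set 0] : set M) s.
Proof. by case=> -[s /regular_seqE sM sd] _; exists s. Qed.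

Theorem canonical_module_cyclic (A : comNzRingType) (N : lmodType A) :
    noetherian A -> nonunits_add A -> maximal_cohen_macaulay (A^o : lmodType A) ->
    finite_injdim (A^o : lmodType A) -> canonical_module_local N ->
  exists n : N, forall z, exists a, z = a *: n.
Proof.
move=> /noetherian_maximal hA A_local [_ [d dA dpA]] Ainj.
case=> -[N_fg [d' d'A dpN]] N_type Ninj.
have {d'A} dd' : d' = d by exact: krull_dim_unique d'A dA.
rewrite {}dd' in dpN.
have hN : noetherian_module N by exact: fg_noetherian.
have [s [sd sA sN]] := common_regular_seq hA A_local hA hN
  (@set0_submod A A^o) (@set0_submod A N) (depth_regular_seq dpA) (depth_regular_seq dpN).
set J : set A^o := foldl (@add_mul A A^o) [set 0] s.
have JS : submod J by apply: foldl_add_mul_submod; exact: set0_submod.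
have J_proper : ~ J (1 : A^o).
  move=> J1; have /regular_seq_modP[_ _ [z]] := sA; apply.
  by rewrite -[z]mulr1; apply: (submodZ JS (z : A)).
have J_socle (M : lmodType A) (U : set M) z : submod U -> ~ U z ->
    (forall a, J a -> U (a *: z)) ->
    exists b, ~ U (b *: z) /\ forall a, a \in @nonunit A -> U (a *: (b *: z)).
  exact: parameter_socle dA sd sA.
have [nA /(injdim_le_regular_seq (@set0_submod A A^o)) hinjA] := finite_injdim_le Ainj.
have [nA' [QA [qA [qAS qAJ QAinj]]]] := hinjA s sA sA.
have [nN /(injdim_le_regular_seq (@set0_submod A A^o)) hinjN] := finite_injdim_le Ninj.
have [nN' [Q [q [qS qJ Qinj]]]] := hinjN s sA sN.
have QAB := injdim_le_baer hA JS J_proper J_socle QAinj.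
have QB := injdim_le_baer hA JS J_proper J_socle Qinj.
(* The length of [s] is the depth of [N], so the type of [N] is available at [s] itself. *)
have s_max : maximal_regular_seq N s.
  split=> [|y sy]; first exact/regular_seqE.
  by have := dpN.2 _ sy; rewrite size_rcons sd ltnn.
have [u [u_soc u_free u_gen]] := N_type s s_max.
have q0 z : q z = 0 <-> in_seq_mul s z by rewrite qJ in_seq_mulE.
have s_nonunit : {subset s <= @nonunit A} by have /regular_seq_modP[] := sA.
have JQ : killed_by J Q.
  move=> a w Ja; have [z <-] := qS w; rewrite -linearZZ; apply/qJ.
  apply: (spanned_min (U := [set a : A^o | foldl (@add_mul A N) [set 0] s (a *: z)]))
    (_ : spanned (s : seq A^o) a).
  - split=> [|b x y Sx Sy]; rewrite /= ?scale0r.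
      by apply: submod0; apply: foldl_add_mul_submod; exact: set0_submod.
    rewrite scalerDl -scalerA; apply: submodD; first by apply: foldl_add_mul_submod;
      exact: set0_submod.
      by apply: submodZ => //; apply: foldl_add_mul_submod; exact: set0_submod.
    exact: Sy.
  - by move=> x xs; apply: foldl_add_mul_mem => //; exact: set0_submod.
  have /foldl_add_mulP[_ ->] := Ja; rewrite subr0 => -[v ->].
  apply: submod_sum => [|i]; first exact: spanned_submod.
  rewrite /GRing.scale /= mulrC; apply: (submodZ (spanned_submod _) (v i)).
  by apply: spanned_mem; exact: mem_nth.
have [n nP] : exists n : Q, forall w, exists a, w = a *: n.
  apply: (cyclic_of_socle JS J_proper J_socle (q := qA) (n0 := q (u ord0))) => //.
  - apply/eqP => /q0 u0; have := u_free (fun=> 1) _ ord0.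
    by rewrite big_ord1 scale1r (negPf (nonunit1 A)) => /(_ u0).
  - by move=> a aN; rewrite -linearZZ; apply/q0/u_soc.
  - move=> w w0; have [z zw] := qS w.
    have [|c cz] := u_gen z; first by move=> a aN; apply/q0; rewrite linearZZ zw w0.
    exists (c ord0); move/q0: cz; rewrite big_ord1 linearB linearZZ zw => /eqP.
    by rewrite subr_eq0 => /eqP.
have [n' n'n] := qS n.
have US : submod [set z | exists a, z = a *: n'].
  split; first by exists 0; rewrite scale0r.
  by move=> a _ _ [b ->] [c ->]; exists (a * b + c); rewrite scalerDl scalerA.
exists n' => z; apply: (@nakayama A A_local N _ setT hN US) => // V VP UV mV w _.
have [a wa] := nP (q w); rewrite -[w](subrK (a *: n')).
apply: submodD => //; last by apply: UV; exists a.
have /q0[v ->] : q (w - a *: n') = 0 by rewrite linearB linearZZ n'n wa subrr.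
apply: submod_sum => // i; apply: mV => //; apply: s_nonunit; exact: mem_nth.
Qed.

(** * Localization *)

Lemma maximal_ideal_prime (R : comNzRingType) (m : {pred R}) :
  maximal_ideal m -> exists p : prime_idealr R, p =i m.
Proof.
move=> [mI mmax].
have [m0 m1 mD] := mI.
have mM a b : b \in m -> a * b \in m by move=> mb; rewrite -[_ * _]addr0; apply: mD.
have mP : prime_idealr_closed m.
  move=> u v muv; apply/orP; have [|nmu] := boolP (u \in m); [by left|right].
  pose J : {pred R} := [pred x | `[< exists a, x - a * u \in m >]].
  have JI : ~ idealr_closed J.
    move=> /mmax Jm; move/negP: nmu; apply; apply: Jm.
      by move=> x mx; apply/asboolP; exists 0; rewrite mul0r subr0.
    by apply/asboolP; exists 1; rewrite mul1r subrr.
  have /asboolP[a m1a] : 1 \in J.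
    apply: contrapT => /negP nJ1; apply: JI; split=> //.
      by apply/asboolP; exists 0; rewrite mul0r subr0.
    move=> a x y /asboolP[b mx] /asboolP[c my]; apply/asboolP; exists (a * b + c).
    by rewrite mulrDl opprD addrACA -mulrA -mulrBr; apply: mD.
  rewrite -[v]mul1r -[1](subrK (a * u)) mulrDl -mulrA mulrC.
  by apply: mD => //; apply: mM.
pose m' : R -> bool := fun x => x \in m.
have m'I : @idealr_closed R m' by [].
have m'P : @prime_idealr_closed R m' by [].
pose i1 := isIdealr.Build R m' m'I.
pose i2 := isPrimeIdealrClosed.Build R m' m'P.
pose p : prime_idealr R := HB.pack m' i1 i2.
by exists p.
Qed.

Lemma proper_ideal_maximal (R : comNzRingType) (I : set R^o) :
    noetherian_module (R^o : lmodType R) -> submod I -> ~ I 1 ->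
  exists m : {pred R}, maximal_ideal m /\ forall x, I x -> x \in m.
Proof.
move=> hR IS I1.
have [||J [JS IJ J1] Jmax] :=
    hR [set J : set R^o | [/\ submod J, I `<=` J & ~ J 1]].
- by move=> J [].
- by exists I; split.
exists ([pred x : R | `[< J x >]] : {pred R}); split=> [|x Ix]; last by apply/asboolP/IJ.
split; first split.
- by apply/asboolP; exact: (submod0 JS).
- exact/asboolPn.
- move=> a x y /asboolP Jx /asboolP Jy; apply/asboolP.
  by apply: (submodD JS) => //; apply: (submodZ JS).
move=> K [K0 K1 KD] JK x Kx; apply/asboolP.
apply: (Jmax [set x | x \in K]) Kx => [|y Jy]; last by apply: JK; apply/asboolP.
split; [by split=> // a y z; apply: KD| |exact/negP].
by move=> y Iy; apply: JK; apply/asboolP/IJ.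
Qed.

Lemma local_unit (R : comNzRingType) (m : {pred R}) t : noetherian R ->
    maximal_ideal m -> (forall m' : {pred R}, maximal_ideal m' -> m' =i m) ->
  t \notin m -> exists u, u * t = 1.
Proof.
move=> /noetherian_maximal hR mM m_uniq tm; apply: contrapT => nu.
have [||m' [m'M m't]] := @proper_ideal_maximal R [set x | exists u : R, x = u * t] hR.
- split; first by exists 0; rewrite mul0r.
  move=> a _ _ [u ->] [v ->]; exists (a * u + v).
  by rewrite mulrDl -mulrA.
- by move=> [u]; move/esym => ut; apply: nu; exists u.
move/negP: tm; apply; rewrite -(m_uniq m' m'M); apply: m't.
by exists 1; rewrite mul1r.
Qed.

Section Loc.
Variables (R : idomainType) (p : prime_idealr R).

Lemma loc_fraction (x : loc p) : exists a s, s \notin p /\ toloc p s * x = toloc p a.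
Proof.
case: x => x xp; have /loc_predP[a [s [ps xE]]] := xp; exists a, s; split=> //.
apply: val_inj; rewrite rmorphM /= xE mulrC divfK //.
exact: (notin_prime_neq0 ps).
Qed.

Lemma toloc_inj : injective (toloc p).
Proof. by move=> a b [] /eqP; rewrite tofrac_eq => /eqP. Qed.

Lemma toloc_inv s : s \notin p -> exists y : loc p, toloc p s * y = 1.
Proof.
move=> ps; have yp : 1%:F / s%:F \in loc_pred p.
  by apply/loc_predP; exists 1, s.
exists (Loc yp); apply: val_inj;
  rewrite -[LHS]/(s%:F * (1%:F / s%:F)) -[RHS]/1 mulrC divfK ?tofrac1 //.
exact: (notin_prime_neq0 ps).
Qed.

Lemma toloc_nonunit a : (toloc p a \in @nonunit (loc p)) = (a \in p).
Proof.
apply/idP/idP => [/nonunitP aN|pa].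
  by apply/negPn/negP => /toloc_inv.
apply/nonunitP => -[y ay]; have [b [s [ps sy]]] := loc_fraction y.
have /toloc_inj abs : toloc p (a * b) = toloc p s.
  by rewrite rmorphM /= -sy mulrCA ay mulr1.
by move/negP: ps; apply; rewrite -abs mulrC idealMr.
Qed.

Lemma loc_nonunits_add : nonunits_add (loc p).
Proof.
move=> x y xN yN; have [a [s [ps xa]]] := loc_fraction x.
have [b [t [pt yb]]] := loc_fraction y.
have pa : a \in p by rewrite -toloc_nonunit -xa; exact: nonunitM.
have pb : b \in p by rewrite -toloc_nonunit -yb; exact: nonunitM.
have : toloc p (s * t) * (x + y) \in @nonunit (loc p).
  have -> : toloc p (s * t) * (x + y) = toloc p (t * a + s * b).
    by rewrite mulrDr rmorphD !rmorphM /= -xa -yb !mulrA [toloc p t * _]mulrC.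
  by rewrite toloc_nonunit rpredD ?idealMr.
apply: contraTT => /notin_nonunit[z xyz].
have [|w stw] := @toloc_inv (s * t); first by rewrite prime_idealrM negb_or ps pt.
by apply/negP => /nonunitP; apply; exists (w * z); rewrite mulrACA stw xyz mulr1.
Qed.

Lemma loc_noetherian : noetherian R -> noetherian (loc p).
Proof.
move=> hR I [I0 ID].
have IZ (a x : loc p) : x \in I -> a * x \in I.
  by move=> Ix; have := ID a x 0 Ix I0; rewrite addr0.
pose I' : {pred R^o} := [pred a : R | toloc p a \in I].
have I'S : GRing.submod_closed I'.
  split; first by rewrite inE rmorph0.
  move=> a x y; rewrite !inE => Ix Iy.
  by rewrite -[a *: x]/(a * x) rmorphD rmorphM /=; exact: ID.
have [s [sI sG]] := hR I' I'S.
exists [seq toloc p a : (loc p)^o | a <- s]; split=> [_ /mapP[a /sI aI ->] //|].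
move=> N' [N0 ND] sN x Ix; have [a [t [pt tx]]] := loc_fraction x.
have Na : toloc p a \in N'.
  apply: (sG [pred a : R | toloc p a \in N']).
  - split; first by rewrite inE rmorph0.
    move=> b u v; rewrite !inE => Nu Nv.
    by rewrite -[b *: u]/(b * u) rmorphD rmorphM /=; exact: ND.
  - by move=> b bs; apply: sN; exact: (map_f (toloc p : R -> (loc p)^o)).
  - by rewrite inE -tx; apply: IZ.
have [w tw] := toloc_inv pt.
have := ND w _ 0 Na N0; rewrite addr0 /GRing.scale /= -tx mulrA [w * _]mulrC tw mul1r //.
Qed.

(** Clearing denominators turns a generator of the localization into the relation t w = a w0 over R.
    In the local case [t] is then a unit; in the graded case its component of degree 0 is. *)
Lemma localization_cyclic (M : lmodType R) (N : lmodType (loc p))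
    (f : {linear M -> N | toloc p \; *:%R}) n : is_localization f ->
    (forall z : N, exists a, z = a *: n) ->
  exists w0 : M, forall w, exists t a, t \notin p /\ t *: w = a *: w0.
Proof.
move=> [f0 fS] nP; have [w0 [s [ps sn]]] := fS n; exists w0 => w.
have [x fw] := nP (f w); have [b [u [pu ux]]] := loc_fraction x.
have /f0[t pt tz] : f ((u * s) *: w - b *: w0) = 0.
  rewrite linearB !linearZ_LR /= fw -sn -ux rmorphM /= !scalerA.
  by rewrite scalerN scalerA mulrAC subrr.
exists (t * (u * s)), (t * b); split.
  by rewrite !prime_idealrM !negb_or pt pu ps.
by apply/eqP; rewrite -subr_eq0 -(scalerA t (u * s)) -(scalerA t b) -scalerBr tz.
Qed.

Lemma finite_injdim_iso (A : comNzRingType) (M N : lmodType A) (g : {linear M -> N}) :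
    injective g -> (forall y, exists x, g x = y) ->
  finite_injdim N -> finite_injdim M.
Proof.
move=> gI gS [n [E [e [d [Einj eI ed dd En]]]]].
exists n, E, (e \o g), d; split=> // [x y /eI /gI //|b].
rewrite ed; split=> [[y ->]|[x ->]]; last by exists (g x).
by have [x <-] := gS y; exists x.
Qed.

Lemma localization_injdim (M : lmodType R) (N : lmodType (loc p))
    (f : {linear M -> N | toloc p \; *:%R}) (w0 : M) : is_localization f ->
    (forall a, a *: w0 = 0 -> a = 0) -> (forall w, exists a, w = a *: w0) ->
  finite_injdim N -> finite_injdim ((loc p)^o : lmodType (loc p)).
Proof.
move=> [f0 fS] w0_free w0P.
have glin : linear (fun a : (loc p)^o => a *: f w0).
  by move=> a x y; rewrite scalerDl scalerA.
pose lg := GRing.isLinear.Build (loc p) (loc p)^o N _ _ glin.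
pose g : {linear (loc p)^o -> N} := HB.pack (fun a : (loc p)^o => a *: f w0) lg.
apply: (finite_injdim_iso (g := g)).
  apply: linear_inj => x /= xw0; have [a [s [ps sx]]] := loc_fraction x.
  have /f0[t pt] : f (a *: w0) = 0.
    by rewrite linearZ_LR /= -sx -scalerA xw0 scaler0.
  rewrite scalerA => /w0_free /eqP; rewrite mulf_eq0 => /orP[/eqP t0|/eqP a0].
    by move: pt; rewrite t0 idealr0.
  have [y sy] := toloc_inv ps.
  by rewrite -[x]mul1r -sy mulrAC sx a0 rmorph0 mul0r.
move=> y; have [z [s [ps sy]]] := fS y; have [a za] := w0P z.
have [u su] := toloc_inv ps; exists (u * toloc p a) => /=.
by rewrite -scalerA -[y]scale1r -su mulrC -[RHS]scalerA sy za linearZ_LR.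
Qed.

End Loc.

(** * Gradings and homogeneous components *)

Section Components.
Variables (V : zmodType) (I : eqType) (H : I -> {pred V}).
Hypothesis H_grading : grading H.

(** Since [c] has to vanish off [s], it is determined by [x], although [s] is not. *)
Definition decomposition (x : V) (s : seq I) (c : I -> V) : Prop :=
  [/\ uniq s, forall i, c i \in H i, forall i, i \notin s -> c i = 0
    & x = \sum_(i <- s) c i].

Lemma homogeneous_zmod i : zmod_closed (H i). Proof. by case: H_grading. Qed.
Lemma homogeneous0 i : 0 \in H i. Proof. by case: (homogeneous_zmod i). Qed.
Lemma homogeneousB i x y : x \in H i -> y \in H i -> x - y \in H i.
Proof. by case: (homogeneous_zmod i) => _; apply. Qed.
Lemma homogeneousD i x y : x \in H i -> y \in H i -> x + y \in H i.
Proof.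
move=> Hx Hy; rewrite -[y]opprK -[- y]add0r; apply: homogeneousB => //.
by apply: homogeneousB => //; exact: homogeneous0.
Qed.

Lemma decomposition_exists x : exists s c, decomposition x s c.
Proof.
have [_ /(_ x)[s [c [cH ->]]] _] := H_grading.
exists (undup s), (fun i => \sum_(j <- s | j == i) c j); split.
- exact: undup_uniq.
- move=> i; elim/big_rec: _ => [|j y /eqP -> Hy]; first exact: homogeneous0.
  exact: homogeneousD.
- move=> i; rewrite mem_undup => si; rewrite big_seq_cond big1 // => j /andP[js /eqP ji].
  by move: si; rewrite -ji js.
- rewrite (exchange_big_dep predT) //= big_seq [RHS]big_seq; apply: eq_bigr => j js.
  by rewrite (big_rem j) ?mem_undup //= eqxx big_seq_cond big1 ?addr0 // => i /andP[];
    rewrite mem_rem_uniq ?undup_uniq // inE => /andP[/negPf ij _] /eqP ji;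
      rewrite -ji eqxx in ij.
Qed.

Lemma decomposition_widen x s c s' : decomposition x s c -> uniq s' ->
  {subset s <= s'} -> x = \sum_(i <- s') c i.
Proof.
move=> [us cH c0 ->] us' ss'.
rewrite [RHS](bigID (fun i => i \in s)) /= [X in _ + X]big1 ?addr0; last by move=> i /c0.
rewrite -[RHS]big_filter; apply: perm_big; apply: uniq_perm => //;
  first exact: filter_uniq.
by move=> i; rewrite mem_filter andb_idr // => /ss'.
Qed.

Lemma decomposition_unique x s c s' c' :
  decomposition x s c -> decomposition x s' c' -> c =1 c'.
Proof.
move=> xs xs' i; have [_ _ H_free] := H_grading.
have [_ cH c0 _] := xs; have [_ c'H c'0 _] := xs'.
pose t := undup (s ++ s'); have ut : uniq t by exact: undup_uniq.
have [it|] := boolP (i \in t); last first.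
  by rewrite mem_undup mem_cat negb_or => /andP[/c0 -> /c'0 ->].
apply/eqP; rewrite -subr_eq0; apply/eqP/(H_free t (fun i => c i - c' i)) => // [j|].
  by apply: homogeneousB.
rewrite sumrB -(decomposition_widen xs) // -?(decomposition_widen xs') ?subrr //.
  by move=> j js; rewrite mem_undup mem_cat js orbT.
by move=> j js; rewrite mem_undup mem_cat js.
Qed.

Lemma components_exist : exists (S : V -> seq I) (c : V -> I -> V),
  forall x, decomposition x (S x) (c x).
Proof.
have /choice[S /choice[c cP]] := decomposition_exists.
by exists S, c.
Qed.

Variables (S : V -> seq I) (c : V -> I -> V).
Hypothesis cP : forall x, decomposition x (S x) (c x).

Lemma component_mem x i : c x i \in H i. Proof. by case: (cP x). Qed.

Lemma componentD x y i : c (x + y) i = c x i + c y i.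
Proof.
pose t := undup (S x ++ S y).
have [_ cxH cx0 _] := cP x; have [_ cyH cy0 _] := cP y.
apply: (@decomposition_unique _ _ _ t (fun i => c x i + c y i) (cP (x + y)) _ i); split.
- exact: undup_uniq.
- by move=> j; apply: homogeneousD.
- by move=> j; rewrite mem_undup mem_cat negb_or => /andP[/cx0 -> /cy0 ->]; rewrite addr0.
rewrite big_split /= -(decomposition_widen (cP x)) ?undup_uniq //; last first.
  by move=> j js; rewrite mem_undup mem_cat js.
rewrite -(decomposition_widen (cP y)) ?undup_uniq //.
by move=> j js; rewrite mem_undup mem_cat js orbT.
Qed.

Lemma component_homogeneous x i j : x \in H i -> c x j = if j == i then x else 0.
Proof.
move=> Hx; apply: (@decomposition_unique _ _ _ [::
  i] (fun j => if j == i then x else 0) (cP x) _ j); split=> //.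
- by move=> k; case: eqP => [-> //|_]; exact: homogeneous0.
- by move=> k; rewrite inE => /negPf ->.
- by rewrite big_seq1 eqxx.
Qed.

Lemma component0 i : c 0 i = 0.
Proof. by rewrite (component_homogeneous _ (homogeneous0 i)); case: eqP. Qed.

Lemma component_sum (K : Type) (s : seq K) (F : K -> V) i :
  c (\sum_(k <- s) F k) i = \sum_(k <- s) c (F k) i.
Proof. by apply: (big_morph (c^~ i)) => [x y|];
  [exact: componentD|exact: component0]. Qed.

Lemma component_neq0 x : x != 0 -> exists i, c x i != 0.
Proof.
move=> x0; apply: contrapT => h; move/negP: x0; apply; apply/eqP.
have [_ _ _ ->] := cP x; rewrite big1 // => i _.
by apply/eqP/negPn/negP => ci; apply: h; exists i.
Qed.

End Components.

Section GradedAction.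
Variables (R : comNzRingType) (M : lmodType R) (I : eqType) (act : nat -> I -> I).
Variables (G : nat -> {pred R}) (H : I -> {pred M}).
Hypotheses (G_grading : grading G) (H_grading : grading H).
Hypothesis GH : forall i j a x, a \in G i -> x \in H j -> a *: x \in H (act i j).
Variables (SR : R -> seq nat) (cR : R -> nat -> R) (SM : M -> seq I) (cM : M -> I -> M).
Hypotheses (cRP : forall a, decomposition G a (SR a) (cR a))
           (cMP : forall x, decomposition H x (SM x) (cM x)).

(** [act] stands for addition of degrees, so that the same lemmas serve R over itself, graded by
    [nat], and a module graded by [int]. *)
Lemma component_scale a x m : cM (a *: x) m =
  \sum_(i <- SR a) \sum_(j <- SM x | act i j == m) cR a i *: cM x j.
Proof.
have [_ _ _ {1}->] := cRP a; have [_ _ _ {1}->] := cMP x.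
rewrite scaler_suml (component_sum H_grading cMP); apply: eq_bigr => i _.
rewrite scaler_sumr (component_sum H_grading cMP) [RHS]big_mkcond;
  apply: eq_bigr => j _ /=.
rewrite (component_homogeneous H_grading cMP _ (GH (component_mem cRP a i)
  (component_mem cMP x j))).
by rewrite eq_sym.
Qed.

Lemma component_scale1 a x i0 j0 :
    (forall i j, act i j = act i0 j0 -> cR a i != 0 -> cM x j != 0 -> i = i0 /\ j = j0) ->
  cM (a *: x) (act i0 j0) = cR a i0 *: cM x j0.
Proof.
move=> h; rewrite component_scale.
have [ua _ a0 _] := cRP a; have [ux _ x0 _] := cMP x.
have Z i j : act i j = act i0 j0 -> (i != i0) || (j != j0) -> cR a i *: cM x j = 0.
  move=> ij ne; apply/eqP/negPn/negP => ax0.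
  have [] := h i j ij.
  - by apply: contraNneq ax0 => ->; rewrite scale0r.
  - by apply: contraNneq ax0 => ->; rewrite scaler0.
  - by move=> ii jj; move: ne; rewrite ii jj !eqxx.
have [ax0|ax0] := eqVneq (cR a i0 *: cM x j0) 0.
  rewrite ax0 big1 // => i _; rewrite big1 // => j /eqP ij.
  by have [/andP[/eqP -> /eqP ->]//|] := boolP ((i == i0) && (j == j0));
    rewrite negb_and => /Z ->.
have i0a : i0 \in SR a by apply: contraNT ax0 => /a0 ->; rewrite scale0r.
have j0x : j0 \in SM x by apply: contraNT ax0 => /x0 ->; rewrite scaler0.
rewrite (bigD1_seq i0) //= [X in _ + X]big1 ?addr0 => [|i ii0]; last first.
  by rewrite big1 // => j /eqP /Z -> //; rewrite ii0.
rewrite big_mkcond (bigD1_seq j0) //= eqxx big1 ?addr0 // => j jj0.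
by case: eqP => // /Z ->; rewrite // jj0 orbT.
Qed.

Lemma component_scale0 a x m :
  (forall i j, act i j = m -> cR a i != 0 -> cM x j != 0 -> False) -> cM (a *: x) m = 0.
Proof.
move=> h; rewrite component_scale big1 // => i _; rewrite big1 // => j /eqP ij.
have [->|ai] := eqVneq (cR a i) 0; first by rewrite scale0r.
have [->|xj] := eqVneq (cM x j) 0; first by rewrite scaler0.
by case: (h i j ij ai xj).
Qed.

End GradedAction.

(** * Graded modules *)

Lemma seq_min (P : pred int) (s : seq int) : has P s ->
  exists2 l, P l & forall j, j \in s -> P j -> l <= j.
Proof.
elim: s => //= x s IHs; have [Px _|nPx /= /IHs[l Pl lmin]] := boolP (P x); last first.
  exists l => // j; rewrite inE => /predU1P[-> Px|]; last exact: lmin.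
  by rewrite Px in nPx.
have [/IHs[l Pl lmin]|/hasPn noP] := boolP (has P s); last first.
  by exists x => // j; rewrite inE => /predU1P[->//|/noP /negP].
have [xl|lx] := leP x l.
  exists x => // j; rewrite inE => /predU1P[->//|js Pj].
  by apply: le_trans xl _; apply: lmin.
exists l => // j; rewrite inE => /predU1P[-> _|]; [exact: ltW|exact: lmin].
Qed.

Section GradedCyclic.
Variables (K : fieldType) (R : idomainType) (iota : {rmorphism K -> R}).
Variables (G : nat -> {pred R}) (SR : R -> seq nat) (cR : R -> nat -> R).
Hypothesis R_graded : graded_algebra iota G.
Hypothesis cRP : forall a, decomposition G a (SR a) (cR a).

Definition irrelevant_ideal : {pred R} := [pred x | cR x 0 == 0].

Lemma degree0_unit x : x \in G 0%N -> x != 0 -> exists y, y * x = 1.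
Proof.
have [_ _ G0] := R_graded; move=> /G0[a ->] a0; exists (iota a^-1).
rewrite -rmorphM mulVf ?rmorph1 //.
by apply: contraNneq a0 => ->; rewrite rmorph0.
Qed.

Lemma component_mul0 x y : cR (x * y) 0 = cR x 0 * cR y 0.
Proof.
have [Gg GM _] := R_graded.
apply: (@component_scale1 R R^o _ addn G G Gg GM SR cR SR cR cRP cRP x y 0 0).
by move=> [|i] [|j].
Qed.

Lemma irrelevant_ideal_maximal : maximal_ideal irrelevant_ideal.
Proof.
have [Gg GM G0] := R_graded.
have c1 : cR 1 0 = 1.
  by rewrite (component_homogeneous Gg cRP (i := 0%N)) //; apply/G0; exists 1;
    rewrite rmorph1.
split; first split.
- by rewrite inE (component0 Gg cRP).
- by rewrite inE c1 oner_eq0.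
- move=> a x y; rewrite !inE => /eqP x0 /eqP y0.
  by rewrite (componentD Gg cRP) component_mul0 x0 y0 mulr0 addr0.
move=> J [J0 J1 JD] mJ x Jx; rewrite inE; apply/negPn/negP => x0.
have [y yx] := degree0_unit (component_mem cRP x 0) x0.
have JM a b : b \in J -> a * b \in J by move=> Jb; rewrite -[_ * _]addr0; apply: JD.
move/negP: J1; apply; rewrite -yx; apply: JM.
have m : x - cR x 0 \in irrelevant_ideal.
  rewrite inE (componentD Gg cRP).
  rewrite (component_homogeneous Gg cRP 0%N (x := - cR x 0) (i := 0%N)) ?subrr //.
  by rewrite -sub0r; apply: (homogeneousB Gg);
    [exact: (homogeneous0 Gg)|exact: (component_mem cRP)].
rewrite -[cR x 0](subKr x) addrC -mulN1r; apply: JD => //; exact: mJ.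
Qed.

Variables (M : lmodType R) (H : int -> {pred M}).
Hypothesis M_graded : graded_module G H.
Hypothesis M_torsion_free : forall (a : R) (x : M), a *: x = 0 -> a = 0 \/ x = 0.

(* If t w = a w0 with t outside of the irrelevant ideal and w homogeneous,
   comparing the components of lowest degree shows that w is a multiple of the
   component of lowest degree of w0. *)
Lemma graded_cyclic (w0 : M) :
    (forall w, exists t a, t \notin irrelevant_ideal /\ t *: w = a *: w0) ->
  exists h : M, forall w, exists a, w = a *: h.
Proof.
move=> w0P; have [Gg GM G0] := R_graded; have [Hg GH] := M_graded.
have tw0 t : t \notin irrelevant_ideal -> t != 0.
  by apply: contraNneq => ->; rewrite inE (component0 Gg cRP).
have [w00|w00] := eqVneq w0 0.
  exists 0 => w; exists 0; have [t [a [/tw0 t0]]] := w0P w.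
  rewrite w00 !scaler0 => /M_torsion_free[t00|//].
  by rewrite t00 eqxx in t0.
have [SM [cM cMP]] := components_exist Hg.
have [l hl lmin] : exists2 l, cM w0 l != 0 & forall j, cM w0 j != 0 -> l <= j.
  have [_ _ w0S _] := cMP w0.
  have [|l hl lmin] := @seq_min (fun j => cM w0 j != 0) (SM w0).
    apply/hasP; have [j jw] := component_neq0 cMP w00; exists j => //.
    by apply: contraNT jw => /w0S ->.
  exists l => // j jw; apply: lmin => //.
  by apply: contraNT jw => /w0S ->.
exists (cM w0 l).
suff hom j w : w \in H j -> exists a, w = a *: cM w0 l.
  move=> w; have /choice[b bP] : forall j, exists a, cM w j = a *: cM w0 l.
    by move=> j; apply: (hom j); exact: (component_mem cMP).
  exists (\sum_(j <- SM w) b j); have [_ _ _ {1}->] := cMP w.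
  by rewrite scaler_suml; apply: eq_bigr => j _; rewrite bP.
move=> wj; have [->|w0'] := eqVneq w 0; first by exists 0; rewrite scale0r.
have [t [a [tm twa]]] := w0P w.
have t0 : cR t 0 != 0 by [].
have cw i : cM w i != 0 -> i = j.
  by rewrite (component_homogeneous Hg cMP _ wj); have [//|_] := eqVneq i j; rewrite eqxx.
have cwj : cM w j = w by rewrite (component_homogeneous Hg cMP _ wj) eqxx.
have act_eq (i : nat) (k k' : int) : i%:Z + k = k' -> i = `|k' - k|%N.
  by move=> <-; rewrite addrK.
have tw_j : cM (t *: w) j = cR t 0 *: w.
  have := @component_scale1 R M _ (fun i k =>
    i%:Z + k) G H Hg GH SR cR SM cM cRP cMP t w 0%N j.
  rewrite add0r cwj; apply=> i k ik _ /cw kj; split=> //.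
  by move: ik; rewrite kj => /act_eq; rewrite subrr.
have tw_lt m : m < j -> cM (t *: w) m = 0.
  move=> mj; apply: (component_scale0 (act := fun i k => i%:Z + k) Hg GH cRP cMP).
  move=> i k ik _ /cw kj; move: mj; rewrite -ik kj.
  by rewrite ltNge lerDr.
have a0 : a != 0.
  apply: contraNneq w0' => a00; move: twa;
    rewrite a00 scale0r => /M_torsion_free[t00|-> //].
  by move: (tw0 t tm); rewrite t00 eqxx.
have exk : exists k, cR a k != 0 by exact: (component_neq0 cRP).
case: (ex_minnP exk) => k ak kmin.
have aw_kl : cM (a *: w0) (k%:Z + l) = cR a k *: cM w0 l.
  apply: (component_scale1 (act := fun i k => i%:Z + k) Hg GH cRP cMP).
  move=> i m im /kmin ki /lmin lm; have : i%:Z = k%:Z /\ m = l.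
    have ki' : k%:Z <= i%:Z by rewrite lez_nat.
    have kE : i%:Z = k%:Z.
      apply/eqP; rewrite eq_le ki' andbT -(lerD2r m) im lerD2l //.
    by split=> //; apply: (addrI i%:Z); rewrite im kE.
  by case=> -[-> ->].
have aw_lt m : m < k%:Z + l -> cM (a *: w0) m = 0.
  move=> mkl; apply: (component_scale0 (act := fun i k => i%:Z + k) Hg GH cRP cMP).
  move=> i n inm /kmin ki /lmin ln; move: mkl; rewrite -inm ltNge.
  by rewrite lerD // lez_nat.
(* The lowest degree is [j] in t w and k + l in a w0; torsion-freeness ensures that the components
   found there are nonzero. *)
have kl : k%:Z + l = j.
  apply/eqP; rewrite eq_le; apply/andP; split; rewrite leNgt; apply/negP.
    move=> /aw_lt; rewrite -twa tw_j => /M_torsion_free[t00|w00'].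
      by rewrite t00 eqxx in t0.
    by rewrite w00' eqxx in w0'.
  move=> /tw_lt; rewrite twa aw_kl => /M_torsion_free[t00|w00'].
    by rewrite t00 eqxx in ak.
  by rewrite w00' eqxx in hl.
have [u ut] := degree0_unit (component_mem cRP t 0) t0.
exists (u * cR a k); rewrite -scalerA -aw_kl kl -twa tw_j scalerA ut scale1r //.
Qed.

End GradedCyclic.

(** * Ideals of minors *)

Section MinorIdeal.
Implicit Types m n p q k : nat.

Lemma minor_ideal_submod m n (A : 'M[int]_(m, n)) k :
  submod (minor_ideal A k : set int^o).
Proof.
split; first by exists (fun _ _ => 0); rewrite big1 // => f _; rewrite big1 // => g _;
  rewrite mul0r.
move=> a _ _ [c ->] [d ->]; exists (fun f g => a * c f g + d f g).
rewrite scaler_sumr -big_split; apply: eq_bigr => f _ /=.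
rewrite scaler_sumr -big_split; apply: eq_bigr => g _ /=.
by rewrite mulrDl -[a *: _]/(a * _) mulrA.
Qed.

Lemma minor_mem m n (A : 'M[int]_(m, n)) k (f : 'I_k -> 'I_m) (g : 'I_k -> 'I_n) :
  minor_ideal A k (\det (mxsub f g A)).
Proof.
exists (fun f' g' => ((f' == finfun f) && (g' == finfun g))%:R).
rewrite (bigD1 (finfun f)) //= (bigD1 (finfun g)) //= !eqxx mul1r mxsub_ffun.
rewrite [X in _ + X + _]big1 ?[X in _ + _ + X]big1 ?addr0 // =>
  [f' /negPf ff'|g' /negPf gg'].
  by rewrite big1 // => g' _; rewrite ff' mul0r.
by rewrite gg' andbF mul0r.
Qed.

Lemma minor_ideal_sub m n (A : 'M[int]_(m, n)) k (I : set int) :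
    submod (I : set int^o) ->
    (forall (f : 'I_k -> 'I_m) (g : 'I_k -> 'I_n), I (\det (mxsub f g A))) ->
  minor_ideal A k `<=` I.
Proof.
move=> IS If _ [c ->]; apply: (submod_sum IS) => f; apply: (submod_sum IS) => g.
exact: (submodZ IS).
Qed.

(** A crude Cauchy-Binet formula in which [h] ranges over all functions; it already puts the minors
    of a product into the ideal of minors of the right factor. *)
Lemma det_mulmx_expand k m (P : 'M[int]_(k, m)) (Q : 'M[int]_(m, k)) :
  \det (P *m Q) = \sum_(h : {ffun 'I_k -> 'I_m}) (\prod_i P i (h i)) * \det (rowsub h Q).
Proof.
pose PQ (s : 'S_k) i j := P i j * Q j (s i).
transitivity (\sum_(h : {ffun 'I_k -> 'I_m}) \sum_(s :
  'S_k) (-1) ^+ s * \prod_i PQ s i (h i)).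
  rewrite exchange_big; apply: eq_bigr => /= s _; rewrite -big_distrr /=.
  congr (_ * _); rewrite -(bigA_distr_bigA (PQ s)) /=.
  by apply: eq_bigr => x _; rewrite mxE.
apply: eq_bigr => h _; rewrite big_distrr; apply: eq_bigr => s _ /=.
rewrite mulrCA big_split; congr (_ * (_ * _)).
by apply: eq_bigr => i _; rewrite mxE.
Qed.

Lemma minor_ideal_mull m n p (X : 'M[int]_(p, m)) (A : 'M[int]_(m, n)) k :
  minor_ideal (X *m A) k `<=` minor_ideal A k.
Proof.
apply: minor_ideal_sub => [|f g]; first exact: minor_ideal_submod.
rewrite mxsub_mul det_mulmx_expand; apply: (submod_sum (minor_ideal_submod A k)) => h.
apply: (submodZ (minor_ideal_submod A k)); rewrite -mxsubrc; exact: minor_mem.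
Qed.

Lemma minor_ideal_tr m n (A : 'M[int]_(m, n)) k : minor_ideal A^T k `<=` minor_ideal A k.
Proof.
apply: minor_ideal_sub => [|f g]; first exact: minor_ideal_submod.
by rewrite -trmx_mxsub det_tr; exact: minor_mem.
Qed.

Lemma minor_ideal_mulr m n p (A : 'M[int]_(m, n)) (X : 'M[int]_(n, p)) k :
  minor_ideal (A *m X) k `<=` minor_ideal A k.
Proof.
move=> z; rewrite -[A *m X]trmxK => /minor_ideal_tr; rewrite trmx_mul.
by move=> /minor_ideal_mull /minor_ideal_tr.
Qed.

Lemma minor_ideal_mxsub m n p q (A : 'M[int]_(m, n)) k (f : 'I_p -> 'I_m) (g :
  'I_q -> 'I_n) :
  minor_ideal (mxsub f g A) k `<=` minor_ideal A k.
Proof.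
apply: minor_ideal_sub => [|f' g']; first exact: minor_ideal_submod.
by rewrite -mxsub_comp; exact: minor_mem.
Qed.

Lemma minor_ideal0 m n (A : 'M[int]_(m, n)) z : minor_ideal A 0 z.
Proof.
have f0 p : 'I_0 -> 'I_p by case.
have := minor_mem A (f0 m) (f0 n); rewrite det_mx00 => A1.
by rewrite -[z]mulr1; apply: (submodZ (minor_ideal_submod A 0) z A1).
Qed.

Lemma row'_col'_mxsub m n k (A : 'M[int]_(m, n)) (f : 'I_k -> 'I_m) (g :
  'I_k -> 'I_n) i j :
  row' i (col' j (mxsub f g A)) = mxsub (f \o lift i) (g \o lift j) A.
Proof. by apply/matrixP => a b; rewrite !mxE. Qed.

Lemma minor_ideal_le m n (A : 'M[int]_(m, n)) k l : (k <= l)%N ->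
  minor_ideal A l `<=` minor_ideal A k.
Proof.
suff AS j : minor_ideal A j.+1 `<=` minor_ideal A j.
  by move/subnK <-; elim: (l - k)%N => // j IHj z /AS /IHj.
have AS := minor_ideal_submod A j.
apply: minor_ideal_sub => // f g; rewrite (expand_det_row _ ord0).
apply: (submod_sum AS) => i; apply: (submodZ AS).
rewrite /cofactor; apply: (submodZ AS); rewrite row'_col'_mxsub; exact: minor_mem.
Qed.

Lemma minor_ideal_diag m p q (A : 'M[int]_(p, q)) k :
  minor_ideal A k `<=` minor_ideal (block_mx (1%:M : 'M_m) 0 0 A) (m + k).
Proof.
apply: minor_ideal_sub => [|f g]; first exact: minor_ideal_submod.
pose F r (h : 'I_k -> 'I_r) (i : 'I_(m + k)) : 'I_(m + r) :=
  match split i with inl j => lshift r j | inr j => rshift m (h j) end.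
have Fl r (h : 'I_k -> 'I_r) j : F r h (lshift k j) = lshift r j.
  by rewrite /F; case: split_ordP => a /eqP; rewrite ?eq_lshift ?eq_lrshift // => /eqP ->.
have Fr r (h : 'I_k -> 'I_r) j : F r h (rshift m j) = rshift m (h j).
  by rewrite /F; case: split_ordP => a /eqP; rewrite ?eq_rshift ?eq_rlshift // => /eqP ->.
have -> : \det (mxsub f g A) = \det (mxsub (F p f) (F q g) (block_mx (1%:M :
  'M_m) 0 0 A)).
  transitivity (\det (block_mx (1%:M : 'M_m) 0 0 (mxsub f g A))).
    by rewrite det_ublock det1 mul1r.
  congr (\det _).
  apply/matrixP => i j; rewrite [RHS]mxE.
  case: (split_ordP i) => a ->; case: (split_ordP j) => b ->; rewrite ?Fl ?Fr.
  - by rewrite !block_mxEul.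
  - by rewrite !block_mxEur !mxE.
  - by rewrite !block_mxEdl !mxE.
  - by rewrite !block_mxEdr mxE.
exact: minor_mem.
Qed.

(** Expanding along row 0 turns a minor using it into a multiple of a smaller minor of the rest; a
    minor using only column 0 has a zero column; any other is a minor of the rest. *)
Lemma minor_ideal_corner m n (A : 'M[int]_(m.+1, n.+1)) k : A ord0 ord0 = 1 ->
    (forall j, A ord0 (lift ord0 j) = 0) -> (forall i, A (lift ord0 i) ord0 = 0) ->
  minor_ideal A k.+1 `<=` minor_ideal (row' ord0 (col' ord0 A)) k.
Proof.
set B := row' _ _ => A00 A0 Al0; have BS := minor_ideal_submod B k.
have A0j j : j != ord0 -> A ord0 j = 0.
  by move=> j0; have [|j' -> _] := @unlift_some _ ord0 j; [rewrite eq_sym|exact: A0].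
have Ai0 i : i != ord0 -> A i ord0 = 0.
  by move=> i0; have [|i' -> _] := @unlift_some _ ord0 i; [rewrite eq_sym|exact: Al0].
have AB l (f : 'I_l -> 'I_m.+1) (g : 'I_l -> 'I_n.+1) :
    (forall i, f i != ord0) -> (forall i, g i != ord0) ->
    minor_ideal B l (\det (mxsub f g A)).
  move=> f0 g0.
  have lift_choice r (h : 'I_l -> 'I_r.+1) : (forall i, h i != ord0) ->
      exists h' : 'I_l -> 'I_r, forall i, h i = lift ord0 (h' i).
    move=> h0; suff /choice[h' h'P] : forall i, exists a, h i = lift ord0 a by exists h'.
    by move=> i; have [|a hi _] := @unlift_some _ ord0 (h i); [rewrite eq_sym|exists a].
  have [[f' f'P] [g' g'P]] := (lift_choice _ f f0, lift_choice _ g g0).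
  have -> : mxsub f g A = mxsub f' g' B.
    by apply/matrixP => i j; rewrite !mxE f'P g'P.
  exact: minor_mem.
apply: minor_ideal_sub => // f g.
have [fI|/injectivePn[i1 [i2 i12 fi]]] := altP (injectiveP f); last first.
  rewrite (determinant_alternate i12); first exact: (submod0 BS).
  by move=> j; rewrite !mxE fi.
have [gI|/injectivePn[i1 [i2 i12 gi]]] := altP (injectiveP g); last first.
  rewrite -det_tr (determinant_alternate i12); first exact: (submod0 BS).
  by move=> j; rewrite !mxE gi.
have [/existsP[i0 /eqP fi0]|/existsPn f0] := boolP [exists i, f i == ord0].
  rewrite (expand_det_row _ i0); apply: (submod_sum BS) => j.
  have [gj|gj] := eqVneq (g j) ord0; last first.
    by rewrite mxE fi0 A0j // mul0r; exact: (submod0 BS).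
  apply: (submodZ BS); rewrite /cofactor; apply: (submodZ BS).
  rewrite row'_col'_mxsub; apply: AB => a /=.
    by rewrite -fi0 (inj_eq fI) eq_sym neq_lift.
  by rewrite -gj (inj_eq gI) eq_sym neq_lift.
have [/existsP[j0 /eqP gj0]|/existsPn g0] := boolP [exists i, g i == ord0].
  rewrite (expand_det_col _ j0) big1; first exact: (submod0 BS).
  by move=> i _; rewrite mxE gj0 Ai0 ?mul0r.
exact/(minor_ideal_le (leqnSn k))/AB.
Qed.

Lemma minor_ideal_diagV m p q (A : 'M[int]_(p, q)) k :
  minor_ideal (block_mx (1%:M : 'M_m) 0 0 A) (m + k) `<=` minor_ideal A k.
Proof.
elim: m => [|m IHm].
  have -> : block_mx (1%:M : 'M_0) 0 0 A = A.
    apply/matrixP => i j; rewrite -[i in LHS](_ : rshift 0 i = i) ?(_ :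
      rshift 0 j = j); last exact: val_inj.
      by rewrite -[j in LHS](_ : rshift 0 j = j) ?block_mxEdr //; exact: val_inj.
  by [].
have lift_l r (i : 'I_m) : lift ord0 (lshift r i) = lshift r (lift ord0 i) by exact:
  val_inj.
have lift_r r (i : 'I_r) : lift ord0 (rshift m i) = rshift m.+1 i by exact: val_inj.
have ord0l r : ord0 = lshift r (ord0 : 'I_m.+1) :> 'I_(m + r).+1 by exact: val_inj.
move=> z /minor_ideal_corner Hz; apply: IHm.
have -> : block_mx (1%:M : 'M_m) 0 0 A =
    row' (ord0 : 'I_(m + p).+1) (col' (ord0 : 'I_(m + q).+1) (block_mx (1%:M :
      'M_m.+1) 0 0 A)).
  apply/matrixP => i j; rewrite 2![RHS]mxE.
  case: (split_ordP i) => a ->; case: (split_ordP j) => b ->; rewrite ?lift_l ?lift_r.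
  - by rewrite block_mxEul [RHS](block_mxEul 1%:M 0 0 A) !mxE (inj_eq (@lift_inj _ ord0)).
  - by rewrite block_mxEur [RHS](block_mxEur 1%:M 0 0 A) !mxE.
  - by rewrite block_mxEdl [RHS](block_mxEdl 1%:M 0 0 A) !mxE.
  - by rewrite block_mxEdr [RHS](block_mxEdr 1%:M 0 0 A).
apply: Hz.
- by rewrite !ord0l [LHS](block_mxEul 1%:M 0 0 A) mxE eqxx.
- move=> j; case: (split_ordP j) => b ->; rewrite ?lift_l ?lift_r !ord0l.
    by rewrite [LHS](block_mxEul 1%:M 0 0 A) mxE.
  by rewrite [LHS](block_mxEur 1%:M 0 0 A) mxE.
- move=> i; case: (split_ordP i) => a ->; rewrite ?lift_l ?lift_r !ord0l.
    by rewrite [LHS](block_mxEul 1%:M 0 0 A) mxE.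
  by rewrite [LHS](block_mxEdl 1%:M 0 0 A) mxE.
Qed.

Lemma minor_ideal_swap m p q (A : 'M[int]_(p, q)) k :
  minor_ideal (block_mx A 0 0 (1%:M : 'M_m)) k `<=`
  minor_ideal (block_mx (1%:M : 'M_m) 0 0 A) k.
Proof.
pose F r (i : 'I_(r + m)) : 'I_(m + r) :=
  match split i with inl j => rshift m j | inr j => lshift r j end.
have Fl r j : F r (lshift m j) = rshift m j.
  by rewrite /F; case: split_ordP => a /eqP; rewrite ?eq_lshift ?eq_lrshift // => /eqP ->.
have Fr r j : F r (rshift r j) = lshift r j.
  by rewrite /F; case: split_ordP => a /eqP; rewrite ?eq_rshift ?eq_rlshift // => /eqP ->.
have -> : block_mx A 0 0 (1%:M : 'M_m) = mxsub (F p) (F q) (block_mx (1%:M : 'M_m) 0 0 A).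
  apply/matrixP => i j; rewrite [RHS]mxE.
  case: (split_ordP i) => a ->; case: (split_ordP j) => b ->; rewrite ?Fl ?Fr.
  - by rewrite block_mxEul block_mxEdr.
  - by rewrite block_mxEur block_mxEdl !mxE.
  - by rewrite block_mxEdl block_mxEur !mxE.
  - by rewrite block_mxEdr block_mxEul.
exact: minor_ideal_mxsub.
Qed.

End MinorIdeal.

(** * Presentations of abelian groups *)

Lemma int_ideal_principal (I : set int^o) : submod I ->
  exists d : nat, I = [set z : int | (d%:Z %| z)%Z].
Proof.
move=> IS; have [[x [Ix x0]]|nI] := pselect (exists x : int, I x /\ x != 0); last first.
  exists 0%N; apply/predeqP => z; rewrite /= dvd0z; split=> [Iz|/eqP ->];
    last exact: (submod0 IS).
  by apply/negPn/negP => z0; apply: nI; exists z.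
have Iabs z : I z -> I `|z|%N%:Z.
  move=> Iz; rewrite abszE; case: (ger0P z) => _ //; exact: (submodN IS).
have exd : exists d, (0 < d)%N && `[< I d%:Z >].
  by exists `|x|%N; rewrite absz_gt0 x0; apply/asboolP; exact: Iabs.
case: (ex_minnP exd) => d /andP[d0 /asboolP Id] dmin.
exists d; apply/predeqP => z /=; split=> [Iz|/dvdzP[q ->]]; last exact: (submodZ IS q Id).
have d0' : d%:Z != 0 by rewrite eqz_nat -lt0n.
apply/dvdz_mod0P/eqP/negPn/negP => zd.
have Ir : I (z %% d)%Z.
  have -> : (z %% d)%Z = z - (z %/ d)%Z * d%:Z by rewrite {2}(divz_eq z d) addrC addKr.
  exact: (submodB IS Iz (submodZ IS (z %/ d)%Z Id)).
have r0 := modz_ge0 z d0'.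
have : (d <= `|(z %% d)%Z|)%N.
  by apply: dmin; rewrite absz_gt0 zd; apply/asboolP; exact: Iabs.
rewrite leqNgt => /negP; apply.
by rewrite -ltz_nat gez0_abs // ltz_pmod.
Qed.

Section Presentations.
Variable G : zmodType.
Implicit Types m n k : nat.

Definition comb n (u : 'I_n -> G) (c : 'rV[int]_n) : G := \sum_i u i *~ c 0 i.

Lemma combD n (u : 'I_n -> G) c d : comb u (c + d) = comb u c + comb u d.
Proof. by rewrite -big_split; apply: eq_bigr => i _; rewrite mxE mulrzDr. Qed.

Lemma combN n (u : 'I_n -> G) c : comb u (- c) = - comb u c.
Proof. by rewrite -sumrN; apply: eq_bigr => i _; rewrite mxE mulrNz. Qed.

Lemma combB n (u : 'I_n -> G) c d : comb u (c - d) = comb u c - comb u d.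
Proof. by rewrite combD combN. Qed.

Lemma comb0 n (u : 'I_n -> G) : comb u 0 = 0.
Proof. by rewrite /comb big1 // => i _; rewrite mxE mulr0z. Qed.

Lemma comb_mul m n (u : 'I_n -> G) (b : 'rV[int]_m) (A : 'M[int]_(m, n)) :
  comb u (b *m A) = comb (fun i => comb u (row i A)) b.
Proof.
rewrite /comb; under eq_bigr do rewrite mxE mulrz_sumr.
rewrite exchange_big; apply: eq_bigr => i _ /=; rewrite mulrz_suml.
by apply: eq_bigr => j _; rewrite mxE mulrC mulrzA.
Qed.

Lemma comb_delta n (u : 'I_n -> G) i : comb u (delta_mx 0 i) = u i.
Proof.
rewrite /comb (bigD1 i) //= big1 ?addr0 => [|j ji]; first by rewrite mxE !eqxx mulr1z.
by rewrite mxE eqxx (negPf ji) mulr0z.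
Qed.

Lemma eq_comb n (u v : 'I_n -> G) c : u =1 v -> comb u c = comb v c.
Proof. by move=> uv; apply: eq_bigr => i _; rewrite uv. Qed.

Lemma relation_matrix n (u : 'I_n -> G) m (A : 'M[int]_(m, n)) k (X : 'M[int]_(k, n)) :
  presented_by u A -> (forall i, comb u (row i X) = 0) -> exists Y, X = Y *m A.
Proof.
move=> [_ uA] uX.
have /choice[Y YP] (i : 'I_k) : exists y, row i X = y *m A by apply/uA/uX.
exists (\matrix_i Y i); apply/row_matrixP => i.
by rewrite row_mul rowK.
Qed.

Lemma generators_matrix n (u : 'I_n -> G) k (v : 'I_k -> G) : generates u ->
  exists P : 'M[int]_(k, n), forall i, v i = comb u (row i P).
Proof.
move=> uG; have /choice[P PP] (i : 'I_k) : exists c, v i = comb u c by exact: uG.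
by exists (\matrix_i P i) => i; rewrite rowK.
Qed.

(** Consider the joint generators (v, u). The rows of [D] are the relations [B] and u = P v; those
    of [C], namely v = Q u and [A], are combinations of them. Column operations reduce [C] to 1 + A
    and [D] to B + 1 as block sums, whose minors are those of [A] and [B] with a shift of the
    size. *)
Lemma presentation_minor_ideal n (u : 'I_n -> G) a (A : 'M[int]_(a, n))
    m (v : 'I_m -> G) b (B : 'M[int]_(b, m)) i :
  presented_by u A -> presented_by v B ->
  minor_ideal A (n - i) `<=` minor_ideal B (m - i).
Proof.
move=> uA vB; have [P uP] := generators_matrix u vB.1.
have [Q vQ] := generators_matrix v uA.1.
have [mi|im] := ltnP m i.
  by have /eqP -> : (m - i == 0)%N; [rewrite subn_eq0 ltnW|move=> z _;
    exact: minor_ideal0].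
have [X1 X1E] : exists Y, 1%:M - Q *m P = Y *m B.
  apply: (relation_matrix vB) => j; rewrite raddfB /= row_mul row1 combB comb_delta.
  by rewrite comb_mul vQ (eq_comb _ uP) subrr.
have [X2 X2E] : exists Y, A *m P = Y *m B.
  apply: (relation_matrix vB) => j; rewrite row_mul comb_mul -(eq_comb _ uP).
  by apply/(uA.2); exists (delta_mx 0 j); rewrite -rowE.
pose C := block_mx 1%:M (- Q) 0 A; pose D := block_mx B 0 (- P) 1%:M.
have CD : C = block_mx X1 (- Q) X2 A *m D.
  rewrite mulmx_block !mulmx0 !add0r !mulmx1 -X1E -X2E mulmxN mulNmx opprK subrK.
  by rewrite mulmxN subrr.
(* The inequality can be strict, because n - i is truncated when n < i. *)
have le_mn : (m + n - i <= m + (n - i))%N by rewrite leq_subLR addnCA leq_add2l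
  -leq_subLR.
move=> z /(@minor_ideal_diag m) /(minor_ideal_le le_mn).
have -> : block_mx 1%:M 0 0 A = C *m block_mx 1%:M Q 0 1%:M.
  by rewrite mulmx_block !mulmx0 !mul0mx !mulmx1 !mul1mx !addr0 !add0r subrr.
move=> /minor_ideal_mulr; rewrite CD => /minor_ideal_mull.
have -> : D = block_mx B 0 0 1%:M *m block_mx 1%:M 0 (- P) 1%:M.
  by rewrite mulmx_block !mulmx0 !mul0mx !mulmx1 !mul1mx !addr0 !add0r.
move=> /minor_ideal_mulr /minor_ideal_swap.
have -> : (m + n - i = n + (m - i))%N by rewrite addnBA // addnC.
exact: minor_ideal_diagV.
Qed.

Lemma fitting_ideal_presented n (u : 'I_n -> G) a (A : 'M[int]_(a, n)) i :
  presented_by u A -> fitting_ideal i G = minor_ideal A (n - i).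
Proof.
move=> uA; apply/predeqP => z; split=> [[m [v [b [B [vB Bz]]]]]|Az].
  exact: presentation_minor_ideal vB uA _ Bz.
by exists n, u, a, A.
Qed.

(* A subgroup of Z^n.+1 is generated by a subgroup of Z^n together with one
   element whose first coordinate generates the ideal of first coordinates. *)
Lemma int_submodule_fg n (N : set 'rV[int]_n) : submod N ->
  exists m (A : 'M[int]_(m, n)), forall c, N c <-> exists b, c = b *m A.
Proof.
elim: n N => [|n IHn] N NS.
  exists 0%N, 0 => c; rewrite thinmx0; split=> [_|_]; last exact: (submod0 NS).
  by exists 0; rewrite mulmx0.
pose I : set int^o := [set a : int | exists c' : 'rV_n, N (row_mx (a%:M : 'M_1) c')].
have IS : submod I.
  split; first by exists 0; rewrite raddf0 row_mx0; exact: (submod0 NS).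
  move=> a x y [c Nc] [d Nd]; exists (a *: c + d).
  rewrite raddfD /= -[a *: x]/(a * x) -scale_scalar_mx -add_row_mx -scale_row_mx.
  by apply: (submodD NS) => //; exact: (submodZ NS).
have [d dI] := int_ideal_principal IS.
have [e Ne] : I d by rewrite dI /=.
have [|m [A0 A0P]] := IHn [set c' | N (row_mx (0 : 'M_1) c')].
  split; first by rewrite /= row_mx0; exact: (submod0 NS).
  move=> a x y /= Nx Ny; rewrite -[0]addr0 -[X in X + _](scaler0 _ a) -add_row_mx
    -scale_row_mx.
  by apply: (submodD NS) => //; exact: (submodZ NS).
exists (1 + m)%N, (block_mx (d%:Z%:M : 'M_1) e 0 A0) => c.
have NB (b1 : 'M[int]_1) (b2 : 'rV_m) :
    N (row_mx b1 b2 *m block_mx (d%:Z%:M : 'M_1) e 0 A0).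
  rewrite mul_row_block mulmx0 addr0 [b1]mx11_scalar !mul_scalar_mx.
  rewrite -[X in row_mx X _]addr0 -add_row_mx -scale_row_mx.
  apply: (submodD NS); first exact: (submodZ NS).
  by apply/A0P; exists b2.
split=> [Nc|[b ->]]; last by rewrite -[b](@hsubmxK _ 1 1 m); exact: NB.
pose c0 : int := c 0 ord0.
have cE : c = row_mx (c0%:M : 'M_1) (rsubmx (c : 'rV_(1 + n))).
  have <- : lsubmx (c : 'rV_(1 + n)) = c0%:M.
    by rewrite [LHS]mx11_scalar !mxE; congr (c _ _)%:M; exact: val_inj.
  by rewrite (@hsubmxK _ 1 1 n).
have /dvdzP[q qE] : (d%:Z %| c0)%Z.
  by have : I c0; [exists (rsubmx (c : 'rV_(1 + n))); rewrite -cE|rewrite dI].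
have /A0P[b bE] : N (row_mx (0 : 'M_1) (rsubmx (c : 'rV_(1 + n)) - q *: e)).
  have -> : row_mx (0 : 'M_1) (rsubmx (c : 'rV_(1 + n)) - q *: e) =
      row_mx c0%:M (rsubmx (c : 'rV_(1 + n))) - q *: row_mx (d%:Z%:M : 'M_1) e.
    by rewrite scale_row_mx opp_row_mx add_row_mx scale_scalar_mx -qE subrr.
  rewrite -cE.
  exact: (submodB NS Nc (submodZ NS q Ne)).
exists (row_mx (q%:M : 'M_1) b);
  rewrite [RHS](@mul_row_block _ 1 1 m 1 n) mulmx0 addr0 -bE.
by rewrite -scalar_mxM -qE mul_scalar_mx addrC subrK -cE.
Qed.

Lemma fg_presented : fg_group G ->
  exists n (u : 'I_n -> G) m (A : 'M[int]_(m, n)), presented_by u A.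
Proof.
move=> [n [u uG]]; have [|m [A AP]] := @int_submodule_fg n [set c | comb u c = 0].
  split; first by rewrite /= comb0.
  move=> a x y /= ux uy; rewrite combD uy addr0.
  rewrite -mul_scalar_mx comb_mul /comb big_ord1 [X in X *~ _](_ : _ = 0) ?mul0rz //.
  by rewrite rowE -[RHS]ux; congr (comb u _); apply/rowP => j;
    rewrite mxE big_ord1 mxE !eqxx mul1r ord1.
by exists n, u, m, A; split=> // c; apply: iff_trans (AP c) _.
Qed.

Lemma rat_matrix_denominator m n (M : 'M[rat]_(m, n)) :
  exists (d : int) (X : 'M[int]_(m, n)), d != 0 /\ d%:~R *: M = map_mx intr X.
Proof.
pose d := \prod_i \prod_j denq (M i j).
have d0 : d != 0.
  by apply/prodf_neq0 => i _; apply/prodf_neq0 => j _; rewrite denq_eq0.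
have /choice[X XP] (ij : 'I_m * 'I_n) : exists x : int, d%:~R * M ij.1 ij.2 = x%:~R.
  case: ij => i j /=; rewrite /d (bigD1 i) //= (bigD1 j) //=.
  exists (numq (M i j) * (\prod_(j0 | j0 != j) denq (M i j0)) * \prod_(i0 | i0 != i)
    \prod_j0 denq (M i0 j0)).
  by rewrite !rmorphM /= numqE mulrC !mulrA.
exists d, (\matrix_(i, j) X (i, j)); split=> //.
by apply/matrixP => i j; rewrite !mxE -(XP (i, j)).
Qed.

Definition rat_rank m n (A : 'M[int]_(m, n)) : nat := \rank (map_mx intr A :
  'M[rat]_(m, n)).

Lemma map_intr_inj m n : injective (map_mx intr : 'M[int]_(m, n) -> 'M[rat]_(m, n)).
Proof.
by move=> A B /matrixP AB; apply/matrixP => i j; have := AB i j;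
  rewrite !mxE => /intr_inj.
Qed.

(** After tensoring with Q the rank is the dimension of Q^n modulo the row space of [A]; clearing
    denominators carries independence both ways. *)
Lemma presented_rank n (u : 'I_n -> G) m (A : 'M[int]_(m, n)) :
  presented_by u A -> has_rank G (n - rat_rank A).
Proof.
move=> uA; pose AQ : 'M[rat]_(m, n) := map_mx intr A.
rewrite -[rat_rank A]/(\rank AQ); split.
  rewrite -mxrank_compl.
  (* Integral multiples of a basis of a complement of the row space: a relation between them would
     lie in both spaces. *)
  have [d [C [d0 CE]]] := rat_matrix_denominator (row_base AQ^C%MS).
  exists (fun i => comb u (row i C)) => x;
    rewrite -[LHS]/(comb _ x) -comb_mul => /uA.2[z zE].
  have dQ : d%:~R != 0 :> rat by rewrite intr_eq0.
  have xC : (map_mx intr x *m row_base AQ^C <= AQ :&: AQ^C)%MS.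
    rewrite sub_capmx; apply/andP; split; last by rewrite mulmx_sub // eq_row_base.
    rewrite -(eqmx_scale _ dQ) scalemxAr CE -map_mxM zE map_mxM; exact: submxMl.
  apply: map_intr_inj; rewrite map_mx0.
  apply: (row_free_inj (row_base_free AQ^C%MS)); rewrite mul0mx.
  by apply/eqP; rewrite -submx0 (submx_trans xC) // capmx_compl.
move=> k w w_free; have [C CE] := generators_matrix w uA.1.
rewrite leqNgt; apply/negP => kn.
pose CQ : 'M[rat]_(k, n) := map_mx intr C.
have kn' : (n < k + \rank AQ)%N.
  by rewrite addnC -ltn_subLR ?rank_leq_col.
(* More than [n] rows in Q^n are dependent. The part [x] of a dependence is nonzero since the rows
   of [row_base AQ] are independent. *)
pose E := col_mx CQ (row_base AQ).
have /rowV0Pn[v vE v0] : kermx E != 0.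
  by rewrite kermx_eq0 -row_leq_rank -ltnNge (leq_ltn_trans (rank_leq_col _)).
have vE0 : v *m E = 0 by apply/sub_kermxP.
move: vE0 v0 {vE}; rewrite -[v]hsubmxK mul_row_col; set x := lsubmx v; set y := rsubmx v.
move=> xy v0.
have x0 : x != 0.
  apply: contraNneq v0 => x0; rewrite x0 mul0mx add0r in xy.
  by rewrite x0 (row_free_inj (row_base_free AQ) (etrans xy (esym (mul0mx _ _)))) row_mx0.
have /submxP[z zE] : (x *m CQ <= AQ)%MS.
  have -> : x *m CQ = - (y *m row_base AQ) by apply/eqP; rewrite -addr_eq0 xy.
  by rewrite eqmx_opp mulmx_sub // eq_row_base.
have [d1 [X [d10 XE]]] := rat_matrix_denominator x.
have [d2 [Z [d20 ZE]]] := rat_matrix_denominator z.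
have XZ : (d2 *: X) *m C = (d1 *: Z) *m A.
  apply: map_intr_inj; rewrite !map_mxM !map_mxZ /= -XE -ZE -!scalemxAl -/CQ -/AQ zE.
  by rewrite !scalerA mulrC.
have : d2 *: X = 0.
  apply: w_free; rewrite -[LHS]/(comb w _) (eq_comb _ CE) -comb_mul XZ.
  by apply/uA.2; exists (d1 *: Z).
move/(congr1 (map_mx (intr : int -> rat))); rewrite map_mxZ -XE map_mx0 => /eqP.
by rewrite !scaler_eq0 !intr_eq0 (negPf d10) (negPf d20) (negPf x0).
Qed.

Lemma rank_presented n (u : 'I_n -> G) m (A : 'M[int]_(m, n)) :
  presented_by u A -> rank G = (n - rat_rank A)%N.
Proof.
move=> /presented_rank rA; apply: xget_unique => // r [[v v_free] vmax].
case: rA => -[w w_free] wmax; apply/eqP.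
by rewrite eqn_leq (wmax _ v) // (vmax _ w).
Qed.

End Presentations.

(** * Smith normal form *)

Lemma minor_rank0 m n (A : 'M[int]_(m, n)) k z : (rat_rank A < k)%N ->
  minor_ideal A k z -> z = 0.
Proof.
move=> Ak; suff : minor_ideal A k `<=` [set 0] by move=> h /h.
apply: minor_ideal_sub => [|f g]; first exact: (@set0_submod int int^o).
apply/eqP; apply: contraTT Ak => d0; rewrite -leqNgt.
set AQ : 'M[rat]_(m, n) := map_mx intr A.
have <- : \rank (mxsub f g AQ) = k.
  by apply: mxrank_unit; rewrite unitmxE unitfE -map_mxsub det_map_mx intr_eq0.
have -> : mxsub f g AQ = rowsub f 1%:M *m (AQ *m colsub g 1%:M).
  by rewrite -[AQ in LHS]mul1mx mxsub_mul -[AQ in LHS]mulmx1 mxsub_mul mxsub_id.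
by rewrite (leq_trans (mxrankM_maxr _ _)) // mxrankM_maxl.
Qed.

Lemma minor_rank_neq0 m n (A : 'M[int]_(m, n)) :
  exists2 z, z != 0 & minor_ideal A (rat_rank A) z.
Proof.
rewrite /rat_rank; set AQ : 'M[rat]_(m, n) := map_mx intr A.
pose f := maxrankfun AQ; pose B := rowsub f AQ.
have Bfull : row_full B^T by rewrite /row_full mxrank_tr; exact: maxrowsub_free.
pose g := fullrankfun Bfull.
exists (\det (mxsub f g A)); last exact: minor_mem.
have := fullrowsub_unit Bfull; rewrite unitmxE unitfE -/g.
have -> : rowsub g B^T = (map_mx intr (mxsub f g A))^T.
  by apply/matrixP => i j; rewrite !mxE.
by rewrite det_tr det_map_mx intr_eq0.
Qed.

Section SmithRow.
Variables (m n : nat) (d : seq int) (c : 'rV[int]_n) (k : nat).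
Hypothesis d_sorted : sorted dvdz d.
Let D : 'M[int]_(m, n) := \matrix_(i, j) (d`_i *+ (i == j :> nat)).
Hypothesis D_neq0 : exists2 z, z != 0 & minor_ideal D k z.
Hypothesis Dc_eq0 : forall z, minor_ideal (col_mx D c) k.+1 z -> z = 0.
Hypothesis Dc_sub : minor_ideal (col_mx D c) k `<=` minor_ideal D k.

Lemma smith_zero i j : (i <= j)%N -> d`_i = 0 -> d`_j = 0.
Proof.
move=> ij di; have [dj|jd] := leqP (size d) j; first by rewrite nth_default.
have := sorted_leq_nth (@dvdz_trans) (@dvdzz) 0 d_sorted i j (leq_ltn_trans ij jd) jd ij.
by rewrite di dvd0z => /eqP.
Qed.

Lemma smith_support : exists (f : 'I_k -> 'I_m) (g : 'I_k -> 'I_n),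
  [/\ injective f, injective g & forall i, d`_(f i) != 0].
Proof.
apply: contrapT => h; have [z z0 Dz] := D_neq0.
move/negP: z0; apply; apply/eqP.
suff : minor_ideal D k `<=` [set 0] by move=> /(_ z Dz).
apply: minor_ideal_sub => [|f g]; first exact: (@set0_submod int int^o).
have [fI|/injectivePn[i1 [i2 i12 fi]]] := altP (injectiveP f); last first.
  by apply: (determinant_alternate i12) => j; rewrite !mxE fi.
have [gI|/injectivePn[i1 [i2 i12 gi]]] := altP (injectiveP g); last first.
  by rewrite -det_tr; apply: (determinant_alternate i12) => j; rewrite !mxE gi.
rewrite /= /determinant big1 // => s _; apply/eqP; rewrite mulf_eq0 signr_eq0 /=.
apply/negPn/negP => /prodf_neq0 Ds; apply: h; exists f, g; split=> // i.
by have := Ds i isT; rewrite !mxE; apply: contraNneq => ->; rewrite mul0rn.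
Qed.

(** In a divisibility chain zeros come last, and a nonzero k-minor requires [k] nonzero diagonal
    entries. *)
Lemma smith_lt i : (i < k)%N -> d`_i != 0.
Proof.
have [f [g [fI _ df]]] := smith_support.
move=> ik; apply: contraTneq ik => di; rewrite -leqNgt.
have fi j : (f j < i)%N.
  by rewrite ltnNge; apply/negP => /smith_zero /(_ di) /eqP; apply/negP.
rewrite -[k]card_ord -[i]card_ord; apply: (@leq_card _ _ (fun j => Ordinal (fi j))).
by move=> j j' [] /val_inj /fI.
Qed.

Lemma smith_leq : (k <= m)%N /\ (k <= n)%N.
Proof.
have [f [g [fI gI _]]] := smith_support.
by rewrite -[k]card_ord -[m]card_ord -[n]card_ord; split;
  [exact: leq_card fI|exact: leq_card gI].
Qed.

Let km := smith_leq.1.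
Let kn := smith_leq.2.
Let wm (i : 'I_k) : 'I_m := widen_ord km i.
Let wn (i : 'I_k) : 'I_n := widen_ord kn i.

Lemma smith_ge i : (k <= i)%N -> (i < m)%N -> (i < n)%N -> d`_i = 0.
Proof.
move=> ki im inn; apply: (smith_zero ki); apply/eqP.
have km' : (k.+1 <= m)%N by exact: leq_ltn_trans im.
have kn' : (k.+1 <= n)%N by exact: leq_ltn_trans inn.
have := Dc_eq0 (minor_mem (col_mx D c) (fun i =>
  lshift 1 (widen_ord km' i)) (widen_ord kn')).
rewrite det_trig; last first.
  apply/is_trig_mxP => i' j' ij; rewrite mxE col_mxEu mxE /=.
  by rewrite (ltn_eqF ij) mulr0n.
move/eqP; apply: contraTT => dk; apply/prodf_neq0 => j _.
rewrite mxE col_mxEu mxE eqxx mulr1n /=; apply: contraNneq dk => dj.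
by apply/eqP; apply: smith_zero dj; rewrite -ltnS.
Qed.

Let delta := \prod_(i < k) d`_i.

Lemma smith_minor z : minor_ideal D k z -> (delta %| z)%Z.
Proof.
suff : minor_ideal D k `<=` [set z : int | (delta %| z)%Z] by apply.
apply: minor_ideal_sub => [|f g].
  split=> [|a x y /= dx dy]; first exact: dvdz0.
  by rewrite /= rpredD // dvdz_mull.
have [fI|/injectivePn[i1 [i2 i12 fi]]] := altP (injectiveP f); last first.
  by rewrite /= (determinant_alternate i12) ?dvdz0 // => j; rewrite !mxE fi.
rewrite /= /determinant; apply: rpred_sum => s _; apply: dvdz_mull.
have [Ds|] := boolP [forall i, mxsub f g D i (s i) != 0]; last first.
  by rewrite negb_forall => /existsP[i /negPn/eqP Di];
    rewrite (bigD1 i) //= Di mul0r dvdz0.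
move/forallP: Ds => Ds.
have fg i : (f i == g (s i) :> nat).
  by have := Ds i; rewrite !mxE; apply: contraR => /negPf ->; rewrite mulr0n.
have fk i : (f i < k)%N.
  have := Ds i; rewrite !mxE fg mulr1n ltnNge; apply: contraNN => ki; apply/eqP.
  by apply: smith_ge; rewrite ?ltn_ord // (eqP (fg i)) ltn_ord.
pose h i := Ordinal (fk i).
have hI : injective h by move=> i j [] /val_inj /fI.
have -> : \prod_i mxsub f g D i (s i) = delta; last exact: dvdzz.
rewrite /delta [RHS](reindex_inj hI); apply: eq_bigr => i _.
by rewrite !mxE fg mulr1n.
Qed.

(** The first [k] rows and columns together with the row [c] and column [j] form a triangular minor
    of size k + 1 equal to delta times the entry of [c]. It vanishes while delta does not. *)
Lemma smith_row_ge (j : 'I_n) : (k <= j)%N -> c 0 j = 0.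
Proof.
move=> kj.
pose F (i : 'I_k.+1) : 'I_(m + 1) :=
  if unlift ord_max i is Some i' then lshift 1 (wm i') else rshift m ord0.
pose H (i : 'I_k.+1) : 'I_n := if unlift ord_max i is Some i' then wn i' else j.
have := Dc_eq0 (minor_mem (col_mx D c) F H).
have lift_max (i : 'I_k) : lift ord_max i = i :> nat by rewrite /= /bump leqNgt ltn_ord.
rewrite det_trig; last first.
  apply/is_trig_mxP => i' j' ij; rewrite mxE /F /H.
  case: unliftP ij => [a ->|->]; last by rewrite ltnNge -ltnS ltn_ord.
  rewrite col_mxEu mxE; case: unliftP => [b ->|-> _].
    by rewrite !lift_max => ab; rewrite (_ :
      (wm a == wn b :> nat) = false) ?mulr0n // ltn_eqF.
  by rewrite (_ : (wm a == j :> nat) = false) ?mulr0n // ltn_eqF // (leq_trans (ltn_ord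
    a)).
rewrite big_ord_recr /= => /eqP; rewrite mulf_eq0 => /orP[|].
  move=> /prodf_eq0 [i _]; rewrite mxE /F /H.
  have -> : widen_ord (leqnSn k) i = lift ord_max i by apply: val_inj;
    rewrite [RHS]lift_max.
  by rewrite liftK col_mxEu mxE eqxx mulr1n /= (negPf (smith_lt (ltn_ord i))).
by rewrite mxE /F /H unlift_none col_mxEd => /eqP.
Qed.

(** Replacing row [i] of the leading block by [c] multiplies its determinant delta by c_i / d_i. The
    new minor lies in the ideal of k-minors of [D], all divisible by delta. *)
Lemma smith_row_lt (i : 'I_k) : (d`_i %| c 0%R (wn i))%Z.
Proof.
pose F (l : 'I_k) : 'I_(m + 1) := if l == i then rshift m ord0 else lshift 1 (wm l).
pose X := mxsub F wn (col_mx D c).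
have XE l j : X l j = if l == i then c 0 (wn j) else d`_l *+ (l == j).
  rewrite mxE /F; case: eqP => _; first by rewrite col_mxEd.
  by rewrite col_mxEu mxE.
have delta0 : delta != 0 by apply/prodf_neq0 => l _; apply: smith_lt.
have dE : delta = d`_i * \prod_(l < k.-1) d`_(lift i l).
  by rewrite /delta (bigD1_ord i).
have : (delta %| \det X)%Z by apply/smith_minor/Dc_sub; exact: minor_mem.
rewrite (expand_det_col _ i) (bigD1 i) //= big1 ?addr0 => [|l li]; last first.
  by rewrite XE (negPf li) mulr0n mul0r.
rewrite XE eqxx /cofactor -signr_odd oddD addbb mul1r.
rewrite det_trig; last first.
  apply/is_trig_mxP => a b ab; rewrite 2!mxE XE [lift i a == i]eq_sym (negPf (neq_lift
    _ _)).
  by rewrite (inj_eq (@lift_inj _ i)) -val_eqE /= (ltn_eqF ab) mulr0n.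
have -> : \prod_(l < k.-1) row' i (col' i X) l l = \prod_(l < k.-1) d`_(lift i l).
  by apply: eq_bigr => l _; rewrite 2!mxE XE [lift i l == i]eq_sym (negPf (neq_lift _
    _)) eqxx.
rewrite dE dvdz_mul2r //; apply: contraNneq delta0 => d0.
by rewrite dE d0 mulr0.
Qed.

Lemma smith_row : exists b, c = b *m D.
Proof.
(* The value 0 past the first [k] rows is harmless, as [c] vanishes past the first [k] columns. *)
exists (\row_(i < m) if insub (i : nat) is Some i' then (c 0%R (wn i') %/ d`_i)%Z else 0).
apply/rowP => j; rewrite mxE.
have [jk|kj] := ltnP j k; last first.
  rewrite smith_row_ge // big1 // => i _; rewrite !mxE.
  case: insubP => [i' ik _|_]; last by rewrite mul0r.
  by rewrite ltn_eqF ?mulr0n ?mulr0 // (leq_trans ik).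
have jm : (j < m)%N by exact: leq_trans jk km.
rewrite (bigD1 (Ordinal jm)) //= big1 ?addr0 => [|i ij]; last first.
  have ij' : (i != j :> nat) by move: ij; rewrite -val_eqE.
  by rewrite !mxE (negPf ij') mulr0n mulr0.
rewrite !mxE eqxx mulr1n insubT /=.
have -> : wn (Sub (j : nat) jk) = j by exact: val_inj.
by rewrite divzK //; have := smith_row_lt (Ordinal jk); congr (_ %| c 0%R _)%Z;
  exact: val_inj.
Qed.

End SmithRow.

(** * The torsion number *)

Section TorsionNumber.
Variables (G : zmodType) (g : G).
Local Notation Gbar := ({ideal_quot (multiples g)} : zmodType).
Let pi (x : G) : Gbar := \pi_{ideal_quot (multiples g)} x.

Lemma multiplesP x : reflect (exists k : int, x = g *~ k) (x \in multiples g).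
Proof. exact: asboolP. Qed.

Lemma quotient_pi_eq0 x : pi x = 0 <-> exists k : int, x = g *~ k.
Proof.
have -> : (0 : Gbar) = pi 0 by rewrite [RHS](raddf0 \pi_{ideal_quot (multiples g)}).
split=> [/eqP|/multiplesP xg].
  by rewrite -Quotient.idealrBE subr0 => /multiplesP.
by apply/eqP; rewrite -Quotient.idealrBE subr0.
Qed.

Lemma quotient_pi_surj (y : Gbar) : exists x, pi x = y.
Proof. by exists (repr y); rewrite /pi reprK. Qed.

Lemma quotient_pi_comb n (u : 'I_n -> G) c : pi (comb u c) = comb (pi \o u) c.
Proof.
rewrite /pi /comb (raddf_sum \pi_{ideal_quot (multiples g)}); apply: eq_bigr => i _.
exact: (raddfMz \pi_{ideal_quot (multiples g)}).
Qed.

Lemma quotient_presented n (u : 'I_n -> G) m (A : 'M[int]_(m, n)) c :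
  presented_by u A -> g = comb u c -> presented_by (pi \o u) (col_mx A c).
Proof.
move=> [uG uA] gc; split=> [y|x].
  have [x <-] := quotient_pi_surj y; have [d ->] := uG x; exists d.
  exact: quotient_pi_comb.
rewrite -[\sum_i _]/(comb (pi \o u) x) -quotient_pi_comb.
apply: (iff_trans (quotient_pi_eq0 _)); split=> [[k xk]|[b ->]].
  have /uA[b bE] : comb u (x - k%:M *m c) = 0.
    rewrite combB comb_mul xk /comb big_ord1 -/(comb u _) mxE eqxx mulr1n.
    rewrite -/(comb u (row 0 c)) (_ : row 0 c = c) -?gc ?subrr //.
    by apply/rowP => i; rewrite mxE.
  by exists (row_mx b k%:M); rewrite mul_row_col -bE subrK.
rewrite -[b]hsubmxK mul_row_col combD.
have -> : comb u (lsubmx b *m A) = 0 by apply/uA; exists (lsubmx b).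
exists (rsubmx b 0 0); rewrite add0r comb_mul /comb big_ord1 -/(comb u _).
by rewrite [in RHS]gc; congr (comb u _ *~ _); apply/rowP => i; rewrite mxE.
Qed.

Lemma fitting_ideal_quotient0 i : g = 0 -> fitting_ideal i G = fitting_ideal i Gbar.
Proof.
move=> g0; have pi0 x : pi x = 0 -> x = 0.
  by move=> /quotient_pi_eq0[k ->]; rewrite g0 mul0rz.
have piI x y : pi x = pi y -> x = y.
  move=> xy; apply/eqP; rewrite -subr_eq0; apply/eqP/pi0.
  by rewrite [LHS](raddfB \pi_{ideal_quot (multiples g)}) [X in X - _]xy subrr.
apply/predeqP => z; split=> [[n [u [m [A [[uG uA] Az]]]]]|[n [v [m [A [[vG vA] Az]]]]]].
  exists n, (pi \o u), m, A; split=> //; split=> [y|x].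
    have [x <-] := quotient_pi_surj y; have [c ->] := uG x; exists c.
    exact: quotient_pi_comb.
  rewrite -uA -[X in X = 0 <-> _]/(comb (pi \o u) x) -quotient_pi_comb.
  split=> [/pi0 //|]; rewrite -/(comb u x) => ->.
  exact: (raddf0 \pi_{ideal_quot (multiples g)}).
have /choice[u uP] := fun i => quotient_pi_surj (v i).
have uv c : pi (comb u c) = comb v c.
  by rewrite quotient_pi_comb; apply: eq_comb.
exists n, u, m, A; split=> //; split=> [x|x].
  by have [c cE] := vG (pi x); exists c; apply: piI; rewrite cE; exact: esym (uv c).
rewrite -vA -[X in _ <-> X = 0]/(comb v x) -uv -/(comb u x); split=> [->|/pi0 //].
exact: (raddf0 \pi_{ideal_quot (multiples g)}).
Qed.

Lemma smith_relation n m (A : 'M[int]_(m, n)) (c : 'rV[int]_n) k :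
    (exists2 z, z != 0 & minor_ideal A k z) ->
    (forall z, minor_ideal (col_mx A c) k.+1 z -> z = 0) ->
    minor_ideal (col_mx A c) k `<=` minor_ideal A k ->
  exists b, c = b *m A.
Proof.
have [L L1 [R R1 [d d_sorted AE]]] := int_Smith_normal_form A.
set D := \matrix_(i, j) _ in AE.
have DE : D = invmx L *m A *m invmx R.
  by rewrite AE -mulmxA mulmxK // mulKmx.
have AD l : minor_ideal A l `<=` minor_ideal D l.
  by move=> z; rewrite AE => /minor_ideal_mulr /minor_ideal_mull.
have DA l : minor_ideal (col_mx D (c *m invmx R)) l `<=` minor_ideal (col_mx A c) l.
  have -> : col_mx D (c *m invmx R) =
      block_mx (invmx L) 0 0 1%:M *m col_mx A c *m invmx R.
    by rewrite mul_block_col !mul0mx addr0 add0r mul1mx mul_col_mx DE.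
  by move=> z /minor_ideal_mulr /minor_ideal_mull.
move=> [z z0 Az] Ac0 AcA.
have [||//|b bE] := @smith_row m n d (c *m invmx R) k d_sorted.
- by exists z => //; apply: AD.
- by move=> y /DA; apply: Ac0.
- by move=> y /DA /AcA; apply: AD.
exists (b *m invmx L); rewrite AE !mulmxA mulmxKV // -bE mulmxKV //.
Qed.

(** The value 0 could come from equal Fitting ideals or from a zero generator; the second is
    excluded by a nonzero minor of size equal to the rank of [A; c]. *)
Lemma torsion_number_eq0 : fg_group G -> torsion_number g = 0%N <-> g = 0.
Proof.
move=> G_fg; rewrite /torsion_number; split=> [|g0]; last first.
  by rewrite asboolT //; exact: fitting_ideal_quotient0.
have [n [u [m [A uA]]]] := fg_presented G_fg.
have [c gc] := uA.1 g; rewrite -/(comb u c) in gc.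
have uAc := quotient_presented uA gc.
have r_le : (rat_rank (col_mx A c) <= n)%N by exact: rank_leq_col.
have rE : (n - rank Gbar = rat_rank (col_mx A c))%N.
  by rewrite (rank_presented uAc) subKn.
have fitG := fitting_ideal_presented (rank Gbar) uA.
have fitGbar := fitting_ideal_presented (rank Gbar) uAc.
rewrite rE in fitG fitGbar.
have [z z0 Az] := minor_rank_neq0 (col_mx A c).
case: asboolP => [fitE _|_ t0].
  rewrite fitG fitGbar in fitE.
  have [||//|b cE] := @smith_relation n m A c (rat_rank (col_mx A c)).
  (* Equality of the ideals puts the nonzero minor [z] into that of [A], so adjoining [c] does not
     raise the rank. *)
  - by exists z; rewrite // fitE.
  - by move=> y; apply: minor_rank0.
  - by move=> y; rewrite fitE.
  by rewrite gc; apply/uA.2; exists b.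
have [d dE] := int_ideal_principal (minor_ideal_submod (col_mx A c) (rat_rank (col_mx A
  c))).
(* By [dE] a generator exists, so the value 0 of [xget] is a true generator and not its default. *)
have : [set d : nat | fitting_ideal (rank Gbar) Gbar = [set z : int | (d%:Z %| z)%Z]] 0%N.
  by rewrite -[X in _ X]t0; apply: (xgetPex 0%N); exists d; rewrite /= fitGbar.
rewrite /= fitGbar => fit0; rewrite fit0 /= dvd0z in Az.
by rewrite Az in z0.
Qed.

End TorsionNumber.

(** * The canonical class *)

Lemma eq_maximal_ideal (R : comNzRingType) (m p : {pred R}) :
  p =i m -> maximal_ideal m -> maximal_ideal p.
Proof.
move=> pm [[m0 m1 mD] mmax]; split; first split; rewrite ?pm //.
  by move=> a x y; rewrite !pm; apply: mD.
move=> J JI pJ x Jx; rewrite pm; apply: (mmax J) Jx => // y.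
by rewrite -pm; apply: pJ.
Qed.

Lemma gorenstein_localization_cyclic (R : idomainType) (M : lmodType R)
    (p : prime_idealr R) :
    noetherian R -> cohen_macaulay R -> gorenstein R -> canonical_module M ->
    maximal_ideal p ->
  exists w0 : M, forall w, exists t a, t \notin p /\ t *: w = a *: w0.
Proof.
move=> hR CM Gor [_ MC] pM; have [N [f [fN NC]]] := MC p pM.
have [n nP] := canonical_module_cyclic (loc_noetherian (p := p) hR)
  (@loc_nonunits_add R p) (CM p pM) (Gor p pM) NC.
exact: localization_cyclic fN nP.
Qed.

Lemma gorenstein_canonical_cyclic (R : idomainType) (S : setting R) (M : lmodType R) :
    cohen_macaulay R -> gorenstein R -> canonical_module_in S M ->
    (forall (a : R) (x : M), a *: x = 0 -> a = 0 \/ x = 0) ->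
  exists w0 : M, forall w, exists a, w = a *: w0.
Proof.
have hR := setting_noetherian S; move=> CM Gor MC M_tf.
case: S MC => [R_noeth R_local|K iota G R_graded fgR] /=.
  have [m [mM m_uniq]] := R_local => MC; have [p pm] := maximal_ideal_prime mM.
  have [w0 w0P] := gorenstein_localization_cyclic hR CM Gor MC (eq_maximal_ideal pm mM).
  exists w0 => w; have [t [a [pt twa]]] := w0P w.
  have [|u ut] := local_unit (t := t) hR mM m_uniq; first by rewrite -pm.
  by exists (u * a); rewrite -scalerA -twa scalerA ut scale1r.
move=> [MC [H M_graded]]; have [Gg _ _] := R_graded;
  have [SR [cR cRP]] := components_exist Gg.
have mM := irrelevant_ideal_maximal R_graded cRP.
have [p pm] := maximal_ideal_prime mM.
have [w0 w0P] := gorenstein_localization_cyclic hR CM Gor MC (eq_maximal_ideal pm mM).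
apply: (graded_cyclic R_graded cRP M_graded M_tf (w0 := w0)) => w.
by have [t [a [pt twa]]] := w0P w; exists t, a; rewrite -pm.
Qed.

Lemma div_class_eq0 (R : idomainType) (hN : noetherian R) (hI : integrally_closed R)
    (I : divisorial_ideal R) :
  div_class hN hI I = 0 <-> exists x : {fraction R}, x != 0 /\
    forall y, ideal_set I y <-> base_ring (y / x).
Proof.
have -> : (0 : Cl hN hI) = \pi_{ideal_quot (principal (hN := hN) (hI := hI))} 0.
  by rewrite [RHS](raddf0 \pi_{ideal_quot _}).
split=> [/eqP|/(principalP (I : Div hN hI)) Ip].
  by rewrite -Quotient.idealrBE subr0 => /principalP.
by apply/eqP; rewrite -Quotient.idealrBE subr0.
Qed.

Section IdealGenerator.
Variables (R : idomainType) (M : lmodType R) (W : divisorial_ideal R).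
Variables (e : {linear M -> R^o}) (e_inj : injective e).
Hypothesis W_M : forall x : {fraction R},
  ideal_set W x <-> exists w, x = (e w : R)%:F.

Lemma embedded_torsion_free (a : R) (x : M) : a *: x = 0 -> a = 0 \/ x = 0.
Proof.
move/(congr1 e); rewrite linearZ linear0 => /eqP.
rewrite mulf_eq0 => /orP[/eqP|/eqP ex]; [by left|right].
by apply: e_inj; rewrite linear0.
Qed.

Lemma principal_cyclic :
  (exists x : {fraction R}, x != 0 /\ forall y, ideal_set W y <-> base_ring (y / x)) <->
  exists2 w0 : M, w0 != 0 & forall w, exists a, w = a *: w0.
Proof.
split=> [[x [x0 Wx]]|[w0 w00 w0P]].
  have /W_M[w0 xE] : ideal_set W x by apply/Wx; rewrite divff //; exact: base_ring1.
  exists w0 => [|w].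
    by apply: contraNneq x0 => w00; rewrite xE w00 linear0 tofrac0.
  have /Wx[a wa] : ideal_set W (e w : R)%:F by apply/W_M; exists w.
  have ew : (e w : R) = a * (e w0 : R).
    apply/eqP; rewrite -tofrac_eq; apply/eqP.
    by rewrite tofracM -wa -xE divfK.
  by exists a; apply: e_inj; rewrite linearZ.
have x0 : (e w0 : R)%:F != 0.
  by rewrite tofrac_eq0; apply: contraNneq w00 => ew0; apply/eqP/e_inj;
    rewrite ew0 linear0.
exists (e w0 : R)%:F; split=> // y; split=> [/W_M[w ->]|[a ya]].
  have [a ->] := w0P w; exists a; rewrite linearZ.
  by rewrite -[X in X / _]/((a * (e w0 : R))%:F) tofracM mulfK.
apply/W_M; exists (a *: w0); rewrite linearZ -(divfK x0 y) ya -tofracM //.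
Qed.

End IdealGenerator.

Theorem lemma1p1 (R : idomainType) (S : setting R)
  (R_normal : integrally_closed R) (R_CM : cohen_macaulay R)
  (omega : lmodType R) (omega_canonical : canonical_module_in S omega)
  (W : divisorial_ideal R) (e : {linear omega -> R^o}) (e_inj : injective e)
  (W_omega : forall x : {fraction R}, ideal_set W x <-> exists w, x = (e w : R)%:F)
  (Cl_fg : fg_group (Cl (setting_noetherian S) R_normal)) :
  gorenstein R <->
  torsion_number (div_class (setting_noetherian S) R_normal W) = 0%N.
Proof.
have omega_tf := embedded_torsion_free e_inj.
apply: iff_trans (iff_sym (torsion_number_eq0 _ Cl_fg)).
apply: iff_trans (iff_sym (div_class_eq0 _ _ _)).
apply: iff_trans (iff_sym (principal_cyclic e_inj W_omega)).
split=> [Gor|[w0 w00 w0P] p pM].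
  have [w0 w0P] := gorenstein_canonical_cyclic R_CM Gor omega_canonical omega_tf.
  exists w0 => //; have [[_ _ [x Wx x0] _] _] := divP W.
  apply: contraNneq x0 => w00; have /W_omega[w ->] := Wx.
  by have [a ->] := w0P w; rewrite w00 scaler0 linear0 tofrac0.
have [_ /(_ p pM)[N [f [fN [_ _ N_inj]]]]] : canonical_module omega.
  by case: (S) omega_canonical => // K iota G ? ? [].
apply: localization_injdim fN _ w0P N_inj => a /omega_tf[//|w00'].
by rewrite w00' eqxx in w00.
Qed.
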